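(* Let $\bar Y^k$ and $Y^{N,k}$ ($N,k\in\mathbb{N}^*$) be $D(\mathbb{R}_+,\mathbb{R}_+)$-valued random variables. Let $(\pi^k)_{k\in\mathbb{N}^*}$ and $(\bar\pi^k)_{k\in\mathbb{N}^*}$ be i.i.d. families of Poisson measures on $\mathbb{R}_+\times\mathbb{R}_+$ having Lebesgue intensity. Define the point processes, for $t\ge 0$ and $k\geq 1$, $$Z^{N,k}_t:=\int_{[0,t]\times\mathbb{R}_+}\mathbf{1}_{\{z\leq Y^{N,k}_{s-}\}}\,d\pi^k(s,z),\qquad \bar Z^k_t:=\int_{[0,t]\times\mathbb{R}_+}\mathbf{1}_{\{z\leq \bar Y^{k}_{s-}\}}\,d\bar\pi^k(s,z).$$ Assume that, for every $n\geq 1$, $(Y^{N,1},\pi^1,\ldots,Y^{N,n},\pi^n)$ converges in distribution, as $N\to\infty$, to $(\bar Y^1,\bar\pi^1,\ldots,\bar Y^n,\bar\pi^n)$ in $(D(\mathbb{R}_+,\mathbb{R})\times\mathcal{N})^n$, and that, for each $k\geq 1$, $\bar Y^k$ is independent of $\bar\pi^k$. Then, for any $n\geq 1$, $(Z^{N,k})_{1\leq k\leq n}$ converges to $(\bar Z^k)_{1\leq k\leq n}$ in distribution in $D(\mathbb{R}_+,\mathbb{R}^n)$ as $N\to\infty$. In particular, $(Z^{N,k})_{k\geq 1}$ converges to $(\bar Z^k)_{k\geq 1}$ in distribution in $D(\mathbb{R}_+,\mathbb{R})^{\mathbb{N}^*}$ endowed with the product topology.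
   Context: $\mathbb{R}_+=[0,\infty)$ and $\mathbb{N}^*=\{1,2,\ldots\}$. For $E\subseteq\mathbb{R}^n$, $D(\mathbb{R}_+,E)$ is the space of càdlàg functions $\mathbb{R}_+\to E$ endowed with the Skorohod ($J_1$) topology; in particular $D(\mathbb{R}_+,\mathbb{R}^n)$ carries the Skorohod topology for $\mathbb{R}^n$-valued functions (one common time change for all coordinates), which is finer than the product topology of $D(\mathbb{R}_+,\mathbb{R})^n$. For a càdlàg function $y$, $y_{s-}$ denotes its left limit at $s$ (with, say, $y_{0-}:=y_0$; a.s. the Poisson measures have no atom at time $0$). $\mathcal{M}$ is the space of locally finite measures on $\mathbb{R}_+^2$ endowed with the topology of vague convergence (convergence of integrals of continuous compactly supported functions on $\mathbb{R}_+^2$), and $\mathcal{N}\subset\mathcal{M}$ is the subspace of locally finite simple point measures (sums of Dirac masses at distinct points, finitely many in each bounded set). Products such as $(D(\mathbb{R}_+,\mathbb{R})\times\mathcal{N})^n$ carry the product topology. A Poisson measure on $\mathbb{R}_+^2$ is a locally finite random measure $\pi$ (an $\mathcal{M}$-valued random variable, $\mathcal M$ having the $\sigma$-algebra generated by the evaluations $\pi\mapsto\pi(B)$, $B$ Borel) such that $\pi(B)$ is Poisson distributed for every Borel set $B$ (parameter $+\infty$ allowed, meaning $\pi(B)=+\infty$ a.s.), and $\pi(B_1),\ldots,\pi(B_n)$ are independent for disjoint Borel sets $B_1,\ldots,B_n$. Its intensity is the measure $B\mapsto\mathbb{E}[\pi(B)]$. Poisson measures with Lebesgue intensity are (a.s.)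 $\mathcal{N}$-valued. For each $N$, the processes $Y^{N,k}$ and the measures $\pi^k$ ($k\ge1$) are defined on a common probability space, and so are the $\bar Y^k$ and $\bar\pi^k$; the $Y^{N,k}$ are not assumed to be independent of the $\pi^k$. *)

(* Defs.v *)
From HB Require Import structures.
From mathcomp Require Import all_boot all_order all_algebra finmap.
From mathcomp Require Import all_classical all_reals all_analysis.
From mathcomp Require Import measurable_realfun.

Set Implicit Arguments.
Unset Strict Implicit.
Unset Printing Implicit Defensive.

Import Order.TTheory GRing.Theory Num.Theory.
Import numFieldNormedType.Exports.

Local Open Scope classical_set_scope.
Local Open Scope ring_scope.

Section cadlag_paths.
Context {R : realType}.

(* A path R_+ -> V is encoded as its extension to R that is constant on
   ]-oo, 0]. Left limits at 0 then exist and follow the usual convention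
   y_{0-} = y_0. *)
Definition is_cadlag (V : normedModType R) (f : R -> V) : Prop :=
  [/\ forall t, 0 <= t -> f s @[s --> t^'+] --> f t,
      forall t, 0 < t -> cvg (f s @[s --> t^'-])
    & forall t, t < 0 -> f t = f 0].

Record cadlag (V : normedModType R) := Cadlag {
  cadlag_fun :> R -> V;
  cadlag_funP : is_cadlag cadlag_fun }.

Lemma is_cadlag_cst (V : normedModType R) (v : V) : is_cadlag (fun=> v).
Proof. by split=> [t _|t _|//]; [exact: cvg_cst|exact: is_cvg_cst]. Qed.

HB.instance Definition _ (V : normedModType R) := gen_eqMixin (cadlag V).
HB.instance Definition _ (V : normedModType R) := gen_choiceMixin (cadlag V).
HB.instance Definition _ (V : normedModType R) :=
  isPointed.Build (cadlag V) (Cadlag (is_cadlag_cst 0)).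

Definition left_limit (V : normedModType R) (y : cadlag V) (s : R) : V :=
  lim (y r @[r --> s^'-]).

Definition time_change (lam : R -> R) : Prop :=
  {in `[0, +oo[ &, {homo lam : s t / s < t}} /\
  lam @` `[0, +oo[%classic = `[0, +oo[%classic.

(* One time change is used for all the coordinates of V = R^n. By Ethier and
   Kurtz, Markov Processes, Proposition 3.5.3 (a) <-> (c), a sequence converges
   to x for the Skorohod J1 metric iff it is eventually in each of the sets
   J1_ball x T e; since T can be taken integer and e of the form 1/m, these sets
   form a basis of the filter of J1-neighbourhoods of x. *)
Definition J1_ball (V : normedModType R) (x : cadlag V) (T e : R) :
    set (cadlag V) :=
  [set y | exists2 lam, time_change lam &
    forall t, 0 <= t <= T -> `|lam t - t| < e /\ `|y t - x (lam t)| < e].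

Definition J1_open (V : normedModType R) : set_system (cadlag V) :=
  [set A | forall x, A x -> exists T e, 0 < e /\ J1_ball x T e `<=` A].

Lemma J1_ballS (V : normedModType R) (x : cadlag V) (T T' e e' : R) :
  T' <= T -> e <= e' -> J1_ball x T e `<=` J1_ball x T' e'.
Proof.
move=> TT' ee' y [lam hlam h]; exists lam => // t /andP[t0 tT].
have [|h1 h2] := h t; first by rewrite t0 (le_trans tT).
by split; exact: lt_le_trans ee'.
Qed.

Lemma J1_openT (V : normedModType R) : @J1_open V setT.
Proof. by move=> x _; exists 0, 1; split. Qed.

Lemma J1_openI (V : normedModType R) : setI_closed (@J1_open V).
Proof.
move=> A B oA oB x [/oA[T [e [e0 hA]]] /oB[T' [e' [e'0 hB]]]].
exists (Num.max T T'), (Num.min e e'); split; first by rewrite lt_min e0.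
rewrite subsetI; split.
- by apply: subset_trans hA; apply: J1_ballS; rewrite ?le_max ?ge_min lexx.
- by apply: subset_trans hB; apply: J1_ballS;
    rewrite ?le_max ?ge_min lexx orbT.
Qed.

Lemma J1_open_bigcup (V : normedModType R) (I : Type) (f : I -> set (cadlag V)) :
  (forall i, J1_open (f i)) -> J1_open (\bigcup_i f i).
Proof.
move=> of_ x [i _ /of_[T [e [e0 h]]]]; exists T, e; split=> //.
by apply: subset_trans h _ => y fy; exists i.
Qed.

HB.instance Definition _ (V : normedModType R) :=
  isOpenTopological.Build (cadlag V)
    (@J1_openT V) (@J1_openI V) (@J1_open_bigcup V).

HB.instance Definition _ (V : normedModType R) :=
  @isMeasurable.Build (sigma_display (@open (cadlag V))) (cadlag V)
    <<s @open (cadlag V) >> (@sigma_algebra0 _ setT _)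
    (@sigma_algebraC _ _) (@sigma_algebra_bigcup _ setT _).

Lemma cvg_row (n : nat) (F : set_system R) (f : 'I_n -> R -> R) (l : 'I_n -> R) :
  Filter F -> (forall i, f i @ F --> l i) ->
  (fun t => \row_i f i t) @ F --> \row_i l i.
Proof.
move=> FF fl A [P lP PA].
have : \forall t \near F, forall i, P ord0 i (f i t).
  apply: filter_forall => i; apply: (fl i).
  by have := lP ord0 i; rewrite mxE.
by apply: filterS => t Pt; apply: PA => i j; rewrite ord1 mxE.
Qed.

Lemma is_cadlag_row (n : nat) (y : 'I_n -> cadlag R) :
  is_cadlag (fun t => \row_i y i t).
Proof.
split=> [t t0|t t0|t t0].
- by apply: cvg_row => i; have [+ _ _] := cadlag_funP (y i); exact.
- apply/cvg_ex; exists (\row_i left_limit (y i) t); apply: cvg_row => i.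
  by have [_ + _] := cadlag_funP (y i); exact.
- apply/rowP => i; rewrite !mxE.
  by have [_ _ +] := cadlag_funP (y i); exact.
Qed.

Definition cadlag_row (n : nat) (y : 'I_n -> cadlag R) : cadlag 'rV[R]_n :=
  Cadlag (is_cadlag_row y).

End cadlag_paths.

Section measures_on_the_quadrant.
Variable R : realType.

Definition quadrant : set (R * R) := [set p | 0 <= p.1 /\ 0 <= p.2].

Definition box (r : R) : set (R * R) :=
  [set p | 0 <= p.1 <= r /\ 0 <= p.2 <= r].

(* The measures on R_+^2 are the measures on R^2 that do not charge the
   complement of R_+^2. A library measure also takes (irrelevant) values on
   non-measurable sets, so two records may represent the same measure; they are
   then indistinguishable for both the topology and the sigma-algebra below. *)
Record lfmeasure := LFMeasure {
  lfmeasure_measure :> {measure set (R * R) -> \bar R};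
  lfmeasure_quadrant : lfmeasure_measure (~` quadrant) = 0%E;
  lfmeasure_box : forall r, (lfmeasure_measure (box r) < +oo)%E }.

Definition lfmeasure0 : lfmeasure :=
  @LFMeasure mzero erefl (fun=> ltry 0).

HB.instance Definition _ := gen_eqMixin lfmeasure.
HB.instance Definition _ := gen_choiceMixin lfmeasure.
HB.instance Definition _ := isPointed.Build lfmeasure lfmeasure0.

(* Only the restriction of f to R_+^2 matters. *)
Definition test_function : set (R * R -> R) :=
  [set f | {within quadrant, continuous f} /\
    exists2 K, compact K & forall p, quadrant p -> ~ K p -> f p = 0].

Definition vague_eval (mu : lfmeasure) :
    prod_topology (fun _ : set_type test_function => R) :=
  fun f => \int[mu]_(p in quadrant) (set_val f p).

HB.instance Definition _ :=
  Topological.copy lfmeasure (initial_topology vague_eval).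

Definition lfmeasure_evals : set_system lfmeasure :=
  [set C | exists (B : set (R * R)) (U : set \bar R),
     [/\ measurable B, measurable U &
     C = (fun mu : lfmeasure => mu B) @^-1` U]].

HB.instance Definition _ :=
  @isMeasurable.Build (sigma_display lfmeasure_evals) lfmeasure
    <<s lfmeasure_evals >> (@sigma_algebra0 _ setT _)
    (@sigma_algebraC _ _) (@sigma_algebra_bigcup _ setT _).

Definition simple_point_measure : set lfmeasure :=
  [set mu | exists S : set (R * R),
    [/\ S `<=` quadrant, forall r, finite_set (S `&` box r) &
        forall B, measurable B -> mu B = counting (S `&` B)]].

End measures_on_the_quadrant.
Arguments quadrant {R}.
Arguments simple_point_measure {R}.

Section point_process.
Variable R : realType.
Implicit Types (y : cadlag R) (mu : lfmeasure R).

Lemma cadlag_bounded y (T : R) :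
  exists M, forall s, 0 <= s <= T -> `|y s| <= M.
Proof.
have [yr yl yN] := cadlag_funP y.
have : \forall M \near +oo, `[0, T]%classic `<=` [set s | `|y s| <= M].
  have /compact_near_coveringP := @segment_compact R 0 T.
  move=> /(_ R (+oo : set_system R) (fun M s => `|y s| <= M)); apply.
  move=> x /=; rewrite in_itv/= => /andP[x0 xT].
  have [L yL] : exists L, \forall s \near x^'-, `|y s| <= L.
    move: x0; rewrite le_eqVlt => /predU1P[<-|/yl/cvg_ex[l yl']].
      exists `|y 0|; near=> s; rewrite yN//.
    exists (`|l| + 1); apply: cvgr_norm_le yl' _ _ => //; by rewrite ltrDl.
  have yR : \forall s \near x^'+, `|y s| <= `|y x| + 1.
    apply: cvgr_norm_le (yr x x0) _ _ => //; by rewrite ltrDl.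
  pose M0 := Num.max L (`|y x| + 1).
  exists ([set s | `|y s| <= M0], [set M | M0 <= M]) => /=.
    split; last exact: nbhs_pinfty_ge (num_real _).
    have yL' : \forall s \near x, s < x -> `|y s| <= L := yL.
    have yR' : \forall s \near x, x < s -> `|y s| <= `|y x| + 1 := yR.
    apply: filterS2 yL' yR' => s hL hR /=; rewrite /M0 le_max.
    have [sx|xs|->] := ltgtP s x; first by rewrite hL.
    - by rewrite hR ?orbT.
    - by rewrite lerDl ler01 orbT.
  by move=> [s M] /= [h1 h2]; exact: le_trans h2.
move=> /filter_ex[M h]; exists M => s sT; apply: h.
by rewrite /= in_itv.
Unshelve. all: by end_near. Qed.

Lemma cadlag_measurable y : measurable_fun setT y.
Proof.
have [yr yl yN] := cadlag_funP y.
pose k n (s : R) := Num.truncn (n.+1%:R * s).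
pose h n (s : R) : R := y ((k n s).+1%:R / n.+1%:R).
have mk n : measurable_fun setT (fun s => (k n s)%:R : R).
  apply: nondecreasing_measurable => // s t st.
  by rewrite ler_nat le_truncn// ler_pM2l.
apply: (@measurable_fun_cvg _ _ _ _ h).
  move=> n _ B mB; rewrite setTI.
  rewrite (_ : h n @^-1` B = \bigcup_(j in [set j | B (y (j.+1%:R / n.+1%:R))])
      ((fun s => (k n s)%:R : R) @^-1` [set j%:R])); last first.
    apply/seteqP; split=> [s hs|s [j Bj]] /=; first by exists (k n s).
    by move=> /eqP; rewrite eqr_nat => /eqP kj; rewrite /h kj.
  apply: bigcup_measurable => j _.
  by rewrite -[X in measurable X]setTI; apply: mk.
move=> s _.
have ns0 : (n.+1%:R : R)^-1 @[n --> \oo] --> (0 : R).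
  exact: cvg_harmonic.
have [s0|s0] := leP 0 s.
  have ks n : s < (k n s).+1%:R / n.+1%:R <= s + n.+1%:R^-1.
    apply/andP; split; first by rewrite ltr_pdivlMr// mulrC truncnS_gt.
    rewrite ler_pdivrMr// mulrDl mulVf ?pnatr_eq0// -natr1 lerD2r [s * _]mulrC.
    by rewrite truncn_le mulr_ge0.
  have /cvg_at_rightP := yr s s0; apply; split.
    by move=> n; have /andP[] := ks n.
  apply: (@squeeze_cvgr _ _ _ _ (cst s) (fun n => s + n.+1%:R^-1)).
  - by near=> n; have /andP[/ltW -> ->] := ks n.
  - exact: cvg_cst.
  - by rewrite -[X in _ --> X]addr0; apply: cvgD => //; exact: cvg_cst.
rewrite yN//.
have hE n : h n s = y (n.+1%:R^-1).
  rewrite /h /k (_ : Num.truncn _ = 0%N) ?mul1r//.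
  by apply/truncn0Pn; rewrite -ltNge (lt_trans _ ltr01)// pmulr_rlt0.
rewrite (_ : (fun n => h n s) = (fun n => y n.+1%:R^-1)); last exact/funext.
have /cvg_at_rightP := yr 0 (lexx _); apply; split=> // n.
Unshelve. all: by end_near. Qed.

Lemma left_limit_cvg y s : y r @[r --> s^'-] --> left_limit y s.
Proof.
have [yr yl yN] := cadlag_funP y.
have [s0|s0] := ltP 0 s; first exact: yl.
suff : y r @[r --> s^'-] --> y 0 by move=> h; apply/cvg_ex; exists (y 0).
apply: cvg_near_cst; near=> r; apply: yN.
by apply: lt_le_trans s0; near: r; exact: nbhs_left_lt.
Unshelve. all: by end_near. Qed.

Lemma left_limit_measurable y : measurable_fun setT (left_limit y : R -> R).
Proof.
apply: (@measurable_fun_cvg _ R R _ (fun n s => y (s - n.+1%:R^-1)) (left_limit y : R -> R)).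
  move=> n; apply: (measurableT_comp (cadlag_measurable y)).
  exact: measurable_funB.
move=> s _; have /cvg_at_leftP := left_limit_cvg (y := y) (s := s); apply; split.
  by move=> n; rewrite ltrBlDr ltrDl.
rewrite -[X in _ --> X]subr0; apply: cvgB; first exact: cvg_cst.
exact: cvg_harmonic.
Qed.

(* The integral over [0, t] x R_+ for 0 <= t, extended by its value at 0. *)
Definition point_process_fun y mu (t : R) : R :=
  \int[mu]_(p in [set p | 0 <= p.1 <= Num.max 0 t /\ 0 <= p.2])
    \1_[set p | p.2 <= left_limit y p.1] p.

Let D (t : R) : set (R * R) := [set p | 0 <= p.1 <= t /\ 0 <= p.2].
Let G y : set (R * R) := [set p | p.2 <= left_limit y p.1].

Let measurable_D t : measurable (D t).
Proof.
rewrite (_ : D t = `[0, t]%classic `*` `[0, +oo[%classic).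
  exact: measurableX.
by apply/seteqP; split=> p /=; rewrite !in_itv/= andbT.
Qed.

Let measurable_G y : measurable (G y).
Proof.
rewrite (_ : G y = setT `&`
    (fun p : R * R => p.2 <= left_limit y p.1) @^-1` [set true]); last first.
  by rewrite setTI.
apply: measurable_fun_ler => //.
exact: (measurableT_comp (left_limit_measurable y) measurable_fst).
Qed.

Let point_process_funE y mu t :
  point_process_fun y mu t = fine (mu (G y `&` D (Num.max 0 t))).
Proof.
rewrite /point_process_fun /Rintegral (integral_indic mu (measurable_D _))//.
exact: measurable_G.
Qed.

Let left_limit_le y (T M s : R) : (forall r, 0 <= r <= T -> `|y r| <= M) ->
  0 <= s <= T -> left_limit y s <= M.
Proof.
move=> yM /andP[s0 sT]; apply: limr_le.
  by apply/cvg_ex; exists (left_limit y s); exact: left_limit_cvg.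
near=> r; have rs : r <= s by near: r; exact: nbhs_left_le.
apply: le_trans (ler_norm _) _; have [r0|r0] := leP 0 r.
  by apply: yM; rewrite r0 (le_trans rs).
have [_ _ yN] := cadlag_funP y.
by rewrite yN//; apply: yM; rewrite lexx (le_trans s0).
Unshelve. all: by end_near. Qed.

Let fin_GD y mu t : (mu (G y `&` D t) < +oo)%E.
Proof.
have [M yM] := cadlag_bounded y t.
pose r := Num.max t M.
apply: le_lt_trans (lfmeasure_box mu r); apply: le_measure; rewrite ?inE.
- exact: measurableI.
- rewrite (_ : box r = `[0, r]%classic `*` `[0, r]%classic).
    exact: measurableX.
  by apply/seteqP; split=> p /=; rewrite !in_itv.
- move=> p [Gp [/andP[p0 pt] p20]]; split.
    by rewrite p0 /r le_max pt.
  rewrite p20 /r le_max; apply/orP; right.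
  by apply: le_trans Gp _; apply: left_limit_le yM _; rewrite p0.
Qed.

Let fin_num_GD y mu t : mu (G y `&` D t) \is a fin_num.
Proof. by rewrite ge0_fin_numE// fin_GD. Qed.

Let le_point_process_fun y mu :
  {homo point_process_fun y mu : s t / s <= t}.
Proof.
move=> s t st; rewrite !point_process_funE fine_le ?fin_num_GD//.
apply: le_measure; rewrite ?inE; [exact: measurableI|exact: measurableI|].
apply: setIS => p [/andP[p0 ps] p2]; split=> //; rewrite p0/= (le_trans ps)//.
by rewrite ge_max !le_max lexx st/= orbT.
Qed.

Lemma is_cadlag_point_process y mu : is_cadlag (point_process_fun y mu).
Proof.
split=> [t t0|t t0|t t0]; last by rewrite !point_process_funE max_l ?ltW// maxxx.
  have [l fl] : exists l : R, point_process_fun y mu s @[s --> t^'+] --> l.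
    exists (lim (point_process_fun y mu s @[s --> t^'+])).
    apply: (@nondecreasing_at_right_is_cvgr R (point_process_fun y mu) t).
      by near=> x => u v _ _; exact: le_point_process_fun.
    near=> x; exists (point_process_fun y mu t) => _ [s /= + <-].
    by rewrite in_itv/= => /andP[/ltW ts _]; exact: le_point_process_fun.
  have ul : point_process_fun y mu (t + n.+1%:R^-1) @[n --> \oo] --> l.
    move/cvg_at_rightP : fl; apply; split=> [n|]; first by rewrite ltrDl.
    rewrite -[X in _ --> X]addr0; apply: cvgD; first exact: cvg_cst.
    exact: cvg_harmonic.
  suff ut : point_process_fun y mu (t + n.+1%:R^-1) @[n --> \oo] -->
      point_process_fun y mu t by rewrite -(cvg_unique _ ul ut).
  pose F n := G y `&` D (t + n.+1%:R^-1).
  have tn n : 0 <= t + n.+1%:R^-1 :> R by rewrite addr_ge0.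
  have FE : \bigcap_n F n = G y `&` D t.
    apply/seteqP; split=> p.
      move=> Fp; split; first by have [] := Fp 0%N I.
      have [_ [/andP[p0 _] p2]] := Fp 0%N I; split=> //; rewrite p0/=.
      apply/ler_addgt0Pl => e e0.
      have [n ne] : exists n, (n.+1%:R : R)^-1 < e.
        near (\oo : set_system nat) => n; exists n; near: n.
        exact: near_infty_natSinv_lt (PosNum e0).
      have [_ [/andP[_ pn] _]] := Fp n I.
      by rewrite addrC (le_trans pn)// lerD2l ltW.
    move=> [Gp [/andP[p0 pt] p2]] n _; split=> //; split=> //.
    by rewrite p0/= (le_trans pt)// lerDl.
  rewrite point_process_funE max_r// -FE.
  under eq_fun do rewrite point_process_funE max_r//.
  apply: fine_cvg; rewrite fineK; last by rewrite FE fin_num_GD.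
  apply: (@nonincreasing_cvg_mu _ _ _ mu F).
  - exact: fin_GD.
  - by move=> n; exact: measurableI.
  - by apply: bigcap_measurable => // n _; exact: measurableI.
  - move=> n m nm; apply/subsetPset; apply: setIS.
    move=> p [/andP[p0 ps] p2]; split=> //; rewrite p0/= (le_trans ps)//.
    by rewrite lerD2l lef_pV2 ?posrE// ler_nat.
apply: nondecreasing_at_left_is_cvgr.
  by near=> x => u v _ _; exact: le_point_process_fun.
near=> x; exists (point_process_fun y mu t) => _ [s /= + <-].
by rewrite in_itv/= => /andP[_ /ltW st]; exact: le_point_process_fun.
Unshelve. all: by end_near. Qed.

Definition point_process y mu : cadlag R :=
  Cadlag (is_cadlag_point_process y mu).

End point_process.

Section probability.
Context {R : realType}.

(* X is a random element of E that almost surely lies in the subspace A, the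
   sets U `&` A with U open in E being the open sets of A. *)
Definition random_element_in (E : topologicalType) (A : set E)
    d (T : measurableType d) (P : probability T R) (X : T -> E) : Prop :=
  (forall U, open U -> measurable (X @^-1` (U `&` A))) /\
  P (X @^-1` A) = 1%E.

(* Convergence in distribution in the space A, with its subspace topology, of
   random elements that lie in A almost surely. *)
Definition cvg_in_distribution_in (E : topologicalType) (A : set E)
    (d : nat -> measure_display) (T : forall N, measurableType (d N))
    (P : forall N, probability (T N) R) (X : forall N, T N -> E)
    d' (T' : measurableType d') (P' : probability T' R) (X' : T' -> E) : Prop :=
  [/\ forall N, random_element_in A (P N) (X N),
      random_element_in A P' X'
    & forall f : E -> R, {within A, continuous f} ->
        (exists M, forall x, A x -> `|f x| <= M) ->
        (\int[P N]_(w in X N @^-1` A) (f (X N w))%:E)%E @[N --> \oo] -->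
        (\int[P']_(w in X' @^-1` A) (f (X' w))%:E)%E].

Definition cvg_in_distribution (E : topologicalType)
    (d : nat -> measure_display) (T : forall N, measurableType (d N))
    (P : forall N, probability (T N) R) (X : forall N, T N -> E)
    d' (T' : measurableType d') (P' : probability T' R) (X' : T' -> E) : Prop :=
  cvg_in_distribution_in [set: E] P X P' X'.

Context d (T : measurableType d) (P : probability T R).

Definition independent_RVs d1 d2 (T1 : measurableType d1)
    (T2 : measurableType d2) (X1 : T -> T1) (X2 : T -> T2) : Prop :=
  forall (B1 : set T1) (B2 : set T2), measurable B1 -> measurable B2 ->
  P (X1 @^-1` B1 `&` X2 @^-1` B2) = (P (X1 @^-1` B1) * P (X2 @^-1` B2))%E.

Definition mutually_independent_RVs (I : choiceType) d1
    (T1 : measurableType d1) (X : I -> T -> T1) : Prop :=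
  forall (J : {fset I}) (B : I -> set T1), (forall i, measurable (B i)) ->
  P (\bigcap_(i in [set` J]) (X i @^-1` B i)) =
  (\prod_(i <- J) P (X i @^-1` B i))%E.

Definition iid (I : choiceType) d1 (T1 : measurableType d1)
    (X : I -> T -> T1) : Prop :=
  mutually_independent_RVs X /\
  forall i j (B : set T1), measurable B -> P (X i @^-1` B) = P (X j @^-1` B).

(* The second argument of poisson_prob is a dummy. *)
Definition poisson_distributed (X : T -> \bar R) (m : \bar R) : Prop :=
  match m with
  | r%:E => (0 <= r)%R /\
      forall k : nat, P (X @^-1` [set k%:R%:E]) = poisson_prob r 0%N [set k]
  | +oo => P (X @^-1` [set +oo]) = 1
  | -oo => False
  end%E.

Definition is_poisson_measure (pi : {RV P >-> lfmeasure R}) : Prop :=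
  (forall B : set (R * R), measurable B -> B `<=` quadrant ->
     exists m, poisson_distributed (fun w => pi w B) m) /\
  (forall n (B : 'I_n -> set (R * R)),
     (forall i, measurable (B i) /\ B i `<=` quadrant) -> trivIset setT B ->
     mutually_independent_RVs (fun i w => pi w (B i))).

Definition intensity (pi : {RV P >-> lfmeasure R}) (B : set (R * R)) : \bar R :=
  (\int[P]_w pi w B)%E.

Definition has_lebesgue_intensity (pi : {RV P >-> lfmeasure R}) : Prop :=
  forall B : set (R * R), measurable B -> B `<=` quadrant ->
  intensity pi B = (lebesgue_measure \x lebesgue_measure)%E B.

End probability.

(* Main.v *)
Require Import Defs.
From HB Require Import structures.
From mathcomp Require Import all_boot all_order all_algebra finmap.
From mathcomp Require Import all_classical all_reals all_analysis.
From mathcomp Require Import measurable_realfun.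
From mathcomp Require Import ring lra.

Set Implicit Arguments.
Unset Strict Implicit.
Unset Printing Implicit Defensive.

Import Order.TTheory GRing.Theory Num.Theory.
Import numFieldNormedType.Exports.

Local Open Scope classical_set_scope.
Local Open Scope ring_scope.

(* The process Z^k is a function of (Y^k, pi^k), continuous at every generic pair:
   pi^k is a simple point measure without atom at time 0, no two atoms of the
   measures have the same time, and no atom (s, z) lies on the graph of Y^k
   completed by vertical segments, i.e. z is not between Y^k_{s-} and Y^k_s.
   Near a generic state each atom below a large level moves a little and stays on
   the same side of the path, so that one time change, equal to the identity
   outside of small disjoint windows around the finitely many atoms, maps the
   jumps of the perturbed processes exactly to those of the limit ones.

   The limit state is almost surely generic, by covering with a grid of mesh 1/m:
   two atoms share a column with probability O(1/m), and, by independence of Y^k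
   and pi^k, an atom shares a cell with the completed graph of Y^k with
   probability at most the expected area of the cells meeting this graph, which
   vanishes as m tends to infinity because cadlag paths have few oscillations.

   The mapping theorem is proved without metrizing the state space. Only
   countably many continuous functionals are needed to express that a state is
   close to a generic one: integrals of bumps against pi^k, and suprema of Y^k
   over windows. A bounded function of the jumps is hence, at generic states, the
   increasing limit of continuous functions of finitely many of these
   functionals, so that its expectation is lower semicontinuous along the
   sequence; this applies to the function and to its opposite. *)

(** * Time changes *)

Section time_changes.
Context {R : realType}.
Implicit Types (a c s t : R) (lam : R -> R).

(** The hypothesis speaks of integrals of bounded continuous functions on finite products, where
    distinct [lfmeasure] records may be topologically indistinguishable. States are therefore
    compared through the countable type [constraint]: the filter it generates is coarser than the
    product topology, yet fine enough at generic states. Countability turns a supremum of continuous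
    minorants into the limit of a sequence, to which dominated convergence applies.

    Three obstacles shape the rest. Evaluation at a fixed time is in general not J1-continuous, so
    paths are observed through suprema over windows. Vague closeness yields an atom near each atom
    of the limit, but additional atoms are excluded only by an upper bound on the mass of a
    rectangle, chosen with no atom just outside its upper and right sides. Finally, the conclusion
    requires Borel measurability for J1, whose open sets are not described by evaluations: a
    countable family of measurable sets playing the role of a base has to be exhibited. *)

Definition increasing_bijection lam : Prop :=
  {homo lam : s t / s < t} /\ forall u, exists t, lam t = u.

Lemma increasing_bijection_id : increasing_bijection id.
Proof. by split=> // u; exists u. Qed.

Lemma increasing_bijection_comp lam1 lam2 :
  increasing_bijection lam1 -> increasing_bijection lam2 ->
  increasing_bijection (lam1 \o lam2).
Proof.
move=> [h1 s1] [h2 s2]; split=> [s t st|u] /=; first exact/h1/h2.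
by have [v <-] := s1 u; have [t <-] := s2 v; exists t.
Qed.

Lemma increasing_bijection_ltE lam : increasing_bijection lam ->
  {mono lam : s t / s < t}.
Proof. by move=> [h _]; apply: leW_mono; apply: le_mono. Qed.

Lemma increasing_bijection_leE lam : increasing_bijection lam ->
  {mono lam : s t / s <= t}.
Proof. by move=> [h _]; apply: le_mono. Qed.

(** Bijections of the whole line can be composed and glued without any boundary condition at 0;
    fixing 0 is what makes such a map preserve the half-line. *)
Lemma increasing_bijection_time_change lam :
  increasing_bijection lam -> lam 0 = 0 -> time_change lam.
Proof.
move=> hlam lam0; split=> [s t _ _|]; first by case: hlam => + _; apply.
apply/seteqP; split=> [_ [t /= + <-]|u /=]; rewrite !in_itv/= !andbT.
  by move=> t0; rewrite -lam0 (increasing_bijection_leE hlam).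
move=> u0; have [_ /(_ u)[t tu]] := hlam; exists t => //=.
by rewrite in_itv/= andbT -(increasing_bijection_leE hlam) lam0 tu.
Qed.

(* Piecewise linear, with nodes a |-> a, s' |-> s and c |-> c. *)
Definition pl_bump a c s' s t : R :=
  if t <= s' then (if t <= a then t else a + (t - a) * ((s - a) / (s' - a)))
  else (if c <= t then t else c - (c - t) * ((c - s) / (c - s'))).

Lemma pl_bump_out a c s' s t : a < s' -> s' < c ->
  (t <= a) || (c <= t) -> pl_bump a c s' s t = t.
Proof.
move=> as' s'c; rewrite /pl_bump => /orP[h|h]; first by rewrite h (le_trans h)// ltW.
by rewrite h leNgt (lt_le_trans s'c).
Qed.

Lemma pl_bump_node a c s' s : a < s' -> pl_bump a c s' s s' = s.
Proof. by move=> as'; rewrite /pl_bump lexx leNgt as' /=; field; apply/eqP => ?; lra. Qed.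

Lemma pl_bump_homo a c s' s : a < s' -> s' < c -> a < s -> s < c ->
  {homo pl_bump a c s' s : x y / x < y}.
Proof.
move=> as' s'c as_ sc.
have al : 0 < (s - a) / (s' - a) by rewrite divr_gt0// subr_gt0.
have be : 0 < (c - s) / (c - s') by rewrite divr_gt0// subr_gt0.
have ae : (s' - a) * ((s - a) / (s' - a)) = s - a by field; apply/eqP => ?; lra.
have ce : (c - s') * ((c - s) / (c - s')) = c - s by field; apply/eqP => ?; lra.
rewrite /pl_bump; move: al be ae ce.
(* The slopes become abstract positive numbers. [ae] and [ce] say that both pieces reach height [s]
   at the node; with monotonicity of the products, each case is then linear. *)
move: ((s - a) / (s' - a)) ((c - s) / (c - s')) => al be al0 be0 ae ce x y xy.
have mal u v : u <= v -> u * al <= v * al by move=> uv; rewrite ler_pM2r.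
have mbe u v : u <= v -> u * be <= v * be by move=> uv; rewrite ler_pM2r.
have sal u v : u < v -> u * al < v * al by move=> uv; rewrite ltr_pM2r.
have sbe u v : u < v -> u * be < v * be by move=> uv; rewrite ltr_pM2r.
have [xs'|s'x] := leP x s'; have [ys'|s'y] := leP y s'; last 2 first.
- by lra.
- have := sbe (c - y) (c - x); have [cx|xc] := leP c x; have [cy|yc] := leP c y => h.
  + by [].
  + by lra.
  + have := sbe 0 (c - x); lra.
  + by lra.
- have := sal (x - a) (y - a); have [xa|ax] := leP x a; have [ya|ay] := leP y a => h.
  + by [].
  + have := sal 0 (y - a); lra.
  + by lra.
  + by lra.
- have h1 := mal (x - a) (s' - a); have h2 := sbe (c - y) (c - s').
  by have [xa|ax] := leP x a; have [cy|yc] := leP c y; lra.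
Qed.

(** Exchanging the two nodes inverts each affine piece; surjectivity of the bump comes from here. *)
Lemma pl_bumpK a c s' s t : a < s' -> s' < c -> a < s -> s < c ->
  pl_bump a c s' s (pl_bump a c s s' t) = t.
Proof.
move=> as' s'c as_ sc.
have [ta|ta] := leP t a; first by rewrite !pl_bump_out ?ta.
have [ct|ct] := leP c t; first by rewrite !pl_bump_out ?ct ?orbT.
rewrite {2}/pl_bump (leNgt t a) ta (leNgt c t) ct /=.
have al : 0 < (s' - a) / (s - a) by rewrite divr_gt0// subr_gt0.
have be : 0 < (c - s') / (c - s) by rewrite divr_gt0// subr_gt0.
have ae : (s - a) * ((s' - a) / (s - a)) = s' - a by field; apply/eqP => ?; lra.
have ce : (c - s) * ((c - s') / (c - s)) = c - s' by field; apply/eqP => ?; lra.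
have [ts|st] := leP t s; rewrite /pl_bump.
  rewrite ifT; last by nra.
  rewrite ifF; last by apply/negbTE; rewrite -ltNge; nra.
  by field; do ?[apply/andP; split]; apply/eqP => ?; lra.
rewrite ifF; last by apply/negbTE; rewrite -ltNge; nra.
rewrite ifF; last by apply/negbTE; rewrite -ltNge; nra.
by field; do ?[apply/andP; split]; apply/eqP => ?; lra.
Qed.

Lemma pl_bump_bijection a c s' s : a < s' -> s' < c -> a < s -> s < c ->
  increasing_bijection (pl_bump a c s' s).
Proof.
move=> as' s'c as_ sc; split=> [|u]; first exact: pl_bump_homo.
by exists (pl_bump a c s s' u); rewrite pl_bumpK.
Qed.

(** The displacement is affine on each piece, zero at [a] and [c], and [s - s'] at the node, hence
    extremal there. *)
Lemma pl_bump_dist a c s' s t : a < s' -> s' < c -> a < s -> s < c ->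
  `|pl_bump a c s' s t - t| <= `|s - s'|.
Proof.
move=> as' s'c as_ sc.
have [ta|ta] := leP t a; first by rewrite pl_bump_out ?ta// subrr normr0.
have [ct|ct] := leP c t; first by rewrite pl_bump_out ?ct ?orbT// subrr normr0.
rewrite /pl_bump (leNgt t a) ta (leNgt c t) ct /=.
have [ts|st] := leP t s'.
  rewrite (_ : _ - t = (t - a) / (s' - a) * (s - s')); last by field; apply/eqP => ?; lra.
  rewrite normrM ler_piMl// ger0_norm ?divr_ge0//; try lra.
  by rewrite ler_pdivrMr; lra.
rewrite (_ : _ - t = (c - t) / (c - s') * (s - s')); last by field; apply/eqP => ?; lra.
rewrite normrM ler_piMl// ger0_norm ?divr_ge0//; try lra.
by rewrite ler_pdivrMr; lra.
Qed.

End time_changes.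

(** * Partitions of cadlag paths *)

Section cadlag_partition.
Context {R : realType} {V : normedModType R}.
Implicit Types (y : cadlag V).

(** Two times are in the same half-open cell when no point of [ts] separates them; this form does
    not require [ts] to be sorted. *)
Let partitioned y (e b : R) := exists ts : seq R, forall u v, u <= v -> v < b ->
  (forall t, t \in ts -> ~~ (u < t <= v)) -> `|y u - y v| <= e.

Let partitioned_step y e b b' : partitioned y e b ->
  (forall u v, b <= u -> u <= v -> v < b' -> `|y u - y v| <= e) ->
  partitioned y e b'.
Proof.
move=> [ts tsP] h; exists (b :: ts) => u v uv vb' nt.
have [vb|bv] := ltP v b.
  by apply: tsP => // t tts; apply: nt; rewrite inE tts orbT.
have [ub|bu] := ltP u b; last exact: h.
by have := nt b; rewrite inE eqxx ub bv => /(_ isT).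
Qed.

(** Continuous induction on the horizon: the left limit shows that the supremum of the admissible
    horizons is admissible, and right-continuity then goes beyond it. *)
Lemma cadlag_partition y e b : 0 < e ->
  exists ts : seq R, forall u v, u <= v -> v < b ->
    (forall t, t \in ts -> ~~ (u < t <= v)) -> `|y u - y v| <= e.
Proof.
move=> e0; have [yr yl yN] := cadlag_funP y.
rewrite -/(partitioned y e b); apply: contrapT => nb.
pose S := [set x | partitioned y e x].
have e20 : 0 < e / 2 by rewrite divr_gt0.
have S0 : S 0.
  exists [::] => u v uv v0 _.
  by rewrite (yN v)// (yN u) ?(le_lt_trans uv)// subrr normr0 ltW.
have Sb x : S x -> x <= b.
  move=> [ts h]; rewrite leNgt; apply/negP => bx; apply: nb; exists ts => u v uv vb.
  by apply: h => //; rewrite (lt_trans vb).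
have hS : has_sup S by split; [exists 0|exists b => x /Sb].
have s0 : 0 <= sup S by apply: ub_le_sup => //; exact: hS.2.
have Ssup : S (sup S).
  have [d d0 hd] : exists2 d, 0 < d &
      forall u v, sup S - d < u -> u < sup S -> sup S - d < v -> v < sup S ->
      `|y u - y v| <= e.
    move: s0; rewrite le_eqVlt => /predU1P[<-|s0].
      exists 1 => // u v _ u0 _ v0.
      by rewrite (yN v)// (yN u)// subrr normr0 ltW.
    have /cvg_ex[l yl'] := yl _ s0.
    have : \forall t \near (sup S)^'-, `|l - y t| <= e / 2.
      exact: cvgr_dist_le yl' _ e20.
    rewrite near_withinE => -[d /= d0 hd]; exists d => // u v u1 u2 v1 v2.
    have hu : `|l - y u| <= e / 2 by apply: hd => //=; rewrite ltr_distlC; lra.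
    have hv : `|l - y v| <= e / 2 by apply: hd => //=; rewrite ltr_distlC; lra.
    by rewrite (le_trans (ler_distD l _ _))// [e]splitr distrC lerD.
  have [t St dt] := sup_adherent d0 hS.
  apply: (partitioned_step St) => u v tu uv vs; apply: hd => //; lra.
have : \forall t \near (sup S)^'+, `|y (sup S) - y t| <= e / 2.
  exact: cvgr_dist_le (yr _ s0) _ e20.
rewrite near_withinE => -[d /= d0 hd].
have Sd : S (sup S + d).
  apply: (partitioned_step Ssup).
  have hd' u : sup S <= u -> u < sup S + d -> `|y (sup S) - y u| <= e / 2.
    rewrite le_eqVlt => /predU1P[<-|su] ud; first by rewrite subrr normr0 ltW.
    by apply: hd => //=; rewrite ltr_distlC; lra.
  move=> u v su uv vd.
  have hu : `|y (sup S) - y u| <= e / 2 by apply: hd' => //; lra.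
  have hv : `|y (sup S) - y v| <= e / 2 by apply: hd'; lra.
  by rewrite (le_trans (ler_distD (y (sup S)) _ _))// [e]splitr distrC lerD.
have : sup S + d <= sup S by apply: ub_le_sup => //; exact: hS.2.
lra.
Qed.

Lemma cadlag_sorted_partition y e b : 0 < e -> 0 < b ->
  exists ts : seq R, path <%R 0 (rcons ts b) /\
    forall u v, 0 <= u -> u <= v -> v < b ->
    (forall t, t \in ts -> ~~ (u < t <= v)) -> `|y u - y v| <= e.
Proof.
move=> e0 b0; have [ts tsP] := cadlag_partition y b e0.
pose ts' := sort <=%R (undup [seq t <- ts | 0 < t < b]).
exists ts'; split; last first.
  move=> u v u0 uv vb nt; apply: tsP => // t tts.
  have [/andP[ut tv]|//] := boolP (_ < _ <= _).
  have := nt t; rewrite ut tv; apply.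
  rewrite mem_sort mem_undup mem_filter tts andbT.
  by rewrite (le_lt_trans u0)//= (le_lt_trans tv).
have tsb t : t \in ts' -> 0 < t < b.
  by rewrite mem_sort mem_undup mem_filter => /andP[].
have : sorted <%R ts' by rewrite lt_sorted_uniq_le sort_uniq undup_uniq sort_le_sorted.
rewrite (path_sortedE lt_trans) => st; apply/andP; split.
  by apply/allP => t; rewrite mem_rcons inE => /orP[/eqP->//|/tsb /andP[]].
rewrite lt_sorted_pairwise pairwise_rcons -lt_sorted_pairwise st andbT.
by apply/allP => t /tsb /andP[].
Qed.

End cadlag_partition.

(** * A countable base for the J1 topology *)

Section J1_countable_base.
Context {R : realType} {V : normedModType R}.
Implicit Types (y : cadlag V) (v : V) (e : R).

Lemma cadlag_right_nbhs y v e t : 0 <= t -> e < `|y t - v| ->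
  exists2 d, 0 < d & forall s, t <= s -> s < t + d -> e < `|y s - v|.
Proof.
move=> t0 et; have [yr _ _] := cadlag_funP y.
have yv : `|y s - v| @[s --> t^'+] --> `|y t - v|.
  by apply: cvg_norm; apply: cvgB; [exact: yr|exact: cvg_cst].
have : \forall s \near t^'+, e < `|y s - v| by exact: cvgr_gt yv _ et.
rewrite near_withinE => -[d /= d0 hd].
exists d => // s; rewrite le_eqVlt => /predU1P[<-//|ts] sd.
by apply: hd => //=; rewrite ltr_distlC; lra.
Qed.

(** Only rational times are tested, so that the condition is measurable as soon as evaluations are;
    right-continuity extends it to all times. *)
Definition stays y (p q : R) v e : Prop :=
  forall t : rat, p <= ratr t < q -> `|y (ratr t) - v| <= e.

(** Expresses that the path passes from [v] to [v'] at some time of the window without quantifying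
    over that time, which would be an uncountable union. *)
Definition switches y (q r : R) v v' e : Prop :=
  forall s t : rat, q <= ratr s < r -> q <= ratr t < r ->
    e < `|y (ratr s) - v'| -> e < `|y (ratr t) - v| -> (s < t)%R.

Lemma staysP y p q v e : 0 <= p -> stays y p q v e ->
  forall t, p <= t -> t < q -> `|y t - v| <= e.
Proof.
move=> p0 h t pt tq; rewrite leNgt; apply/negP => et.
have [d d0 hd] := cadlag_right_nbhs (le_trans p0 pt) et.
have [] := @rat_in_itvoo R t (Num.min (t + d) q); first by rewrite lt_min tq andbT; lra.
move=> s; rewrite in_itv/= lt_min => /andP[ts /andP[sd sq]].
have := hd (ratr s) (ltW ts) sd; rewrite ltNge h// sq andbT; lra.
Qed.

Lemma switchesP y q r v v' e : 0 <= q -> q <= r -> switches y q r v v' e ->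
  exists s, [/\ q <= s, s <= r, forall t, q <= t -> t < s -> `|y t - v| <= e &
    forall t, s <= t -> t < r -> `|y t - v'| <= e].
Proof.
move=> q0 qr h.
(* The switching time is [inf B]; [r] is included for a path that never leaves [v] in the window. *)
pose B := [set t | t = r \/ q <= t < r /\ e < `|y t - v|].
have Br : B r by left.
have Bq t : B t -> q <= t by move=> [->//|[/andP[]]].
have Blb : has_lbound B by exists q => t /Bq.
have hB : has_inf B by split => //; exists r.
have sq : q <= inf B by apply: lb_le_inf; [exists r|move=> t /Bq].
have sr : inf B <= r by exact: ge_inf.
exists (inf B); split=> // t; first move=> qt ts.
  rewrite leNgt; apply/negP => et.
  suff : inf B <= t by lra.
  by apply: ge_inf => //; right; rewrite qt (lt_le_trans ts).
move=> st tr; rewrite leNgt; apply/negP => et.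
have t0 : 0 <= t by lra.
have [d d0 hd] := cadlag_right_nbhs t0 et.
pose d1 := Num.min d (r - t).
have d10 : 0 < d1 by rewrite lt_min d0 subr_gt0.
have [d1d d1r] : d1 <= d /\ d1 <= r - t by rewrite !ge_min !lexx orbT.
have [b Bb bs] := inf_adherent d10 hB.
have qb := Bq _ Bb.
have {Bb} [br eb] : b < r /\ e < `|y b - v|.
  by move: Bb => [br|[/andP[]]//]; lra.
have b0 : 0 <= b by lra.
have [d' d'0 hd'] := cadlag_right_nbhs b0 eb.
(* [b] is pushed right to a rational time still far from [v]. Since the path is far from [v'] right
   after [t], some rational time far from [v'] does not precede it. *)
have [] := @rat_in_itvoo R b (Num.min (b + d') (t + d1)); first by rewrite lt_min; lra.
move=> b'; rewrite in_itv/= lt_min => /andP[bb' /andP[b'd b't]].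
have eb' : e < `|y (ratr b') - v| by apply: hd'; lra.
have [tb'|b't'] := leP t (ratr b').
  have et' : e < `|y (ratr b') - v'| by apply: hd; lra.
  by have := h b' b'; rewrite ltxx => H; have : false by apply: H => //; lra.
have [] := @rat_in_itvoo R t (t + d1); first by lra.
move=> s; rewrite in_itv/= => /andP[ts sd].
have es : e < `|y (ratr s) - v'| by apply: hd; lra.
have : (s < b')%R by apply: h => //; lra.
by rewrite -(@ltr_rat R); lra.
Qed.

Context {C : countType} (a : C -> V).

(* By [switchesP], a path that follows (v, (q, r, q', c) :: l) from p is close to v
   from p to some time in [q, r], then close to a c until q', and so on. *)
Fixpoint follows y e (b : R) (p : rat) v (l : seq (rat * rat * rat * C)) : Prop :=
  match l with
  | [::] => stays y (ratr p) b v e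
  | (q, r, q', c) :: l' =>
      [/\ stays y (ratr p) (ratr q) v e, switches y (ratr q) (ratr r) v (a c) e,
          stays y (ratr r) (ratr q') (a c) e & follows y e b q' (a c) l']
  end.

Fixpoint well_spaced e (p : rat) (l : seq (rat * rat * rat * C)) : bool :=
  if l is (q, r, q', c) :: l' then
    [&& p < q, q < r, r < q', ratr r - ratr q < e & well_spaced e q' l']
  else true.

(** Both paths switch inside the same window of width less than [d], at times that one bump matches.
    Between switches they are within [e] of a common value, whence [e + e]. *)
Lemma follows_close (x y : cadlag V) e d b l p v : 0 < d -> 0 <= p ->
  well_spaced d p l -> follows x e b p v l -> follows y e b p v l ->
  exists lam, [/\ increasing_bijection lam, forall t, t <= ratr p -> lam t = t,
    forall t, `|lam t - t| < d &
    forall t, ratr p <= t -> t < b -> `|y t - x (lam t)| <= e + e].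
Proof.
move=> d0; elim: l p v => [|[[[q r] q'] c] l IH] p v p0 /=.
  move=> _ hx hy; exists id; split=> //.
  - exact: increasing_bijection_id.
  - by move=> t; rewrite subrr normr0.
  - have p0' : 0 <= ratr p :> R by rewrite ler0q.
    move=> t pt tb; rewrite (le_trans (ler_distD v _ _))// lerD//.
      exact: (staysP p0' hy).
    by rewrite distrC; exact: (staysP p0' hx).
move=> /and5P[pq qr rq' rqd ws] [x1 x2 x3 x4] [y1 y2 y3 y4].
have q'0 : 0 <= q' by rewrite (le_trans p0)// (le_trans (ltW pq))// (le_trans (ltW qr)) ?ltW.
have [lam [lamb lamp lamd lamy]] := IH _ _ q'0 ws x4 y4.
move: pq qr rq'; rewrite -!(@ltr_rat R) => pq qr rq'.
have p0' : 0 <= ratr p :> R by rewrite ler0q.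
have q0' : 0 <= ratr q :> R by lra.
have r0' : 0 <= ratr r :> R by lra.
have [sx [qsx sxr hx1 hx2]] := switchesP q0' (ltW qr) x2.
have [sy [qsy syr hy1 hy2]] := switchesP q0' (ltW qr) y2.
have [psy syq' psx sxq'] : [/\ ratr p < sy, sy < ratr q', ratr p < sx & sx < ratr q'].
  by split; lra.
pose bp : R -> R := pl_bump (ratr p) (ratr q') sy sx.
have bpb : increasing_bijection bp by exact: pl_bump_bijection.
have bpp : bp (ratr p) = ratr p by rewrite /bp pl_bump_out// lexx.
have bpq : bp (ratr q') = ratr q' by rewrite /bp pl_bump_out// lexx orbT.
have bps : bp sy = sx by exact: pl_bump_node.
have ble := increasing_bijection_leE bpb.
have blt := increasing_bijection_ltE bpb.
(* Before [q'] only the bump acts, after [q'] only the time change given by the induction. *)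
have lamE t : t <= ratr q' -> lam (bp t) = bp t.
  by move=> tq; apply: lamp; rewrite -bpq ble.
exists (lam \o bp); split=> /=.
- exact: increasing_bijection_comp.
- move=> t tp; rewrite lamE; last by lra.
  by rewrite /bp pl_bump_out ?tp.
- move=> t; have [tq|qt] := leP t (ratr q').
    rewrite lamE//; apply: le_lt_trans (pl_bump_dist _ psy syq' psx sxq') _.
    by rewrite ltr_norml; lra.
  by rewrite /bp pl_bump_out ?(ltW qt) ?orbT.
- have hx1' t : ratr p <= t -> t < sx -> `|x t - v| <= e.
    move=> pt ts; have [tq|qt] := ltP t (ratr q); first exact: (staysP p0' x1).
    exact: hx1.
  have hy1' t : ratr p <= t -> t < sy -> `|y t - v| <= e.
    move=> pt ts; have [tq|qt] := ltP t (ratr q); first exact: (staysP p0' y1).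
    exact: hy1.
  have hx2' t : sx <= t -> t < ratr q' -> `|x t - a c| <= e.
    move=> st tq; have [tr|rt] := ltP t (ratr r); first exact: hx2.
    exact: (staysP r0' x3).
  have hy2' t : sy <= t -> t < ratr q' -> `|y t - a c| <= e.
    move=> st tq; have [tr|rt] := ltP t (ratr r); first exact: hy2.
    exact: (staysP r0' y3).
  move=> t pt tb; have [tq|qt] := ltP t (ratr q'); last first.
    by rewrite /bp pl_bump_out ?qt ?orbT//; exact: lamy.
  rewrite lamE; last by lra.
  have [ts|st] := ltP t sy.
    rewrite (le_trans (ler_distD v _ _))// lerD// ?hy1'// distrC hx1'//.
      by rewrite -bpp ble.
    by rewrite -bps blt.
  rewrite (le_trans (ler_distD (a c) _ _))// lerD// ?hy2'// distrC hx2'//.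
    by rewrite -bps ble.
  by rewrite -bpq blt.
Qed.

Context (a_dense : forall v e, 0 < e -> exists c, `|v - a c| <= e).

(** Each partition time is enclosed in a rational window. The tolerance [e + e] pays once for the
    oscillation within a cell and once for replacing the value by one of the dense family. *)
Lemma follows_exists (x : cadlag V) e b d (ts : seq R) p v : 0 < e -> 0 < d -> 0 <= p ->
  path <%R (ratr p) (rcons ts b) ->
  (forall u w, ratr p <= u -> u <= w -> w < b ->
    (forall t, t \in ts -> ~~ (u < t <= w)) -> `|x u - x w| <= e) ->
  (forall u, ratr p <= u -> u < head b ts -> `|x u - v| <= e + e) ->
  exists2 l, well_spaced d p l & follows x (e + e) b p v l.
Proof.
move=> e0 d0; elim: ts p v => [|t ts IH] p v p0 /=.
  by move=> _ _ h; exists [::] => // s /andP[]; exact: h.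
move=> /andP[pt tsp] osc hv.
have tnext : t < head b ts by case: (ts) tsp => [|t' ts'] /= /andP[].
have nextb : head b ts <= b.
  case: (ts) tsp => [//|t' ts'] /= /andP[_].
  rewrite path_sortedE; last exact: lt_trans.
  by move=> /andP[/allP/(_ b)]; rewrite mem_rcons inE eqxx => /(_ isT)/ltW.
have nts s : s \in ts -> head b ts <= s.
  case: (ts) tsp => [//|t' ts'] /= /andP[_].
  rewrite path_sortedE; last exact: lt_trans.
  move=> /andP[/allP h _]; rewrite inE => /predU1P[->//|sts].
  by apply/ltW/h; rewrite mem_rcons inE sts orbT.
have [c hc] := a_dense (x t) e0.
(* Each end of the window is taken within [d / 2] of [t], so that its width is below [d]. *)
have [] := @rat_in_itvoo R (Num.max (ratr p) (t - d / 2)) t.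
  by rewrite gt_max pt; lra.
move=> q; rewrite in_itv/= gt_max => /andP[/andP[pq dq] qt].
have [] := @rat_in_itvoo R t (Num.min (head b ts) (t + d / 2)).
  by rewrite lt_min tnext; lra.
move=> r; rewrite in_itv/= lt_min => /andP[tr /andP[rnext rd]].
have [q'] := @rat_in_itvoo R (ratr r) (head b ts) rnext.
rewrite in_itv/= => /andP[rq' q'next].
have near_t u : t <= u -> u < head b ts -> `|x u - a c| <= e + e.
  move=> tu un; rewrite (le_trans (ler_distD (x t) _ _))// lerD//.
  rewrite distrC; apply: osc; [lra|lra|lra|] => s.
  rewrite inE => /predU1P[->|/nts hs]; apply/negP => /andP[]; lra.
have q'0 : 0 <= q' by rewrite -(@ler0q R); rewrite -(@ler0q R) in p0; lra.
have [|||l ws fl] := IH q' (a c) q'0.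
- case: (ts) tsp q'next => [|t' ts'] /= /andP[_]; first by move=> _ ->.
  by move=> h ->.
- move=> u w qu uw wb hts; apply: osc => //; first by lra.
  move=> s; rewrite inE => /predU1P[->|]; last exact: hts.
  by apply/negP => /andP[]; lra.
- by move=> u qu un; apply: near_t => //; lra.
exists ((q, r, q', c) :: l).
  by rewrite /= -!(@ltr_rat R) ws andbT; lra.
split=> //.
- by move=> s /andP[ps sq]; apply: hv => //; lra.
- move=> s u /andP[qs sr] /andP[qu ur] hs hu.
  rewrite -(@ltr_rat R); have st : ratr s < t.
    by rewrite ltNge; apply/negP => ts'; move: hs; rewrite ltNge near_t//; lra.
  have tu : t <= ratr u; last by lra.
  by rewrite leNgt; apply/negP => ut; move: hu; rewrite ltNge hv//; lra.
- by move=> s /andP[rs sq']; apply: near_t; lra.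
Qed.

(* Indices (m, b, c, l): a tolerance 1 / m.+1, a horizon b and the values. *)
Definition J1_base (i : nat * nat * C * seq (rat * rat * rat * C)) :
    set (cadlag V) :=
  let '(m, b, c, l) := i in
  [set y | well_spaced m.+1%:R^-1 0 l /\
           follows y m.+1%:R^-1 b%:R 0 (a c) l].

(** The sets [J1_base] are not claimed to be open: this inclusion already makes every open set a
    countable union of them. *)
Lemma J1_baseP (x : cadlag V) (T e : R) : 0 < e ->
  exists i, J1_base i x /\ J1_base i `<=` J1_ball x T e.
Proof.
move=> e0.
(* The tolerance doubles twice: a partition at level [e1 / 2] gives paths following at level [e1],
   and two such paths are at distance at most [e1 + e1 < e]. *)
have [m me] : exists m : nat, (m.+1%:R^-1 : R) < e / 2.
  have e20 : 0 < e / 2 by lra.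
  near (\oo : set_system nat) => m; exists m; near: m.
  exact: near_infty_natSinv_lt (PosNum e20).
pose b := (Num.bound `|T|).+1.
have Tb : T < b%:R.
  by rewrite (le_lt_trans (ler_norm _))// (lt_trans (archi_boundP _))// ltr_nat /b ltnS.
have : 0 < m.+1%:R^-1 :> R by rewrite invr_gt0.
set e1 : R := m.+1%:R^-1 => m0; rewrite -/e1 in me.
have m20 : 0 < e1 / 2 :> R by lra.
have b0 : 0 < b%:R :> R by [].
have [ts [tsp osc]] := cadlag_sorted_partition x m20 b0.
have [c hc] := a_dense (x 0) m20.
have p0 : ratr 0 = 0 :> R by rewrite rmorph0.
have [|||l ws fl] := @follows_exists x (e1 / 2) b%:R e1 ts 0 (a c) m20 m0 (lexx _).
- by rewrite p0.
- by rewrite p0.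
- rewrite p0 => u u0 un; rewrite (le_trans (ler_distD (x 0) _ _))// lerD//.
  rewrite distrC; apply: osc => //.
    case: (ts) tsp un => [//|t' ts'] /= /andP[_].
    rewrite path_sortedE; last exact: lt_trans.
    move=> /andP[/allP/(_ b%:R)]; rewrite mem_rcons inE eqxx => /(_ isT) h _ h'.
    by lra.
  move=> s sts; apply/negP => /andP[s0 su]; move: un; rewrite ltNge => /negP; apply.
  apply: le_trans su; case: (ts) tsp sts => [//|t' ts'] /= /andP[_].
  rewrite path_sortedE; last exact: lt_trans.
  move=> /andP[/allP h _]; rewrite inE => /predU1P[->//|sts].
  by apply/ltW/h; rewrite mem_rcons inE sts orbT.
exists (m, b, c, l); rewrite /J1_base /= -/e1; rewrite -splitr in fl.
split; first by split.
move=> y [_ fy].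
have [lam [lb lam0 lamd lamy]] := follows_close m0 (lexx 0) ws fl fy.
rewrite p0 in lam0; rewrite p0 in lamy.
exists lam; first by apply: increasing_bijection_time_change => //; exact: lam0.
move=> t /andP[t0 tT]; split; first by rewrite (lt_trans (lamd t))//; lra.
rewrite (le_lt_trans (lamy _ t0 _))//; first by lra.
by lra.
Unshelve. all: by end_near. Qed.

End J1_countable_base.

(** * Borel measurability for the J1 topology *)

Lemma cvg_prod_topology (I : choiceType) (K : I -> topologicalType)
    (F : set_system (forall i, K i)) (x : prod_topology K) :
  Filter F ->
  (forall i (B : set (K i)), open B -> B (x i) -> F [set z | B (z i)]) ->
  F --> x.
Proof.
move=> FF h; apply/cvg_sup => i A /= [_ [[B Bop <-] Bx] sBA].
rewrite nbhs_filterE; apply: filterS sBA _; exact: h.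
Qed.

Lemma countable_bigcapT_measurable d (T : measurableType d) (C : countType)
    (F : C -> set T) :
  (forall c, measurable (F c)) -> measurable (\bigcap_c F c).
Proof.
move=> mF; rewrite -[X in measurable X]setCK setC_bigcap.
apply/measurableC/countable_bigcupT_measurable => // c; exact: measurableC.
Qed.

Lemma ler_norm_row (R : realType) n (v : 'rV[R]_n) (e : R) : 0 <= e ->
  reflect (forall i, `|v ord0 i| <= e) (`|v| <= e).
Proof.
move=> e0; rewrite [X in X <= _]/Num.norm/= mx_normrE; apply: (iffP idP).
  by move=> /bigmax_leP[_ h] i; exact: (h (ord0, i)).
move=> h; apply/bigmax_leP; split=> // -[i j] _ /=; rewrite (ord1 i); exact: h.
Qed.

(** * Neighbourhood filters generated by a countable family of sets *)

Section cylinder_filter.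
Context {S : Type} {C : countType}.

Definition cylinder (V : C -> set S) (l : seq C) : set S :=
  [set x | forall c, c \in l -> V c x].

(** The neighbourhoods of [x] in the topology generated by [V]. It serves for J1-measurability, with
    [V] built from [J1_base], and for states, with [V] the constraints. *)
Definition cylinder_filter (V : C -> set S) (x : S) : set_system S :=
  [set O | exists2 l, cylinder V l x & cylinder V l `<=` O].

Global Instance cylinder_filter_filter V x : Filter (cylinder_filter V x).
Proof.
split=> [|A B [l lx lA] [k kx kB]|A B AB [l lx lA]].
- by exists [::].
- exists (l ++ k) => [c|y h]; first by rewrite mem_cat => /orP[/lx|/kx].
  by split; [apply: lA|apply: kB] => c hc; apply: h; rewrite mem_cat hc ?orbT.
- by exists l => //; exact: subset_trans AB.
Qed.

Lemma cylinder_filter1 V x c : V c x -> cylinder_filter V x (V c).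
Proof.
move=> Vcx; exists [:: c] => [d|y]; first by rewrite inE => /eqP->.
by apply; rewrite inE.
Qed.

(** Finite sequences over a countable type are countable, so [U] is the countable union of the
    cylinders it contains. *)
Lemma cylinder_filter_measurable d (T : measurableType d) (V : C -> set S)
    (X : T -> S) (U : set S) :
  (forall c, measurable (X @^-1` V c)) ->
  (forall x, U x -> cylinder_filter V x U) -> measurable (X @^-1` U).
Proof.
move=> mV hU.
have mcyl l : measurable (X @^-1` cylinder V l).
  elim: l => [|c l IH].
    rewrite (_ : _ @^-1` _ = setT); first exact: measurableT.
    by apply/seteqP; split=> // w _ c.
  rewrite (_ : _ @^-1` _ = X @^-1` V c `&` X @^-1` cylinder V l).
    exact: measurableI.
  apply/seteqP; split=> w /=.
    by move=> h; split=> [|c' c'l]; apply: h; rewrite inE ?eqxx// c'l orbT.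
  by move=> [h1 h2] c'; rewrite inE => /predU1P[->//|]; exact: h2.
rewrite (_ : X @^-1` U = \bigcup_l
    (if `[< cylinder V l `<=` U >] then X @^-1` cylinder V l else set0)).
  apply: countable_bigcupT_measurable => // l; case: ifP => // _.
apply/seteqP; split=> w /=.
  by move=> /hU[l lw lU]; exists l => //; case: asboolP.
by move=> [l _]; case: asboolP => // lU; exact: lU.
Qed.

End cylinder_filter.

Section J1_measurability.
Context {R : realType}.

Lemma J1_base_measurable (V : normedModType R) (C : countType) (a : C -> V)
    d (T : measurableType d) (X : T -> cadlag V) i :
  (forall t c e, measurable [set w | `|X w t - a c| <= e]) ->
  measurable (X @^-1` J1_base a i).
Proof.
move=> mX.
have mst p q c e : measurable [set w | stays (X w) p q (a c) e].
  rewrite (_ : [set w | _] = \bigcap_(t : rat)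
    if p <= ratr t < q then [set w | `|X w (ratr t) - a c| <= e] else setT).
    apply: countable_bigcapT_measurable => // t; case: ifP => // _.
  apply/seteqP; split=> w /=.
    by move=> h t _; case: ifPn => // ht; exact: h.
  by move=> h t ht; have := h t I; rewrite ht.
have msw q r c c' e : measurable [set w | switches (X w) q r (a c) (a c') e].
  have mgt t c0 : measurable [set w | e < `|X w t - a c0|].
    rewrite (_ : [set w | _] = ~` [set w | `|X w t - a c0| <= e]).
      exact: measurableC.
    by apply/seteqP; split=> w /=; rewrite ltNge => /negP.
  rewrite (_ : [set w | _] = \bigcap_(st : rat * rat)
    if [&& q <= ratr st.1 < r, q <= ratr st.2 < r & ~~ (st.1 < st.2)] then
      ~` ([set w | e < `|X w (ratr st.1) - a c'|] `&`
          [set w | e < `|X w (ratr st.2) - a c|]) else setT).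
    apply: countable_bigcapT_measurable => // st; case: ifP => // _.
    by apply: measurableC; apply: measurableI.
  apply/seteqP; split=> w /=.
    move=> h [s t] _; case: ifPn => //= /and3P[hs ht nst] [h1 h2].
    by move: nst; rewrite (h s t).
  move=> h s t hs ht h1 h2; have := h (s, t) I; rewrite /= hs ht /=.
  by case: ifPn => [_|]; [move=> []|rewrite negbK].
have mfo e b l : forall p c, measurable [set w | follows a (X w) e b p (a c) l].
  elim: l => [p c|[[[q r] q'] c'] l IH p c]; first exact: mst.
  rewrite (_ : [set w | _] = [set w | stays (X w) (ratr p) (ratr q) (a c) e] `&`
    ([set w | switches (X w) (ratr q) (ratr r) (a c) (a c') e] `&`
    ([set w | stays (X w) (ratr r) (ratr q') (a c') e] `&`
    [set w | follows a (X w) e b q' (a c') l]))).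
    by do 3?apply: measurableI.
  by apply/seteqP; split=> w /= [h1]; [move=> h2 h3 h4|move=> [h2 [h3 h4]]].
case: i => [[[m b] c] l]; rewrite /J1_base /=.
have [ws|ws] := boolP (well_spaced (m.+1%:R^-1 : R) 0 l).
  rewrite (_ : _ @^-1` _ =
    [set w | follows a (X w) m.+1%:R^-1 b%:R 0 (a c) l]) //.
  by apply/seteqP; split=> w /= => [[]|].
by rewrite (_ : _ @^-1` _ = set0) //; apply/seteqP; split=> w /= => [[]|].
Qed.

(** Reduces Borel measurability for J1 to fixed times, the only information available on point
    processes. *)
Lemma J1_open_measurable (V : normedModType R) (C : countType) (a : C -> V)
    d (T : measurableType d) (X : T -> cadlag V) (U : set (cadlag V)) :
  (forall v e, 0 < e -> exists c, `|v - a c| <= e) ->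
  (forall t c e, measurable [set w | `|X w t - a c| <= e]) ->
  open U -> measurable (X @^-1` U).
Proof.
move=> a_dense mX oU.
apply: (cylinder_filter_measurable (V := J1_base a)) => [i|x Ux].
  exact: J1_base_measurable.
have [T0 [e [e0 hU]]] := oU x Ux.
have [i [ix iU]] := J1_baseP a_dense x T0 e0.
apply: filterS (cylinder_filter1 ix); exact: subset_trans hU.
Qed.

Lemma J1_open_measurable_row n d (T : measurableType d)
    (X : T -> 'I_n -> cadlag R) (U : set (cadlag 'rV[R]_n)) :
  (forall i t, measurable_fun setT (fun w => X w i t)) ->
  open U -> measurable [set w | U (cadlag_row (X w))].
Proof.
move=> mX; pose a (c : {ffun 'I_n -> rat}) : 'rV[R]_n := \row_i ratr (c i).
apply: (@J1_open_measurable _ _ a) => [v e e0|t c e].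
  have /choice[c hc] : forall i, exists q : rat, `|v ord0 i - ratr q| <= e.
    move=> i; have [] := @rat_in_itvoo R (v ord0 i - e) (v ord0 i + e); first by lra.
    by move=> q; rewrite in_itv/= => hq; exists q; rewrite ler_distlC; lra.
  exists (finfun c); apply/ler_norm_row; first exact: ltW.
  by move=> i; rewrite !mxE ffunE.
have [e0|e0] := ltP e 0.
  rewrite (_ : [set w | _] = set0)//; apply/seteqP; split=> w //=.
  by rewrite leNgt (lt_le_trans e0).
rewrite (_ : [set w | _] =
    \bigcap_(i : 'I_n) ((fun w => X w i t) @^-1` [set x | `|x - ratr (c i)| <= e])).
  apply: countable_bigcapT_measurable => i.
  rewrite -[X in measurable X]setTI; apply: mX => //.
  rewrite (_ : [set x | _] = `[ratr (c i) - e, ratr (c i) + e]%classic)//.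
  by apply/seteqP; split=> x /=; rewrite in_itv/= ler_distl.
apply/seteqP; split=> w /=.
  by move=> /(ler_norm_row _ e0) h i _; have := h i; rewrite !mxE.
by move=> h; apply/(ler_norm_row _ e0) => i; have := h i I; rewrite /= !mxE.
Qed.

(** Testing one coordinate against one [J1_base] set gives countably many tests, which suffice for
    the product topology too. *)
Lemma J1_open_measurable_seq d (T : measurableType d)
    (X : T -> nat -> cadlag R) (U : set (prod_topology (fun _ : nat => cadlag R))) :
  (forall k t, measurable_fun setT (fun w => X w k t)) ->
  open U -> measurable [set w | U (X w)].
Proof.
move=> mX oU; pose a (q : rat) : R := ratr q.
have a_dense (v e : R) : 0 < e -> exists c, `|v - a c| <= e.
  move=> e0; have [] := @rat_in_itvoo R (v - e) (v + e); first by lra.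
  by move=> q; rewrite in_itv/= => hq; exists q; rewrite ler_distlC; lra.
pose V (c : nat * _) := [set x : nat -> cadlag R | J1_base a c.2 (x c.1)].
apply: (cylinder_filter_measurable (V := V)) => [[k i]|x Ux].
  apply: J1_base_measurable => t c e.
  rewrite (_ : [set w | _] = (fun w => X w k t) @^-1` `[ratr c - e, ratr c + e]%classic).
    by rewrite -[X in measurable X]setTI; apply: mX.
  by apply/seteqP; split=> w /=; rewrite in_itv/= ler_distl.
suff : cylinder_filter V x --> (x : prod_topology (fun _ : nat => cadlag R)).
  by apply; apply: open_nbhs_nbhs.
apply: cvg_prod_topology => k B oB Bx.
have [T0 [e [e0 hB]]] := oB _ Bx.
have [i [ix iB]] := J1_baseP a_dense (x k) T0 e0.
apply: (filterS _ (cylinder_filter1 (V := V) (c := (k, i)) ix)).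
by move=> z /iB; exact: hB.
Qed.

End J1_measurability.

(** * J1-continuous functionals *)

Section trapezoids.
Context {R : realType}.
Implicit Types (a b c t v : R) (i j : nat).

Definition clamp (v : R) : R := Num.max 0 (Num.min 1 v).

Lemma clamp_ge0 v : 0 <= clamp v. Proof. by rewrite le_max lexx. Qed.

Lemma clamp_le1 v : clamp v <= 1.
Proof. by rewrite ge_max ler01 ge_min lexx. Qed.

Lemma clamp_eq1 v : 1 <= v -> clamp v = 1.
Proof. by move=> h; rewrite /clamp min_l// max_r. Qed.

Lemma clamp_eq0 v : v <= 0 -> clamp v = 0.
Proof. by move=> h; rewrite /clamp min_r ?max_l// (le_trans h). Qed.

Lemma clamp_lipschitz v w : `|clamp v - clamp w| <= `|v - w|.
Proof.
rewrite /clamp; have := ler_norm (v - w); have := ler_norm (w - v).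
rewrite (distrC w v) ler_norml; move: `|v - w| => n.
by have [?|?] := leP 1 v; have [?|?] := leP 1 w; rewrite ?maxEle; do ?case: ifP; lra.
Qed.

Definition trapezoid j a b t : R := clamp (1 + j.+1%:R * Num.min (t - a) (b - t)).

Lemma trapezoid_eq1 j a b t : a <= t <= b -> trapezoid j a b t = 1.
Proof.
move=> /andP[at_ tb]; apply: clamp_eq1; rewrite lerDl mulr_ge0//.
by rewrite le_min !subr_ge0 at_.
Qed.

Lemma trapezoid_eq0 j a b t : (t <= a - j.+1%:R^-1) || (b + j.+1%:R^-1 <= t) ->
  trapezoid j a b t = 0.
Proof.
move=> h; apply: clamp_eq0; rewrite addrC -lerBrDr sub0r.
rewrite -(@ler_pM2l _ j.+1%:R^-1) ?invr_gt0// mulKf ?pnatr_eq0// mulrN1 ge_min.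
move: h; move: (j.+1%:R^-1) => d /orP[h|h]; apply/orP; [left|right]; lra.
Qed.

Lemma trapezoid_lipschitz j a b t u :
  `|trapezoid j a b t - trapezoid j a b u| <= j.+1%:R * `|t - u|.
Proof.
rewrite /trapezoid; apply: le_trans (clamp_lipschitz _ _) _.
rewrite [X in `|X|](_ : _ = j.+1%:R * (Num.min (t - a) (b - t) - Num.min (u - a) (b - u))); last ring.
rewrite normrM ger0_norm// ler_wpM2l//.
have := ler_norm (t - u); have := ler_norm (u - t).
rewrite (distrC u t) ler_norml; move: `|t - u| => n.
by have [?|?] := leP (t - a) (b - t); have [?|?] := leP (u - a) (b - u); lra.
Qed.

Definition ramp i c v : R := clamp (1 + i.+1%:R * (v - c)).

Lemma ramp_eq1 i c v : c <= v -> ramp i c v = 1.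
Proof. by move=> cv; apply: clamp_eq1; rewrite lerDl mulr_ge0// subr_ge0. Qed.

Lemma ramp_eq0 i c v : v <= c - i.+1%:R^-1 -> ramp i c v = 0.
Proof.
move=> h; apply: clamp_eq0; rewrite addrC -lerBrDr sub0r.
rewrite -(@ler_pM2l _ i.+1%:R^-1) ?invr_gt0// mulKf ?pnatr_eq0// mulrN1.
by move: h; move: (i.+1%:R^-1) => d; lra.
Qed.

Lemma ramp_lipschitz i c v w : `|ramp i c v - ramp i c w| <= i.+1%:R * `|v - w|.
Proof.
apply: le_trans (clamp_lipschitz _ _) _.
rewrite [X in `|X|](_ : _ = i.+1%:R * (v - w)); last ring.
by rewrite normrM ger0_norm.
Qed.

End trapezoids.

Section windowed_supremum.
Context {R : realType}.
Implicit Types (y : cadlag R) (a b t : R).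

(** Values in [0, 1] keep suprema finite, and the Lipschitz rate turns closeness under a time change
    into closeness of suprema. Upper and lower thresholds are treated alike. *)
Record level := Level {
  level_fun :> R -> R;
  level_rate : R;
  level_ge0 : forall v, 0 <= level_fun v;
  level_le1 : forall v, level_fun v <= 1;
  level_rate_ge0 : 0 <= level_rate;
  level_lipschitz : forall v w,
    `|level_fun v - level_fun w| <= level_rate * `|v - w| }.

Definition ramp_up (i : nat) (c : R) : level :=
  @Level (ramp i c) i.+1%:R (fun v => clamp_ge0 _) (fun v => clamp_le1 _)
    (ler0n _ _) (ramp_lipschitz i c).

Lemma ramp_down_lipschitz (i : nat) (c v w : R) :
  `|ramp i (- c) (- v) - ramp i (- c) (- w)| <= i.+1%:R * `|v - w|.
Proof. by rewrite (le_trans (ramp_lipschitz _ _ _ _))// -opprD normrN. Qed.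

Definition ramp_down (i : nat) (c : R) : level :=
  @Level (fun v => ramp i (- c) (- v)) i.+1%:R (fun v => clamp_ge0 _)
    (fun v => clamp_le1 _) (ler0n _ _) (ramp_down_lipschitz i c).

(* Contrary to y |-> g (y t), this functional is J1-continuous, and it controls
   y on the whole interval [a, b]. *)
Definition window_sup j a b (g : level) y : R :=
  sup [set trapezoid j a b t * g (y t) | t in [set t | 0 <= t]].

Let window_has_sup j a b (g : level) y :
  has_sup [set trapezoid j a b t * g (y t) | t in [set t | 0 <= t]].
Proof.
split; first by exists (trapezoid j a b 0 * g (y 0)); exists 0 => //=.
by exists 1 => _ [t _ <-]; rewrite mulr_ile1 ?clamp_ge0 ?clamp_le1 ?level_ge0 ?level_le1.
Qed.

Lemma window_sup_ge j a b (g : level) y t : 0 <= t ->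
  trapezoid j a b t * g (y t) <= window_sup j a b g y.
Proof.
move=> t0; apply: ub_le_sup; first by have [] := window_has_sup j a b g y.
by exists t.
Qed.

Lemma window_sup_ge0 j a b (g : level) y : 0 <= window_sup j a b g y.
Proof.
apply: le_trans (window_sup_ge j a b g y (lexx 0)).
by rewrite mulr_ge0// ?clamp_ge0 ?level_ge0.
Qed.

Lemma window_sup_le j a b (g : level) y (M : R) :
  (forall t, 0 <= t -> trapezoid j a b t * g (y t) <= M) -> window_sup j a b g y <= M.
Proof.
move=> h; apply: ge_sup => [|_ [t t0 <-]]; last exact: h.
by have [] := window_has_sup j a b g y.
Qed.

Lemma window_sup_continuous j a b (g : level) :
  continuous (window_sup j a b g : cadlag R -> R).
Proof.
apply/continuousP => A oA.
suff : J1_open (window_sup j a b g @^-1` A) by [].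
move=> x Ax.
have /nbhs_ballP[r /= r0 hr] : nbhs (window_sup j a b g x) A.
  exact: open_nbhs_nbhs.
(* If a time change moves times and values by less than [e], the trapezoid factor changes by at most
   [j.+1%:R * e] and the level factor by at most [level_rate g * e]. *)
pose K := j.+1%:R + level_rate g.
have K0 : 0 < K by rewrite ltr_wpDr// level_rate_ge0.
pose e := Num.min 1 (r / 2 / K).
have e0 : 0 < e by rewrite lt_min ltr01 !divr_gt0.
have e1 : e <= 1 by rewrite ge_min lexx.
have eK : e * K <= r / 2 by rewrite -ler_pdivlMr// ge_min lexx orbT.
(* The trapezoid vanishes after [b + 1], and times move by less than 1: beyond [T] both paths are
   out of the window. *)
pose T := `|b| + 2.
have j1 : j.+1%:R^-1 <= 1 :> R by rewrite invf_le1// ler1n.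
exists T, e; split=> // y [lam [lamH lamS] lamy]; apply: hr.
have close t : 0 <= t -> t <= T ->
    `|trapezoid j a b t * g (y t) - trapezoid j a b (lam t) * g (x (lam t))| <= r / 2.
  move=> t0 tT; have [|h1 h2] := lamy t; first by rewrite t0.
  apply: le_trans eK.
  rewrite (_ : _ - _ = trapezoid j a b t * (g (y t) - g (x (lam t))) +
    (trapezoid j a b t - trapezoid j a b (lam t)) * g (x (lam t))); last ring.
  rewrite (le_trans (ler_normD _ _))// !normrM /K mulrDr addrC lerD//.
    rewrite (le_trans (ler_piMr _ _))// ?(ger0_norm (level_ge0 _ _)) ?level_le1//.
    rewrite (le_trans (trapezoid_lipschitz _ _ _ _ _))// mulrC ler_wpM2r// distrC.
    exact: ltW.
  rewrite (le_trans (ler_piMl _ _))// ?(ger0_norm (clamp_ge0 _)) ?clamp_le1//.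
  rewrite (le_trans (level_lipschitz _ _ _))// mulrC ler_wpM2r// ?level_rate_ge0//.
  exact: ltW.
have T0 : 0 <= T by rewrite /T addr_ge0.
have lam_ge0 t : 0 <= t -> 0 <= lam t.
  move=> t0; have : (lam @` `[0, +oo[%classic) (lam t).
    by exists t => //=; rewrite in_itv/= t0.
  by rewrite lamS /= in_itv/= andbT.
rewrite /ball/= distrC ltr_distl; apply/andP; split.
  rewrite ltrBlDr (@le_lt_trans _ _ (window_sup j a b g y + r / 2))//; last by lra.
  apply: window_sup_le => u u0.
  (* Surjectivity of the time change is needed here: every time of [x] corresponds to a time of
     [y]. *)
  have [t t0 tu] : (lam @` `[0, +oo[%classic) u by rewrite lamS /= in_itv/= u0.
  move: t0; rewrite /= in_itv/= andbT => t0.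
  have [tT|Tt] := leP t T.
    have := close t t0 tT; rewrite tu ler_distl => /andP[+ _].
    have := window_sup_ge j a b g y t0.
    set p := _ * g (y t); set q := _ * g (x u); lra.
  have [|h1 _] := lamy T; first by rewrite T0 lexx.
  have lTt : lam T < lam t by apply: lamH; rewrite ?in_itv/= ?T0 ?t0.
  rewrite trapezoid_eq0 ?mul0r; first by rewrite addr_ge0 ?window_sup_ge0//; lra.
  apply/orP; right; rewrite -tu (le_trans _ (ltW lTt))//.
  move: h1; rewrite ltr_distl /T => /andP[h1 _].
  have := ler_norm b; move: j1 h1 e1; move: (j.+1%:R^-1) => jj; lra.
rewrite (@le_lt_trans _ _ (window_sup j a b g x + r / 2))//; last by lra.
apply: window_sup_le => t t0; have [tT|Tt] := leP t T.
  have := close t t0 tT; rewrite ler_distl => /andP[_].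
  have := window_sup_ge j a b g x (lam_ge0 _ t0).
  set p := _ * g (y t); set q := _ * g (x _); lra.
rewrite trapezoid_eq0 ?mul0r; first by rewrite addr_ge0 ?window_sup_ge0//; lra.
apply/orP; right; rewrite (le_trans _ (ltW Tt))// /T.
have := ler_norm b; move: j1; move: (j.+1%:R^-1) => jj; lra.
Qed.

Lemma continuous_J1_measurable (f : cadlag R -> R) :
  continuous f -> measurable_fun setT f.
Proof.
move=> /continuousP cf; apply: (measurability (@RGenOpens.G R)) => [|_ [_ [u [v ->]] <-]].
  exact: RGenOpens.measurableE.
by rewrite setTI; apply: sub_sigma_algebra; apply: cf; exact: itv_open.
Qed.

(** The tents have centre [t + 2 / m.+1%:R] and half-width [1 / m.+1%:R]: they shrink to [t] staying
    strictly to its right, so the left limit at [t] is never seen. *)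
Lemma window_sup_cvg (g : level) y t : 0 <= t ->
  window_sup m (t + 2 / m.+1%:R) (t + 2 / m.+1%:R) g y @[m --> \oo] --> g (y t).
Proof.
move=> t0; apply/cvgrPdist_le => e e0.
have [yr _ _] := cadlag_funP y.
have e'0 : 0 < e / (level_rate g + 1).
  by rewrite divr_gt0// ltr_wpDl// level_rate_ge0.
have : \forall s \near t^'+, `|y t - y s| <= e / (level_rate g + 1).
  exact: cvgr_dist_le (yr _ t0) _ e'0.
rewrite near_withinE => -[d /= d0 hd].
have hg s : t < s -> s < t + d -> `|g (y t) - g (y s)| <= e.
  move=> ts sd; rewrite (le_trans (level_lipschitz _ _ _))//.
  have : `|y t - y s| <= e / (level_rate g + 1).
    by apply: hd => //=; rewrite ltr_distlC; lra.
  rewrite ler_pdivlMr; last by rewrite ltr_wpDl// level_rate_ge0.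
  by have := normr_ge0 (y t - y s); have := level_rate_ge0 g; lra.
have d30 : 0 < d / 3 by lra.
near=> m.
have : m.+1%:R^-1 < d / 3 by near: m; exact: near_infty_natSinv_lt (PosNum d30).
have : 0 < m.+1%:R^-1 :> R by rewrite invr_gt0.
rewrite /window_sup; set p := m.+1%:R^-1 => p0 pd.
have c1 : `|g (y t) - g (y (t + 2 * p))| <= e by apply: hg; lra.
rewrite ler_distlC; apply/andP; split; last first.
  apply: window_sup_le => s s0.
  have [sp|ps] := leP s (t + p).
    rewrite trapezoid_eq0 -/p ?mul0r ?addr_ge0 ?level_ge0//; [lra|].
    by apply/orP; left; lra.
  have [ps'|sp'] := leP (t + 3 * p) s.
    rewrite trapezoid_eq0 -/p ?mul0r ?addr_ge0 ?level_ge0//; [lra|].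
    by apply/orP; right; lra.
  rewrite (le_trans (ler_piMl (level_ge0 _ _) (clamp_le1 _)))//.
  by have := hg s; rewrite ler_distlC => h; have := h; lra.
apply: le_trans (window_sup_ge m (t + 2 * p) (t + 2 * p) g y (t := t + 2 * p) _); last by lra.
rewrite trapezoid_eq1 ?lexx// mul1r.
by move: c1; rewrite ler_distlC; lra.
Unshelve. all: by end_near. Qed.

(** A limit of continuous functionals, although evaluation itself need not be continuous.
    [ramp_up 0 c] equals 1 exactly on the half-line of values at least [c], which generates the
    Borel sets. *)
Lemma cadlag_eval_measurable t : measurable_fun setT (fun y : cadlag R => y t).
Proof.
wlog t0 : t / 0 <= t.
  move=> h; have [t0|t0] := leP 0 t; first exact: h.
  rewrite (_ : (fun y : cadlag R => y t) = (fun y => y 0)); first exact: h.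
  by apply/funext => y; have [_ _] := cadlag_funP y; exact.
apply: (measurability (@RGenCInfty.G R)) => [|_ [_ [c ->] <-]].
  exact: RGenCInfty.measurableE.
have mg : measurable_fun setT (fun y : cadlag R => ramp_up 0 c (y t)).
  apply: (measurable_fun_cvg (h := fun m y =>
    window_sup m (t + 2 / m.+1%:R) (t + 2 / m.+1%:R) (ramp_up 0 c) y)).
    by move=> m; apply: continuous_J1_measurable; exact: window_sup_continuous.
  by move=> y _; exact: window_sup_cvg.
rewrite setTI (_ : _ @^-1` _ = setT `&` (fun y : cadlag R => ramp_up 0 c (y t)) @^-1` [set 1]).
  exact: mg.
rewrite setTI; apply/seteqP; split=> y /=; rewrite in_itv/= andbT.
  exact: ramp_eq1.
rewrite /ramp => h; rewrite leNgt; apply/negP => yc; move: h; rewrite /clamp mul1r.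
by rewrite min_r; [have [] := leP 0 (1 + (y t - c)); lra|lra].
Qed.

End windowed_supremum.

(** * Measurability of the point processes *)

Section point_processes.
Context {R : realType}.
Implicit Types (y : cadlag R) (mu : lfmeasure R).

Definition strip (t : R) : set (R * R) := [set p | 0 <= p.1 <= t /\ 0 <= p.2].

Definition subgraph y : set (R * R) := [set p | p.2 <= left_limit y p.1].

Lemma measurable_strip t : measurable (strip t).
Proof.
rewrite (_ : strip t = `[0, t]%classic `*` `[0, +oo[%classic).
  exact: measurableX.
by apply/seteqP; split=> p /=; rewrite !in_itv/= andbT.
Qed.

Lemma measurable_box (r : R) : measurable (box r).
Proof.
rewrite (_ : box r = `[0, r]%classic `*` `[0, r]%classic).
  exact: measurableX.
by apply/seteqP; split=> p /=; rewrite !in_itv.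
Qed.

Lemma measurable_subgraph y : measurable (subgraph y).
Proof.
rewrite (_ : subgraph y = setT `&`
    (fun p : R * R => p.2 <= left_limit y p.1) @^-1` [set true]); last first.
  by rewrite setTI.
apply: measurable_fun_ler => //.
exact: (measurableT_comp (left_limit_measurable y) measurable_fst).
Qed.

Lemma left_limit_ge y (s c : R) :
  (\forall r \near s^'-, c <= y r) -> c <= left_limit y s.
Proof.
move=> h; apply: limr_ge => //.
by apply/cvg_ex; exists (left_limit y s); exact: left_limit_cvg.
Qed.

Lemma left_limit_le y (s c : R) :
  (\forall r \near s^'-, y r <= c) -> left_limit y s <= c.
Proof.
move=> h; apply: limr_le => //.
by apply/cvg_ex; exists (left_limit y s); exact: left_limit_cvg.
Qed.

Lemma left_limit_bounded y (T M s : R) : (forall r, 0 <= r <= T -> y r <= M) ->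
  0 <= s <= T -> left_limit y s <= M.
Proof.
move=> yM /andP[s0 sT]; apply: left_limit_le.
near=> r; have rs : r <= s by near: r; exact: nbhs_left_le.
have [r0|r0] := leP 0 r; first by apply: yM; rewrite r0 (le_trans rs).
have [_ _ yN] := cadlag_funP y.
by rewrite yN//; apply: yM; rewrite lexx (le_trans s0).
Unshelve. all: by end_near. Qed.

Lemma strip_subgraph_box y t : exists r : R, strip t `&` subgraph y `<=` box r.
Proof.
have [M yM] := cadlag_bounded y t.
exists (Num.max t M) => p [[/andP[p0 pt] p20] Gp]; split.
  by rewrite p0 le_max pt.
rewrite p20 le_max; apply/orP; right; apply: le_trans Gp _.
apply: (@left_limit_bounded _ t); last by rewrite p0.
by move=> r hr; apply: le_trans (ler_norm _) (yM _ hr).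
Qed.

Lemma box_subset (r r' : R) : r <= r' -> box r `<=` box r'.
Proof.
move=> rr' p [/andP[p0 pr] /andP[q0 qr]]; split.
  by rewrite p0 (le_trans pr).
by rewrite q0 (le_trans qr).
Qed.

Lemma point_processE y mu t :
  point_process y mu t = fine (mu (strip (Num.max 0 t) `&` subgraph y)).
Proof.
rewrite /= /point_process_fun /Rintegral.
rewrite (integral_indic mu (measurable_strip (Num.max 0 t)) (measurable_subgraph y)).
by rewrite setIC.
Qed.

Section random.
Context d (T : measurableType d) (Y : T -> cadlag R) (pi : T -> lfmeasure R).
Context (mY : forall t, measurable_fun setT (fun w => Y w t)).
Context (mpi : forall B, measurable B -> measurable_fun setT (fun w => pi w B)).

(** Reading the path at the next grid point, strictly to the right of [s], involves countably many
    times; right-continuity gives the limit. *)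
Lemma cadlag_joint_measurable :
  measurable_fun setT (fun p : T * R => Y p.1 p.2).
Proof.
pose k n (s : R) := Num.truncn (n.+1%:R * s).
pose h n (p : T * R) : R := Y p.1 ((k n p.2).+1%:R / n.+1%:R).
have mk n : measurable_fun setT (fun s => (k n s)%:R : R).
  apply: nondecreasing_measurable => // s t st.
  by rewrite ler_nat le_truncn// ler_pM2l.
apply: (@measurable_fun_cvg _ _ _ _ h).
  move=> n _ B mB; rewrite setTI.
  rewrite (_ : h n @^-1` B = \bigcup_j
      (((fun w => Y w (j.+1%:R / n.+1%:R)) @^-1` B) `*`
       ((fun s => (k n s)%:R : R) @^-1` [set j%:R]))); last first.
    apply/seteqP; split=> [[w s] hs|[w s] [j _ /= [Bj]]] /=.
      by exists (k n s) => //; split.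
    by move=> /eqP; rewrite eqr_nat => /eqP kj; rewrite /h /= kj.
  apply: bigcup_measurable => j _; apply: measurableX.
    by rewrite -[X in measurable X]setTI; apply: mY.
  by rewrite -[X in measurable X]setTI; apply: mk.
move=> [w s] _; rewrite /h /=; set y := Y w.
have [yr yl yN] := cadlag_funP y.
have [s0|s0] := leP 0 s.
  have ks n : s < (k n s).+1%:R / n.+1%:R <= s + n.+1%:R^-1.
    apply/andP; split; first by rewrite ltr_pdivlMr// mulrC truncnS_gt.
    rewrite ler_pdivrMr// mulrDl mulVf ?pnatr_eq0// -natr1 lerD2r [s * _]mulrC.
    by rewrite truncn_le mulr_ge0.
  have /cvg_at_rightP := yr s s0; apply; split.
    by move=> n; have /andP[] := ks n.
  apply: (@squeeze_cvgr _ _ _ _ (cst s) (fun n => s + n.+1%:R^-1)).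
  - by near=> n; have /andP[/ltW -> ->] := ks n.
  - exact: cvg_cst.
  - rewrite -[X in _ --> X]addr0; apply: cvgD; first exact: cvg_cst.
    exact: cvg_harmonic.
have k0 n : k n s = 0%N.
  by apply/truncn0Pn; rewrite -ltNge (lt_trans _ ltr01)// pmulr_rlt0.
rewrite yN//; under eq_fun do rewrite k0 mul1r.
have /cvg_at_rightP := yr 0 (lexx _); apply; split=> //; exact: cvg_harmonic.
Unshelve. all: by end_near. Qed.

Lemma left_limit_joint_measurable :
  measurable_fun setT (fun p : T * R => left_limit (Y p.1) p.2 : R).
Proof.
apply: (@measurable_fun_cvg _ _ R setT (fun n (p : T * R) => Y p.1 (p.2 - n.+1%:R^-1))
  (fun p : T * R => left_limit (Y p.1) p.2 : R)).
  move=> n; apply: (measurableT_comp cadlag_joint_measurable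
    (g := fun p : T * R => (p.1, p.2 - n.+1%:R^-1))).
  by apply/measurable_fun_pair => //; exact: measurable_funB.
move=> [w s] _ /=; have /cvg_at_leftP := left_limit_cvg (y := Y w) (s := s); apply; split.
  by move=> n; rewrite ltrBlDr ltrDl.
rewrite -[X in _ --> X]subr0; apply: cvgB; first exact: cvg_cst.
exact: cvg_harmonic.
Qed.

(** A random measure seen as a kernel, so that the measurability of masses of sections applies. *)
Let kpi (w : T) : {measure set (R * R) -> \bar R} := lfmeasure_measure (pi w).

HB.instance Definition _ := isKernel.Build _ _ _ _ R kpi mpi.

(** The kernel is only locally finite; the restriction to a box provides the finite bound required
    for sections. *)
Lemma random_section_measurable (A : set (T * (R * R))) (r : R) :
  measurable A -> measurable_fun setT (fun w => pi w (xsection A w `&` box r)).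
Proof.
move=> mA.
have [|_ h] := @measurable_prod_subset_xsection_kernel _ _ _ _ _ kpi
  (box r) (measurable_box r) _ A mA; last exact: h.
move=> w; exists (fine (pi w (box r)) + 1) => B mB.
have bfin : pi w (box r) \is a fin_num by rewrite ge0_fin_numE// lfmeasure_box.
rewrite /= /mrestr (@le_lt_trans _ _ (pi w (box r)))//.
  apply: le_measure; rewrite ?inE//; [|exact: measurable_box].
  by apply: measurableI => //; exact: measurable_box.
by rewrite EFinD fineK// lteDl// lte_fin.
Qed.

Lemma point_process_measurable t :
  measurable_fun setT (fun w => point_process (Y w) (pi w) t).
Proof.
set u := Num.max 0 t.
rewrite (_ : (fun w => _) = fine \o (fun w => pi w (strip u `&` subgraph (Y w)))); last first.
  by apply/funext => w; rewrite point_processE.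
apply: measurableT_comp => //.
pose A := [set p : T * (R * R) | p.2.2 <= left_limit (Y p.1) p.2.1] `&` (setT `*` strip u).
have mA : measurable A.
  apply: measurableI; last by apply: measurableX => //; exact: measurable_strip.
  rewrite (_ : [set p | _] = setT `&`
    (fun p : T * (R * R) => p.2.2 <= left_limit (Y p.1) p.2.1) @^-1` [set true]); last first.
    by rewrite setTI.
  apply: measurable_fun_ler => //; first exact: measurableT_comp.
  apply: (measurableT_comp left_limit_joint_measurable
    (g := fun p : T * (R * R) => (p.1, p.2.1))).
  by apply/measurable_fun_pair => //; exact: measurableT_comp.
have AE w : xsection A w = strip u `&` subgraph (Y w).
  apply/seteqP; split=> p; rewrite /xsection /= inE.
    by move=> [h1 [_ h2]].
  by move=> [h1 h2].
apply: (emeasurable_fun_cvg (fun n w => pi w (xsection A w `&` box n%:R))).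
  by move=> n; exact: random_section_measurable.
(* For fixed [w] the path is bounded on [0, u], so the region under it lies in a box and the
   sequence is eventually constant. *)
move=> w _; apply: cvg_near_cst.
have [r hr] := strip_subgraph_box (Y w) u.
near=> n; rewrite AE setIidl//; apply: subset_trans hr _; apply: box_subset.
by near: n; exact: nbhs_infty_ger.
Unshelve. all: by end_near. Qed.

End random.
End point_processes.

(** * Vaguely continuous functionals *)

Section vague_functionals.
Context {R : realType}.
Implicit Types (a b c e : R) (j : nat) (mu : lfmeasure R).

Lemma trapezoid_continuous j a b : continuous (trapezoid j a b : R -> R).
Proof.
move=> t; apply/cvgrPdist_lt => e e0.
have e'0 : 0 < e / j.+1%:R by rewrite divr_gt0.
apply/nbhs_ballP; exists (e / j.+1%:R) => //= s; rewrite /ball/= => ts.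
by apply: le_lt_trans (trapezoid_lipschitz _ _ _ _ _) _; rewrite mulrC -ltr_pdivlMr.
Qed.

Definition pyramid j a b c e (p : R * R) : R :=
  trapezoid j a b p.1 * trapezoid j c e p.2.

Lemma pyramid_continuous j a b c e : continuous (pyramid j a b c e).
Proof.
move=> p; apply: cvgM.
  by apply: (cvg_comp _ _ cvg_fst); exact: trapezoid_continuous.
by apply: (cvg_comp _ _ cvg_snd); exact: trapezoid_continuous.
Qed.

Lemma pyramid_ge0 j a b c e p : 0 <= pyramid j a b c e p.
Proof. by rewrite mulr_ge0 ?clamp_ge0. Qed.

Lemma pyramid_le1 j a b c e p : pyramid j a b c e p <= 1.
Proof. by rewrite mulr_ile1 ?clamp_ge0 ?clamp_le1. Qed.

Lemma pyramid_measurable j a b c e : measurable_fun setT (pyramid j a b c e).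
Proof.
have mt u v : measurable_fun setT (trapezoid j u v : R -> R).
  by apply: continuous_measurable_fun; exact: trapezoid_continuous.
apply: measurable_funM.
  exact: (measurableT_comp (mt a b) measurable_fst).
exact: (measurableT_comp (mt c e) measurable_snd).
Qed.

Lemma pyramid_eq0 j a b c e p :
  ~ (a - j.+1%:R^-1 <= p.1 <= b + j.+1%:R^-1 /\
     c - j.+1%:R^-1 <= p.2 <= e + j.+1%:R^-1) -> pyramid j a b c e p = 0.
Proof.
rewrite /pyramid => h.
have [h1|h1] := boolP (a - j.+1%:R^-1 <= p.1 <= b + j.+1%:R^-1).
  have [h2|h2] := boolP (c - j.+1%:R^-1 <= p.2 <= e + j.+1%:R^-1).
    by exfalso; apply: h.
  rewrite [X in _ * X]trapezoid_eq0 ?mulr0//; move: h2.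
  by rewrite negb_and -!ltNge => /orP[] /ltW ->; rewrite ?orbT.
rewrite trapezoid_eq0 ?mul0r//; move: h1.
by rewrite negb_and -!ltNge => /orP[] /ltW ->; rewrite ?orbT.
Qed.

Lemma pyramid_test_function j a b c e : test_function (pyramid j a b c e).
Proof.
split; first by apply: continuous_subspaceT => p; exact: pyramid_continuous.
exists (`[a - j.+1%:R^-1, b + j.+1%:R^-1]%classic `*`
        `[c - j.+1%:R^-1, e + j.+1%:R^-1]%classic).
  by apply: compact_setX; exact: segment_compact.
by move=> p _ np; apply: pyramid_eq0 => -[h1 h2]; apply: np; split; rewrite /= in_itv/=.
Qed.

Definition pyramid_integral j a b c e mu : R :=
  \int[mu]_(p in quadrant) pyramid j a b c e p.

Lemma pyramid_integral_continuous j a b c e :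
  continuous (pyramid_integral j a b c e : lfmeasure R -> R).
Proof.
pose f : set_type (@test_function R) :=
  exist _ (pyramid j a b c e) (mem_set (pyramid_test_function j a b c e)).
have -> : pyramid_integral j a b c e = proj f \o @vague_eval R by [].
move=> mu.
have h1 := @initial_continuous (lfmeasure R) _ (@vague_eval R) mu.
have h2 := @proj_continuous _ (fun _ : set_type (@test_function R) => R) f (vague_eval mu).
exact: (cvg_comp _ _ h1 h2).
Qed.

Lemma measurable_quadrant : measurable (quadrant : set (R * R)).
Proof.
rewrite (_ : quadrant = `[0, +oo[%classic `*` `[0, +oo[%classic).
  exact: measurableX.
by apply/seteqP; split=> p /=; rewrite !in_itv/= !andbT.
Qed.

(** Stated with extended integrals because finiteness of the integral is itself deduced from the
    upper bound. *)
Let integral_bounds j a b c e mu (P Q : set (R * R)) :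
  measurable P -> P `<=` quadrant -> (forall p, P p -> pyramid j a b c e p = 1) ->
  measurable Q -> (forall p, quadrant p -> ~ Q p -> pyramid j a b c e p = 0) ->
  (mu P <= \int[mu]_(p in quadrant) (pyramid j a b c e p)%:E <= mu (Q `&` quadrant))%E.
Proof.
move=> mP Pq P1 mQ Q0; have mq := measurable_quadrant.
apply/andP; split.
  rewrite -[X in mu X](setIidl Pq) -integral_indic//.
  apply: ge0_le_integral => //.
  - by apply/measurable_EFinP; apply: measurable_funTS; exact: measurable_indic.
  - by apply/measurable_EFinP; apply: measurable_funTS; exact: pyramid_measurable.
  - move=> p _; rewrite lee_fin indicE; case: (boolP (p \in P)).
      by rewrite inE => /P1 ->.
    by rewrite pyramid_ge0.
rewrite -integral_indic//.
apply: ge0_le_integral => //.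
- by move=> p _; rewrite lee_fin pyramid_ge0.
- by apply/measurable_EFinP; apply: measurable_funTS; exact: pyramid_measurable.
- by apply/measurable_EFinP; apply: measurable_funTS; exact: measurable_indic.
- move=> p qp; rewrite lee_fin indicE; case: (boolP (p \in Q)).
    by rewrite pyramid_le1.
  by move=> /negP; rewrite inE => nQ; rewrite Q0.
Qed.

Lemma pyramid_integral_fin_num j a b c e mu :
  (\int[mu]_(p in quadrant) (pyramid j a b c e p)%:E)%E \is a fin_num.
Proof.
have [r hr] : exists r : R, b + j.+1%:R^-1 <= r /\ e + j.+1%:R^-1 <= r.
  by exists (Num.max (b + j.+1%:R^-1) (e + j.+1%:R^-1)); rewrite !le_max !lexx orbT.
have /andP[_ h] : (mu set0 <=
    \int[mu]_(p in quadrant) (pyramid j a b c e p)%:E <= mu (box r `&` quadrant))%E.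
  apply: integral_bounds => //; first exact: measurable_box.
  move=> p [p1 p2] nb; apply: pyramid_eq0 => -[/andP[_ h1] /andP[_ h2]]; apply: nb.
  by split; rewrite ?p1 ?p2 /=; [apply: le_trans h1 hr.1|apply: le_trans h2 hr.2].
rewrite ge0_fin_numE.
  apply: le_lt_trans h _; apply: le_lt_trans (lfmeasure_box mu r).
  apply: le_measure; rewrite ?inE//; [|exact: measurable_box].
  by apply: measurableI; [exact: measurable_box|exact: measurable_quadrant].
by apply: integral_ge0 => p _; rewrite lee_fin pyramid_ge0.
Qed.

Lemma pyramid_integral_ge j a b c e mu (P : set (R * R)) :
  measurable P -> P `<=` quadrant -> (forall p, P p -> pyramid j a b c e p = 1) ->
  (mu P <= (pyramid_integral j a b c e mu)%:E)%E.
Proof.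
move=> mP Pq P1; rewrite /pyramid_integral /Rintegral fineK.
  have /andP[] : (mu P <= \int[mu]_(p in quadrant) (pyramid j a b c e p)%:E <=
      mu (setT `&` quadrant))%E; last by [].
    by apply: integral_bounds => // p _ /(_ I).
exact: pyramid_integral_fin_num.
Qed.

Lemma pyramid_integral_le j a b c e mu (Q : set (R * R)) :
  measurable Q -> (forall p, quadrant p -> ~ Q p -> pyramid j a b c e p = 0) ->
  ((pyramid_integral j a b c e mu)%:E <= mu (Q `&` quadrant))%E.
Proof.
move=> mQ Q0; rewrite /pyramid_integral /Rintegral fineK.
  have /andP[] : (mu set0 <= \int[mu]_(p in quadrant) (pyramid j a b c e p)%:E <=
      mu (Q `&` quadrant))%E; last by [].
    exact: integral_bounds.
exact: pyramid_integral_fin_num.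
Qed.

End vague_functionals.

(** * Atoms of simple point measures *)

Section atoms.
Context {R : realType}.
Implicit Types (mu : lfmeasure R) (p q : R * R).

(** Recovers from the measure alone the set whose mere existence [simple_point_measure] asserts. *)
Definition atoms mu : set (R * R) := [set p | (0 < mu [set p])%E].

Lemma measurable_point p : measurable [set p].
Proof.
case: p => a b; rewrite (_ : [set (a, b)] = [set a] `*` [set b]).
  exact: measurableX.
by apply/seteqP; split=> [[x y] [-> ->]|[x y] [/= -> ->]].
Qed.

Lemma simple_atoms mu : simple_point_measure mu ->
  [/\ atoms mu `<=` quadrant, forall r, finite_set (atoms mu `&` box r) &
      forall B, measurable B -> mu B = counting (atoms mu `&` B)].
Proof.
move=> [S [Sq Sfin muS]]; suff -> : atoms mu = S by [].
apply/seteqP; split=> p; rewrite /atoms /= (muS _ (measurable_point p)).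
  move=> h; apply: contrapT => nSp; move: h.
  rewrite (_ : S `&` [set p] = set0) ?measure0 ?ltxx//.
  by apply/seteqP; split=> q //= [Sq' qp]; apply: nSp; rewrite -qp.
move=> Sp; rewrite (_ : S `&` [set p] = [set p]); last first.
  by apply/seteqP; split=> q /= [] // ->.
by rewrite /counting/=; case: asboolP => [_|[]//]; rewrite fset_set1 cardfs1 lte_fin.
Qed.

Lemma counting_finite (A : set (R * R)) : finite_set A ->
  counting A = (#|` fset_set A|)%:R%:E :> \bar R.
Proof. by move=> finA; rewrite /counting; case: asboolP. Qed.

Lemma counting_gt0 (A : set (R * R)) : (0 < counting A :> \bar R)%E -> A !=set0.
Proof.
by apply: contraPP => /set0P/negP/negPn/eqP ->; rewrite counting_finite// fset_set0 cardfs0 ltxx.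
Qed.

Lemma counting_subset (A B : set (R * R)) : finite_set B -> A `<=` B ->
  (counting A <= counting B :> \bar R)%E.
Proof.
move=> finB AB; have finA := sub_finite_set AB finB.
by rewrite !counting_finite// lee_fin ler_nat fsubset_leq_card// -fset_set_sub.
Qed.

Lemma counting_image (A B : set (R * R)) (f : R * R -> R * R) :
  finite_set A -> {in A &, injective f} -> f @` A = B ->
  counting A = counting B :> \bar R.
Proof.
move=> finA finj <-; have finB : finite_set (f @` A) by exact: finite_image.
rewrite !counting_finite//; congr (_%:R%:E); apply/esym/(fcard_eq finB finA).
exact: inj_card_eq.
Qed.

(** The pigeonhole step by which a bound on the mass excludes additional atoms. *)
Lemma image_counting_le (A B : set (R * R)) (f : R * R -> R * R) :
  finite_set A -> finite_set B -> {in A &, injective f} -> f @` A `<=` B ->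
  (counting B <= counting A :> \bar R)%E -> B = f @` A.
Proof.
move=> finA finB finj fAB.
rewrite (counting_image finA finj erefl) !counting_finite//; last exact: finite_image.
rewrite lee_fin ler_nat => h; have finfA : finite_set (f @` A) by exact: finite_image.
apply: fset_set_inj => //; apply/eqP; rewrite eq_sym eqEfcard h andbT.
by rewrite -fset_set_sub.
Qed.

End atoms.

(** * Time changes through finitely many prescribed points *)

Section interpolation.
Context {R : realType}.

(** The targets are [2 * d] apart, so the windows of radius [d] around them are disjoint and one
    bump per window can be composed without interference. *)
Lemma increasing_interpolation (d : R) (l : seq (R * R)) : 0 < d ->
  (forall p, p \in l -> `|p.1 - p.2| < d) ->
  pairwise (fun p q : R * R => 2 * d <= `|p.2 - q.2|) l ->
  exists lam, [/\ increasing_bijection lam, forall t, `|lam t - t| < d,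
    forall t, (forall p, p \in l -> d <= `|t - p.2|) -> lam t = t &
    forall p, p \in l -> lam p.1 = p.2].
Proof.
move=> d0; elim: l => [|[s' s] l IH] ld.
  move=> _; exists id; split=> //; first exact: increasing_bijection_id.
  by move=> t; rewrite subrr normr0.
rewrite /= => /andP[/allP sl pl].
have [p pin|lam [lamb lamd lamid laml]] := IH _ pl; first by apply: ld; rewrite inE pin orbT.
have s's : `|s' - s| < d by apply: (ld (s', s)); rewrite inE eqxx.
have [h1 h2] : s - d < s' /\ s' < s + d by move: s's; rewrite ltr_distl => /andP.
have [h3 h4] : s - d < s /\ s < s + d by split; lra.
have far p : p \in l -> 2 * d <= `|s - p.2| by move=> /sl.
have lam_win t : `|t - s| < d -> lam t = t.
  move=> ts; apply: lamid => p /far h.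
  have := ler_distD t s p.2; rewrite (distrC s t); lra.
pose b := pl_bump (s - d) (s + d) s' s.
have bb : increasing_bijection b by exact: pl_bump_bijection.
have b_out t : d <= `|t - s| -> b t = t.
  move=> h; apply: pl_bump_out => //; move: h; rewrite leNgt ltr_distl negb_and -!leNgt.
  by [].
exists (b \o lam); split=> /=.
- exact: increasing_bijection_comp.
- move=> t; have [ts|ts] := ltP (`|lam t - s|) d; last by rewrite b_out.
  (* [lam] fixes the window of [s], to which [lam t] belongs, so [lam (lam t) = lam t]; strict
     monotonicity then excludes [lam t != t]. *)
  have tl : lam t = t.
    have [t_lt|lt_t|//] := ltgtP (lam t) t.
      have : lam (lam t) < lam t by rewrite (increasing_bijection_ltE lamb).
      by rewrite (lam_win _ ts) ltxx.
    have : lam t < lam (lam t) by rewrite (increasing_bijection_ltE lamb).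
    by rewrite (lam_win _ ts) ltxx.
  by rewrite tl (le_lt_trans (pl_bump_dist _ _ _ _ _))// distrC.
- move=> t ht; rewrite lamid; last by move=> p pl'; apply: ht; rewrite inE pl' orbT.
  by apply: b_out; apply: (ht (s', s)); rewrite inE eqxx.
- move=> p; rewrite inE => /predU1P[->|pl'] /=.
    by rewrite lam_win// /b pl_bump_node.
  rewrite laml// b_out// distrC; have := far _ pl'; lra.
Qed.

End interpolation.

(** * Continuity of the jumps at generic states *)

Section stable_constraints.
Context {R : realType}.

(** All indices are kept together, so that one filter serves every finite [n] as well as the whole
    sequence. *)
Definition state : Type := nat -> cadlag R * lfmeasure R.

Implicit Types (x u : state) (k j i : nat).

(** Index, kind, sharpness, an integer (a mass bound or the steepness of a ramp) and rational
    parameters: a countable type, so that finite lists of constraints can be enumerated. *)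
Definition constraint : Type :=
  (nat * nat * nat * nat * (rat * rat * rat * rat))%type.

(* Kinds 0 and 1 bound the mass of the k-th measure near a rational rectangle from
   below and from above; kinds 2 and 3 keep the k-th path below and above the level
   q2 during [q0, q1]. *)
Definition slack (c : constraint) x : R :=
  let '(k, kind, j, i, (q0, q1, q2, q3)) := c in
  match kind with
  | 0%N => pyramid_integral j (ratr q0) (ratr q1) (ratr q2) (ratr q3) (x k).2 - 2^-1
  | 1%N => i%:R + 2^-1 -
      pyramid_integral j (ratr q0) (ratr q1) (ratr q2) (ratr q3) (x k).2
  | 2%N => 2^-1 - window_sup j (ratr q0) (ratr q1) (ramp_up i (ratr q2)) (x k).1
  | _ => 2^-1 - window_sup j (ratr q0) (ratr q1) (ramp_down i (ratr q2)) (x k).1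
  end.

(** The threshold 1/2 in [slack] leaves strict room at the reference state, where masses are
    integers and the suprema used vanish, and still decides the integer masses of nearby states. *)
Definition satisfies (c : constraint) : set state := [set x | 0 < slack c x].

Definition state_nbhs x : set_system state := cylinder_filter satisfies x.

Global Instance state_nbhs_filter x : Filter (state_nbhs x).
Proof. exact: cylinder_filter_filter. Qed.

Lemma near_pyramid_gt x k j (q0 q1 q2 q3 : rat) :
  2^-1 < pyramid_integral j (ratr q0) (ratr q1) (ratr q2) (ratr q3) (x k).2 ->
  \forall u \near state_nbhs x,
  2^-1 < pyramid_integral j (ratr q0) (ratr q1) (ratr q2) (ratr q3) ((u : state) k).2.
Proof.
move=> h; pose c : constraint := (k, 0, j, 0, (q0, q1, q2, q3))%N.
apply: (filterS _ (@cylinder_filter1 _ _ satisfies x c _)).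
  by move=> y; rewrite /satisfies /= subr_gt0.
by rewrite /satisfies /= subr_gt0.
Qed.

Lemma near_pyramid_lt x k j i (q0 q1 q2 q3 : rat) :
  pyramid_integral j (ratr q0) (ratr q1) (ratr q2) (ratr q3) (x k).2 < i%:R + 2^-1 ->
  \forall u \near state_nbhs x,
  pyramid_integral j (ratr q0) (ratr q1) (ratr q2) (ratr q3) ((u : state) k).2 < i%:R + 2^-1.
Proof.
move=> h; pose c : constraint := (k, 1, j, i, (q0, q1, q2, q3))%N.
apply: (filterS _ (@cylinder_filter1 _ _ satisfies x c _)).
  by move=> y; rewrite /satisfies /= subr_gt0.
by rewrite /satisfies /= subr_gt0.
Qed.

Lemma near_ramp_up x k j i (q0 q1 q2 : rat) :
  window_sup j (ratr q0) (ratr q1) (ramp_up i (ratr q2)) (x k).1 < 2^-1 ->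
  \forall u \near state_nbhs x,
  window_sup j (ratr q0) (ratr q1) (ramp_up i (ratr q2)) ((u : state) k).1 < 2^-1.
Proof.
move=> h; pose c : constraint := (k, 2, j, i, (q0, q1, q2, 0%R))%N.
apply: (filterS _ (@cylinder_filter1 _ _ satisfies x c _)).
  by move=> y; rewrite /satisfies /= subr_gt0.
by rewrite /satisfies /= subr_gt0.
Qed.

Lemma near_ramp_down x k j i (q0 q1 q2 : rat) :
  window_sup j (ratr q0) (ratr q1) (ramp_down i (ratr q2)) (x k).1 < 2^-1 ->
  \forall u \near state_nbhs x,
  window_sup j (ratr q0) (ratr q1) (ramp_down i (ratr q2)) ((u : state) k).1 < 2^-1.
Proof.
move=> h; pose c : constraint := (k, 3, j, i, (q0, q1, q2, 0%R))%N.
apply: (filterS _ (@cylinder_filter1 _ _ satisfies x c _)).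
  by move=> y; rewrite /satisfies /= subr_gt0.
by rewrite /satisfies /= subr_gt0.
Qed.

(** The margins [j.+1%:R^-1] in time and level make the supremum vanish at [x], whereas one visit at
    level [c] during [a, b] would bring it to 1. *)
Lemma near_path_lt x k j (a b c : rat) :
  (forall t : R, ratr a - j.+1%:R^-1 <= t <= ratr b + j.+1%:R^-1 -> 0 <= t ->
    (x k).1 t <= ratr c - j.+1%:R^-1) ->
  \forall u \near state_nbhs x,
  forall t : R, ratr a <= t <= ratr b -> 0 <= t -> ((u : state) k).1 t < ratr c.
Proof.
move=> h; have := @near_ramp_up x k j j a b c.
have ws0 : window_sup j (ratr a) (ratr b) (ramp_up j (ratr c)) (x k).1 < 2^-1.
  apply: (@le_lt_trans _ _ 0) => //; apply: window_sup_le => t t0.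
  have [tab|tab] := boolP (ratr a - j.+1%:R^-1 <= t <= ratr b + j.+1%:R^-1).
    by rewrite /= ramp_eq0 ?mulr0//; exact: h.
  rewrite trapezoid_eq0 ?mul0r//; move: tab.
  by rewrite negb_and -!ltNge => /orP[] /ltW ->; rewrite ?orbT.
move=> /(_ ws0); apply: filterS => u wu t tab t0; rewrite ltNge; apply/negP => ct.
have := le_lt_trans (window_sup_ge j (ratr a) (ratr b) (ramp_up j (ratr c)) (u k).1 t0) wu.
rewrite trapezoid_eq1//= ramp_eq1// mulr1; lra.
Qed.

Lemma near_path_gt x k j (a b c : rat) :
  (forall t : R, ratr a - j.+1%:R^-1 <= t <= ratr b + j.+1%:R^-1 -> 0 <= t ->
    ratr c + j.+1%:R^-1 <= (x k).1 t) ->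
  \forall u \near state_nbhs x,
  forall t : R, ratr a <= t <= ratr b -> 0 <= t -> ratr c < ((u : state) k).1 t.
Proof.
move=> h; have := @near_ramp_down x k j j a b c.
have ws0 : window_sup j (ratr a) (ratr b) (ramp_down j (ratr c)) (x k).1 < 2^-1.
  apply: (@le_lt_trans _ _ 0) => //; apply: window_sup_le => t t0.
  have [tab|tab] := boolP (ratr a - j.+1%:R^-1 <= t <= ratr b + j.+1%:R^-1).
    by rewrite /= ramp_eq0 ?mulr0// -opprD lerN2; exact: h.
  rewrite trapezoid_eq0 ?mul0r//; move: tab.
  by rewrite negb_and -!ltNge => /orP[] /ltW ->; rewrite ?orbT.
move=> /(_ ws0); apply: filterS => u wu t tab t0; rewrite ltNge; apply/negP => ct.
have := le_lt_trans (window_sup_ge j (ratr a) (ratr b) (ramp_down j (ratr c)) (u k).1 t0) wu.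
rewrite trapezoid_eq1//= ramp_eq1 ?lerN2// mulr1; lra.
Qed.

Lemma rat_close (r d : R) : 0 < d -> exists q : rat, `|r - ratr q| < d.
Proof.
move=> d0; have [] := @rat_in_itvoo R (r - d) (r + d); first by lra.
by move=> q; rewrite in_itv/= => hq; exists q; rewrite ltr_distlC.
Qed.

Definition rectangle (a b : R) : set (R * R) :=
  [set p | 0 <= p.1 <= a /\ 0 <= p.2 <= b].

Lemma measurable_itv2 (a b c e : R) :
  measurable [set p : R * R | a <= p.1 <= b /\ c <= p.2 <= e].
Proof.
rewrite (_ : [set p | _] = `[a, b]%classic `*` `[c, e]%classic).
  exact: measurableX.
by apply/seteqP; split=> p /=; rewrite !in_itv.
Qed.

(** With [d] the inverse of [j.+1]: a rational centre is within [d] of [p] and the pyramid around it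
    reaches [2 * d], hence the distance [3 * d]. Around that centre the path keeps to one side of
    the atom, so both left limits compare in the same way. *)
Lemma near_atom x k (p : R * R) j :
  simple_point_measure (x k).2 -> atoms (x k).2 p -> 10 / j.+1%:R < p.1 ->
  (forall t, `|t - p.1| < 10 / j.+1%:R -> p.2 + 10 / j.+1%:R < (x k).1 t) \/
  (forall t, `|t - p.1| < 10 / j.+1%:R -> (x k).1 t < p.2 - 10 / j.+1%:R) ->
  \forall u \near state_nbhs x, simple_point_measure ((u : state) k).2 ->
  exists p', [/\ atoms (u k).2 p', `|p'.1 - p.1| <= 3 / j.+1%:R,
    `|p'.2 - p.2| <= 3 / j.+1%:R &
    (p'.2 <= left_limit (u k).1 p'.1) = (p.2 <= left_limit (x k).1 p.1)].
Proof.
move=> simx atp; set d : R := j.+1%:R^-1 => p10 dich.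
have d0 : 0 < d by rewrite invr_gt0.
pose dq : rat := j.+1%:R^-1.
have dqE : ratr dq = d by rewrite /dq fmorphV/= ratr_nat.
have [atq _ muB] := simple_atoms simx.
have [s hs] := rat_close p.1 d0; have [z hz] := rat_close p.2 d0.
move: hs hz; rewrite !ltr_distlC => /andP[s1 s2] /andP[z1 z2].
have pyr : \forall u \near state_nbhs x, 2^-1 <
    pyramid_integral j (ratr (s - dq)) (ratr (s + dq)) (ratr (z - dq)) (ratr (z + dq)) ((u : state) k).2.
  apply: near_pyramid_gt; apply: (@lt_le_trans _ _ 1); first by lra.
  have := @pyramid_integral_ge R j (ratr (s - dq)) (ratr (s + dq)) (ratr (z - dq))
     (ratr (z + dq)) (x k).2 [set p] (measurable_point p).
  rewrite (muB _ (measurable_point p)) (_ : atoms _ `&` _ = [set p]); last first.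
    by apply/seteqP; split=> [q [_ ->]|q ->].
  rewrite counting_finite// fset_set1 cardfs1 lee_fin; apply.
    by move=> _ ->; exact: atq.
  by move=> _ ->; rewrite /pyramid !trapezoid_eq1 ?mulr1// !rmorphD/= !rmorphN/= dqE; lra.
have pth : \forall u \near state_nbhs x, forall p' : R * R,
    `|p'.1 - ratr s| <= 2 * d -> `|p'.2 - ratr z| <= 2 * d ->
    (p'.2 <= left_limit ((u : state) k).1 p'.1) = (p.2 <= left_limit (x k).1 p.1).
  have nearl (q c r : R) : c < q -> \forall t \near q^'-, c < t < q.
    move=> cq; near=> t; apply/andP; split; near: t.
      exact: nbhs_left_gt.
    exact: nbhs_left_lt.
  case: dich => dich.
    (* The left limit at [p'.1], itself within [2 * d] of the centre, looks back by at most [d]: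
       hence 3. Adding the margin [d] and the error on the centre gives less than [5 * d], covered
       by 10. *)
    have := @near_path_gt x k j (s - 3 * dq) (s + 3 * dq) (z + 3 * dq).
    rewrite !rmorphD/= !rmorphN/= !rmorphM/= dqE ratr_nat => H.
    have /H : forall t : R, ratr s - 3 * d - j.+1%:R^-1 <= t <= ratr s + 3 * d + j.+1%:R^-1 ->
        0 <= t -> ratr z + 3 * d + j.+1%:R^-1 <= (x k).1 t.
      rewrite -/d => t ht t0; have : p.2 + 10 * d < (x k).1 t; last by lra.
      by apply: dich; rewrite ltr_distl; lra.
    apply: filterS => u hu p'; rewrite !ler_distl => h1 h2.
    have -> : p'.2 <= left_limit (u k).1 p'.1.
      apply: left_limit_ge; near=> t.
      have ht : p'.1 - d < t < p'.1 by near: t; apply: nearl => //; lra.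
      have := hu t; clear -ht h1 h2 d0 p10 s1 s2; lra.
    apply/esym; apply: left_limit_ge; near=> t.
    have ht : p.1 - d < t < p.1 by near: t; apply: nearl => //; lra.
    by have := dich t; rewrite ltr_distl; clear -ht d0; lra.
  have := @near_path_lt x k j (s - 3 * dq) (s + 3 * dq) (z - 3 * dq).
  rewrite !rmorphD/= !rmorphN/= !rmorphM/= dqE ratr_nat => H.
  have /H : forall t : R, ratr s - 3 * d - j.+1%:R^-1 <= t <= ratr s + 3 * d + j.+1%:R^-1 ->
      0 <= t -> (x k).1 t <= ratr z - 3 * d - j.+1%:R^-1.
    rewrite -/d => t ht t0; have : (x k).1 t < p.2 - 10 * d; last by lra.
    by apply: dich; rewrite ltr_distl; lra.
  apply: filterS => u hu p'; rewrite !ler_distl => h1 h2.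
  have l1 : left_limit (u k).1 p'.1 <= ratr z - 3 * d.
    apply: left_limit_le; near=> t.
    have ht : p'.1 - d < t < p'.1 by near: t; apply: nearl => //; lra.
    have := hu t; clear -ht h1 h2 d0 p10 s1 s2; lra.
  have l2 : left_limit (x k).1 p.1 <= p.2 - 10 * d.
    apply: left_limit_le; near=> t.
    have ht : p.1 - d < t < p.1 by near: t; apply: nearl => //; lra.
    by have := dich t; rewrite ltr_distl; clear -ht d0; lra.
  by rewrite !leNgt; congr (~~ _); apply/idP/idP => _; clear -l1 l2 h2 d0; lra.
apply: filterS2 pyr pth => u pyr pth simu.
have [atq' _ muB'] := simple_atoms simu.
pose Q : set (R * R) := [set q | ratr s - 2 * d <= q.1 <= ratr s + 2 * d /\
  ratr z - 2 * d <= q.2 <= ratr z + 2 * d].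
have mQ : measurable Q by exact: measurable_itv2.
have : (0 < (u k).2 (Q `&` quadrant))%E.
  apply: lt_le_trans (@pyramid_integral_le R j (ratr (s - dq)) (ratr (s + dq))
    (ratr (z - dq)) (ratr (z + dq)) (u k).2 _ mQ _); last first.
    move=> q qq nQ; apply: pyramid_eq0; rewrite -/d !rmorphD/= !rmorphN/= dqE.
    by move=> [h1 h2]; apply: nQ; split; lra.
  by rewrite lte_fin (lt_trans _ pyr).
rewrite muB'; last by apply: measurableI => //; exact: measurable_quadrant.
move=> /counting_gt0[p' [atp' [[Q1 Q2] _]]].
exists p'; split=> //.
- by rewrite ler_distl; lra.
- by rewrite ler_distl; lra.
- by apply: pth; rewrite ler_distl; lra.
Unshelve. all: by end_near. Qed.

Lemma finite_atoms_rectangle (mu : lfmeasure R) (a b : R) :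
  simple_point_measure mu -> finite_set (atoms mu `&` rectangle a b).
Proof.
move=> /simple_atoms[_ fin _]; apply: sub_finite_set (fin (Num.max a b)).
by apply: setIS => p [/andP[p1 p2] /andP[q1 q2]]; split; rewrite ?p1 ?q1 le_max ?p2 ?q2 ?orbT.
Qed.

(** The pyramid is 1 on the rectangle enlarged by [3 * d], which contains the displaced atoms, and
    vanishes beyond [4 * d], where the isolation hypothesis prevents it from seeing other atoms of
    [x]. A count below [N + 1/2] is at most [N]. *)
Lemma near_rectangle x k j (T M : nat) :
  simple_point_measure (x k).2 ->
  (atoms (x k).2 `&` rectangle (T%:R + 4 / j.+1%:R) (M%:R + 4 / j.+1%:R)
    `<=` rectangle T%:R M%:R) ->
  (forall t, 0 <= t <= T%:R + 1 -> (x k).1 t <= M%:R - 1) ->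
  \forall u \near state_nbhs x, simple_point_measure ((u : state) k).2 ->
  (counting (atoms (u k).2 `&` rectangle (T%:R + 3 / j.+1%:R) (M%:R + 3 / j.+1%:R)) <=
   counting (atoms (x k).2 `&` rectangle T%:R M%:R) :> \bar R)%E /\
  forall t, 0 <= t <= T%:R -> (u k).1 t <= M%:R.
Proof.
set d : R := j.+1%:R^-1 => simx isol bnd.
have d0 : 0 < d by rewrite invr_gt0.
pose dq : rat := j.+1%:R^-1.
have dqE : ratr dq = d by rewrite /dq fmorphV/= ratr_nat.
have pth : \forall u \near state_nbhs x, forall t, 0 <= t <= T%:R -> ((u : state) k).1 t <= M%:R.
  (* Sharpness 0 means a margin 1, which is the origin of [T%:R + 1] and [M%:R - 1]. *)
  have := @near_path_lt x k 0 0 T%:R M%:R.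
  rewrite !ratr_nat rmorph0 invr1 => H.
  have /H : forall t : R, 0 - 1 <= t <= T%:R + 1 -> 0 <= t -> (x k).1 t <= M%:R - 1.
    by move=> t /andP[_ tT] t0; apply: bnd; rewrite t0.
  by apply: filterS => u hu t /andP[t0 tT]; apply/ltW/hu => //; rewrite t0.
pose N := #|` fset_set (atoms (x k).2 `&` rectangle T%:R M%:R)|.
have cN : counting (atoms (x k).2 `&` rectangle T%:R M%:R) = N%:R%:E :> \bar R.
  by rewrite counting_finite//; exact: finite_atoms_rectangle.
have pyr : \forall u \near state_nbhs x,
   pyramid_integral j (ratr 0) (ratr (T%:R + 3 * dq)) (ratr 0) (ratr (M%:R + 3 * dq)) ((u : state) k).2
   < N%:R + 2^-1.
  apply: near_pyramid_lt; apply: (@le_lt_trans _ _ N%:R); last by lra.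
  rewrite -lee_fin -cN; have [atq _ muB] := simple_atoms simx.
  have mQ := @measurable_itv2 0 (T%:R + 4 * d) 0 (M%:R + 4 * d).
  apply: (@le_trans _ _ ((x k).2 (rectangle (T%:R + 4 * d) (M%:R + 4 * d) `&` quadrant))).
    apply: pyramid_integral_le => // q [q1 q2] nQ; apply: pyramid_eq0.
    rewrite -/d !rmorphD/= !rmorphM/= dqE !ratr_nat => -[h1 h2].
    by apply: nQ; split; lra.
  rewrite muB; last by apply: measurableI => //; exact: measurable_quadrant.
  apply: counting_subset; first exact: finite_atoms_rectangle.
  by move=> q [aq [rq _]]; split=> //; apply: isol.
apply: filterS2 pyr pth => u pyr pth simu; split=> //.
have [atq _ muB] := simple_atoms simu.
have mQ := @measurable_itv2 0 (T%:R + 3 * d) 0 (M%:R + 3 * d).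
have : (counting (atoms (u k).2 `&` rectangle (T%:R + 3 * d) (M%:R + 3 * d)) <
    (N%:R + 2^-1)%:E :> \bar R)%E.
  rewrite -muB//; move: pyr; rewrite -lte_fin; apply: le_lt_trans.
  apply: pyramid_integral_ge => // [q [/andP[q1 _] /andP[q2 _]]//|q [q1 q2]].
  by rewrite /pyramid !trapezoid_eq1 ?mulr1// !rmorphD/= ?rmorph0 !rmorphM/= dqE !ratr_nat.
rewrite cN counting_finite; last exact: finite_atoms_rectangle.
rewrite lte_fin lee_fin => h; rewrite ler_nat -ltnS -(ltr_nat R) -[N.+1%:R]natr1.
by apply: lt_trans h _; rewrite ltrD2l invf_lt1// ltr1n.
Qed.

End stable_constraints.

Lemma near_seq (I : Type) (F : set_system I) (A : eqType) (l : seq A) (Q : A -> set I) :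
  Filter F -> (forall a, a \in l -> \forall i \near F, Q a i) ->
  \forall i \near F, forall a, a \in l -> Q a i.
Proof.
move=> FF; elim: l => [|a l IH] h; first by apply: nearW.
have h1 := h a (mem_head _ _).
have h2 : \forall i \near F, forall b, b \in l -> Q b i.
  by apply: IH => b bl; apply: h; rewrite inE bl orbT.
by apply: filterS2 h1 h2 => i ha hl b; rewrite inE => /predU1P[->//|]; exact: hl.
Qed.

Lemma near_infty_ratio_lt (R : realType) (c m : R) : 0 < c -> 0 < m ->
  \forall j \near \oo, m / j.+1%:R < c.
Proof.
move=> c0 m0; have cm : 0 < c / m by rewrite divr_gt0.
by near=> j; rewrite mulrC -ltr_pdivlMr//; near: j; exact: near_infty_natSinv_lt (PosNum cm).
Unshelve. all: by end_near. Qed.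

(** * Matching the atoms of neighbouring states *)

Section stable_jumps.
Context {R : realType}.
Implicit Types (x u : @state R).

(** The same margin [d] serves in time and in level, a form that constraints can test. If the
    dichotomy fails for every [d], then [p.2] lies between the left limit and the value of the path
    at [p.1]. *)
Definition generic_state x : Prop :=
  [/\ forall k, simple_point_measure (x k).2,
      forall k p, atoms (x k).2 p -> 0 < p.1 /\ exists2 d, 0 < d &
        (forall t, `|t - p.1| < d -> p.2 + d < (x k).1 t) \/
        (forall t, `|t - p.1| < d -> (x k).1 t < p.2 - d) &
      forall k l p q, atoms (x k).2 p -> atoms (x l).2 q -> p.1 = q.1 ->
        k = l /\ p = q].

Lemma near_same_jumps x (n : nat) (T e : R) : generic_state x -> 0 < e ->
  \forall u \near state_nbhs x, (forall k, simple_point_measure ((u : @state R) k).2) ->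
  exists2 lam, time_change lam & forall t, 0 <= t <= T ->
    `|lam t - t| < e /\ forall k, (k < n)%N ->
      point_process (u k).1 (u k).2 t = point_process (x k).1 (x k).2 (lam t).
Proof.
move=> [simx gen distinct] e0.
(* The horizon exceeds [T + e] because [lam t] may exceed [t] by almost [e]. *)
pose b := Num.bound (`|T| + e); pose Tn : R := b%:R.
have TTn : T + e < Tn.
  rewrite (@le_lt_trans _ _ (`|T| + e))// ?lerD2r ?ler_norm//.
  by rewrite archi_boundP// addr_ge0// ltW.
have /choice[M hM] : forall k, exists M : nat, forall t, 0 <= t <= Tn + 1 ->
    (x k).1 t <= M%:R - 1.
  move=> k; have [B hB] := cadlag_bounded (x k).1 (Tn + 1).
  exists (Num.bound `|B + 1|) => t /hB ht; rewrite lerBrDr.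
  have := archi_boundP (normr_ge0 (B + 1)); have := ler_norm (B + 1).
  have := ler_norm ((x k).1 t); lra.
pose I k := atoms (x k).2 `&` rectangle Tn (M k)%:R.
have finI k : finite_set (I k) by exact: finite_atoms_rectangle.
pose L : seq (nat * (R * R)) :=
  undup (flatten [seq [seq (k, p) | p <- enum_fset (fset_set (I k))] | k <- iota 0 n]).
have memL k p : ((k, p) \in L) = (k < n)%N && (p \in I k).
  rewrite mem_undup; apply/flatten_mapP/andP.
    move=> [l]; rewrite mem_iota add0n => /andP[_ ln] /mapP[q qI [-> ->]].
    by split=> //; move: qI; rewrite in_fset_set.
  move=> [kn pI]; exists k; first by rewrite mem_iota.
  by apply/mapP; exists p => //; rewrite in_fset_set.
have LI a : a \in L -> (a.1 < n)%N /\ I a.1 a.2.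
  by case: a => k p; rewrite memL => /andP[kn]; rewrite inE.
have c1 : \forall j \near \oo, forall a, a \in L -> 10 / j.+1%:R < a.2.1 /\
   ((forall t, `|t - a.2.1| < 10 / j.+1%:R -> a.2.2 + 10 / j.+1%:R < (x a.1).1 t) \/
    (forall t, `|t - a.2.1| < 10 / j.+1%:R -> (x a.1).1 t < a.2.2 - 10 / j.+1%:R)).
  apply: near_seq => -[k p] /LI[/= kn [atp _]].
  have [p0 [d d0 hd]] := gen _ _ atp.
  near=> j.
  have jp : 10 / j.+1%:R < p.1 by near: j; exact: near_infty_ratio_lt.
  have jd : 10 / j.+1%:R < d by near: j; exact: near_infty_ratio_lt.
  split=> //; move: jd; move: (10 / j.+1%:R) => r rd.
  by case: hd => hd; [left|right] => t tr; have := hd t (lt_trans tr rd); lra.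
have c2 : \forall j \near \oo, forall a, a \in L -> forall a', a' \in L ->
    a != a' -> 10 / j.+1%:R < `|a.2.1 - a'.2.1|.
  apply: near_seq => a aL; apply: near_seq => a' a'L.
  have [aa'|aa'] := eqVneq a a'; first exact: nearW.
  near=> j => _; near: j; apply: near_infty_ratio_lt => //.
  rewrite normr_gt0 subr_eq0; apply/eqP => h.
  have [[_ [ata _]] [_ [ata' _]]] := (LI _ aL, LI _ a'L).
  have [e1 e2] := distinct _ _ _ _ ata ata' h.
  by move: aa'; rewrite [a]surjective_pairing [a']surjective_pairing e1 e2 eqxx.
(* Only finitely many atoms lie in the rectangle enlarged by 4; each one outside of the original
   rectangle is left out as soon as [4 / j.+1%:R] is small. *)
have c3 : \forall j \near \oo, forall k, k \in iota 0 n ->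
    atoms (x k).2 `&` rectangle (Tn + 4 / j.+1%:R) ((M k)%:R + 4 / j.+1%:R)
    `<=` rectangle Tn (M k)%:R.
  apply: near_seq => k _.
  have fin4 := @finite_atoms_rectangle R _ (Tn + 4) ((M k)%:R + 4) (simx k).
  have : \forall j \near \oo, forall p,
      p \in enum_fset (fset_set (atoms (x k).2 `&` rectangle (Tn + 4) ((M k)%:R + 4))) ->
      rectangle (Tn + 4 / j.+1%:R) ((M k)%:R + 4 / j.+1%:R) p -> rectangle Tn (M k)%:R p.
    apply: near_seq => p _.
    have [pT|Tp] := leP p.1 Tn; have [pM|Mp] := leP p.2 (M k)%:R.
    - by apply: nearW => j [/andP[p1 _] /andP[p2 _]]; split; rewrite ?p1 ?p2.
    - have h : 0 < p.2 - (M k)%:R by lra.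
      near=> j => -[_ /andP[_ q]]; exfalso.
      have q' : 4 / j.+1%:R < p.2 - (M k)%:R by near: j; exact: near_infty_ratio_lt.
      by move: q'; rewrite ltrBrDl => /lt_le_trans/(_ q); rewrite ltxx.
    - have h : 0 < p.1 - Tn by lra.
      near=> j => -[/andP[_ q] _]; exfalso.
      have q' : 4 / j.+1%:R < p.1 - Tn by near: j; exact: near_infty_ratio_lt.
      by move: q'; rewrite ltrBrDl => /lt_le_trans/(_ q); rewrite ltxx.
    - have h : 0 < p.1 - Tn by lra.
      near=> j => -[/andP[_ q] _]; exfalso.
      have q' : 4 / j.+1%:R < p.1 - Tn by near: j; exact: near_infty_ratio_lt.
      by move: q'; rewrite ltrBrDl => /lt_le_trans/(_ q); rewrite ltxx.
  apply: filterS => j hj p [atp rp]; apply: hj => //.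
  rewrite in_fset_set// inE; split=> //.
  have j1 : 4 / j.+1%:R <= 4 :> R by rewrite ler_pdivrMr// ler_peMr// ler1n.
  by case: rp => r1 r2; split; move: j1 r1 r2; move: (4 / j.+1%:R) => r; lra.
near (\oo : set_system nat) => j.
have j1 : forall a, a \in L -> 10 / j.+1%:R < a.2.1 /\
   ((forall t, `|t - a.2.1| < 10 / j.+1%:R -> a.2.2 + 10 / j.+1%:R < (x a.1).1 t) \/
    (forall t, `|t - a.2.1| < 10 / j.+1%:R -> (x a.1).1 t < a.2.2 - 10 / j.+1%:R)).
  by near: j; exact: c1.
have j2 : forall a, a \in L -> forall a', a' \in L ->
    a != a' -> 10 / j.+1%:R < `|a.2.1 - a'.2.1| by near: j; exact: c2.
have j3 : forall k, k \in iota 0 n ->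
    atoms (x k).2 `&` rectangle (Tn + 4 / j.+1%:R) ((M k)%:R + 4 / j.+1%:R)
    `<=` rectangle Tn (M k)%:R by near: j; exact: c3.
have j4 : 10 / j.+1%:R < e by near: j; exact: near_infty_ratio_lt.
have n1 : \forall u \near state_nbhs x, forall a, a \in L ->
    simple_point_measure ((u : @state R) a.1).2 ->
    exists p', [/\ atoms (u a.1).2 p', `|p'.1 - a.2.1| <= 3 / j.+1%:R,
    `|p'.2 - a.2.2| <= 3 / j.+1%:R &
    (p'.2 <= left_limit (u a.1).1 p'.1) = (a.2.2 <= left_limit (x a.1).1 a.2.1)].
  apply: near_seq => a aL; have [ja1 ja2] := j1 _ aL; have [_ [ata _]] := LI _ aL.
  exact: near_atom.
have n2 : \forall u \near state_nbhs x, forall k, k \in iota 0 n ->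
    simple_point_measure ((u : @state R) k).2 ->
    (counting (atoms (u k).2 `&` rectangle (Tn + 3 / j.+1%:R) ((M k)%:R + 3 / j.+1%:R)) <=
     counting (I k) :> \bar R)%E /\
    forall t, 0 <= t <= Tn -> (u k).1 t <= (M k)%:R.
  by apply: near_seq => k kn; apply: (@near_rectangle _ x k j b (M k)); [exact: simx|exact: j3|exact: hM].
apply: filterS2 n1 n2 => u n1 n2 simu.
have /choice[phi hphi] : forall a, exists p', a \in L ->
    [/\ atoms (u a.1).2 p', `|p'.1 - a.2.1| <= 3 / j.+1%:R,
    `|p'.2 - a.2.2| <= 3 / j.+1%:R &
    (p'.2 <= left_limit (u a.1).1 p'.1) = (a.2.2 <= left_limit (x a.1).1 a.2.1)].
  move=> a; have [aL|aL] := boolP (a \in L); last by exists 0.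
  by have [p' hp'] := n1 _ aL (simu _); exists p'.
(* With 5 as numerator, the displacement 3 of the atoms is below [d] and their separation 10 is the
   [2 * d] required by the interpolation. *)
have [d [d0 d10 d3]] : exists d : R, [/\ 0 < d, 10 / j.+1%:R = 2 * d & 3 / j.+1%:R < d].
  exists (5 / j.+1%:R); split; [by rewrite divr_gt0|by rewrite mulrA -natrM|].
  by rewrite ltr_pM2r ?invr_gt0// ltr_nat.
have j4' : 2 * d < e by rewrite -d10.
have phi1 a : a \in L -> `|(phi a).1 - a.2.1| < d.
  by move=> /hphi[_ h _ _]; exact: le_lt_trans h d3.
have [||lam [lamb lamd lamid lamphi]] :=
  @increasing_interpolation R d [seq ((phi a).1, a.2.1) | a <- L] d0.
- by move=> _ /mapP[a aL ->] /=; exact: phi1.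
- rewrite pairwise_map; have := undup_uniq (flatten [seq [seq (k, p) | p <- enum_fset (fset_set (I k))] | k <- iota 0 n]).
  rewrite -/L uniq_pairwise; apply: (sub_in_pairwise (P := mem L)); last exact/allP.
  move=> a a' aL a'L /= aa'; by rewrite -d10; apply: ltW; apply: j2.
have lamE a : a \in L -> lam (phi a).1 = a.2.1.
  by move=> aL; apply: (lamphi ((phi a).1, a.2.1)); apply/mapP; exists a.
have lamle := increasing_bijection_leE lamb.
(* The atoms of [L] have times larger than [2 * d], so 0 is outside of all windows. *)
have lam0 : lam 0 = 0.
  apply: lamid => _ /mapP[a aL ->] /=; rewrite sub0r normrN.
  by have [+ _] := j1 _ aL; rewrite d10 => ja; have := ler_norm a.2.1; lra.
exists lam; first exact: increasing_bijection_time_change.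
move=> t /andP[t0 tT].
have lte : `|lam t - t| < e by apply: lt_trans (lamd t) _; clear -j4' d0; lra.
split=> // k kn; have lt0 : 0 <= lam t by rewrite -lam0 lamle.
have ltT : lam t <= Tn by move: lte; rewrite ltr_distl; clear -tT TTn; lra.
have [atq _ muB] := simple_atoms (simx k); have [atq' _ muB'] := simple_atoms (simu k).
rewrite !point_processE !max_r//.
have mS s y : measurable (strip s `&` subgraph y : set (R * R)).
  by apply: measurableI; [exact: measurable_strip|exact: measurable_subgraph].
rewrite (muB _ (mS _ _)) (muB' _ (mS _ _)); congr fine.
have kio : k \in iota 0 n by rewrite mem_iota.
have [n2c n2b] := n2 _ kio (simu k).
have IL p : I k p -> (k, p) \in L by move=> Ip; rewrite memL kn inE.
have phi_inj : {in I k &, injective (fun p => phi (k, p))}.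
  move=> p q; rewrite !inE => Ip Iq pq; apply/eqP; apply: contrapT => /negP npq.
  have [h1 h2] := (phi1 _ (IL _ Ip), phi1 _ (IL _ Iq)).
  have := j2 _ (IL _ Ip) _ (IL _ Iq); rewrite xpair_eqE eqxx /= d10 => /(_ npq).
  move: h1; rewrite /= pq => h1; have := ler_distD (phi (k, q)).1 p.1 q.1.
  by rewrite (distrC p.1 (phi (k, q)).1); move: h1 h2 => /=; clear -d0; lra.
(* The displaced atoms already exhaust the mass allowed by [n2c]: the perturbed measure has no
   further atom there. *)
have AE : atoms (u k).2 `&` rectangle (Tn + 3 / j.+1%:R) ((M k)%:R + 3 / j.+1%:R) =
    (fun p => phi (k, p)) @` I k.
  apply: image_counting_le => //; first exact: finite_atoms_rectangle.
  move=> _ [p Ip <-]; have [h1 h2 h3 _] := hphi _ (IL _ Ip); split=> //.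
  have [q1 q2] := atq' _ h1; case: Ip => _ [/andP[_ p1] /andP[_ p2]].
  move: h2 h3; rewrite !ler_distl /=; move: (3 / j.+1%:R) => r h2 h3; split.
    by rewrite q1; clear -p1 h2; lra.
  by rewrite q2; clear -p2 h3; lra.
have subI : atoms (x k).2 `&` (strip (lam t) `&` subgraph (x k).1) `<=` I k.
  move=> p [atp [[/andP[s1 s2] s3] s4]]; split=> //; split.
    by rewrite s1 (le_trans s2).
  rewrite s3 (le_trans s4)//; apply: (@left_limit_bounded _ _ Tn).
    by move=> r /andP[r0 rT]; have := hM k r; clear -r0 rT; lra.
  by rewrite s1 (le_trans s2).
apply/esym; apply: (counting_image (f := fun p => phi (k, p))).
- exact: sub_finite_set (finI k).
- move=> p q; rewrite !inE => /subI hp /subI hq; apply: phi_inj; exact/mem_set.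
have same p : I k p -> (strip t `&` subgraph (u k).1) (phi (k, p)) <->
    (strip (lam t) `&` subgraph (x k).1) p.
  move=> Ip; have aL := IL _ Ip; have [h1 _ _ h4] := hphi _ aL.
  have [[p1 p2] [q1 q2]] := (atq _ Ip.1, atq' _ h1).
  have tl : ((phi (k, p)).1 <= t) = (p.1 <= lam t) by rewrite -lamle (lamE _ aL).
  by rewrite /strip /subgraph /= p1 p2 q1 q2 -tl h4.
apply/seteqP; split=> [_ [p [atp Sp] <-]|p' [atp' Sp']].
  have Ip := subI _ (conj atp Sp); have [h1 _ _ _] := hphi _ (IL _ Ip).
  by split=> //; apply/same.
have : (atoms (u k).2 `&` rectangle (Tn + 3 / j.+1%:R) ((M k)%:R + 3 / j.+1%:R)) p'.
  have : 0 < 3 / j.+1%:R :> R by rewrite divr_gt0.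
  move: (3 / j.+1%:R) => r r0.
  case: Sp' => [[/andP[s1 s2] s3] s4]; split=> //; split.
    by rewrite s1; clear -s2 tT TTn e0 r0; lra.
  rewrite s3 (@le_trans _ _ (M k)%:R)//; last by rewrite lerDl ltW.
  rewrite (le_trans s4)//; apply: (@left_limit_bounded _ _ Tn) => //.
  by rewrite s1; clear -s2 tT TTn e0; lra.
rewrite AE => -[p Ip pp']; exists p => //; split; first exact: Ip.1.
by apply/(same _ Ip); rewrite pp'.
Unshelve. all: by end_near. Qed.

End stable_jumps.

(** * Almost sure genericity *)

Section negligible_sets.
Context {R : realType} d (T : measurableType d) (P : probability T R).

Lemma union_bound (I : finType) (E : I -> set T) :
  (forall i, measurable (E i)) ->
  measurable [set w | exists i, E i w] /\
  (P [set w | exists i, E i w] <= \sum_i P (E i))%E.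
Proof.
move=> mE.
have -> : [set w | exists i, E i w] = \big[setU/set0]_(i <- index_enum I) E i.
  apply/seteqP; split=> w /=; rewrite -bigcup_seq.
    by move=> [i Ei]; exists i => //=; rewrite mem_index_enum.
  by move=> [i _ Ei]; exists i.
elim: (index_enum I) => [|i l [IHm IH]]; first by rewrite !big_nil measure0.
rewrite !big_cons; split; first exact: measurableU.
by apply: le_trans (measureU2 _ _ _) _ => //; rewrite leeD2l.
Qed.

(** The exceptional sets are not shown to be measurable; small measurable covers are enough. *)
Lemma negligible_small (B : set T) :
  (forall e : R, 0 < e -> exists E, [/\ measurable E, B `<=` E & (P E <= e%:E)%E]) ->
  P.-negligible B.
Proof.
move=> h; have /choice[E hE] : forall n : nat, exists E,
    [/\ measurable E, B `<=` E & (P E <= (n.+1%:R^-1)%:E)%E].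
  by move=> n; apply: h; rewrite invr_gt0.
have mE : measurable (\bigcap_n E n) by apply: bigcapT_measurable => n; have [] := hE n.
exists (\bigcap_n E n); split=> //; last by move=> w Bw n _; have [_ + _] := hE n; apply.
apply/eqP; rewrite -measure_le0; apply/lee_addgt0Pr => e e0; rewrite add0e.
have [n ne] : exists n : nat, (n.+1%:R : R)^-1 < e.
  near (\oo : set_system nat) => n; exists n; near: n.
  exact: near_infty_natSinv_lt (PosNum e0).
have [mEn _ Pn] := hE n; apply: (@le_trans _ _ (P (E n))).
  by apply: le_measure; rewrite ?inE// => w; apply.
by rewrite (le_trans Pn)// lee_fin ltW.
Unshelve. all: by end_near. Qed.

Lemma negligible_countable (C : countType) (B : C -> set T) :
  (forall c, P.-negligible (B c)) -> P.-negligible [set w | exists c, B c w].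
Proof.
move=> nB; pose F n := if (choice.unpickle n : option C) is Some c then B c else set0.
apply: (@negligibleS _ _ _ _ (\bigcup_n F n)).
  by move=> w [c Bc]; exists (choice.pickle c) => //; rewrite /F choice.pickleK.
apply: negligible_bigcup => n; rewrite /F; case: (choice.unpickle n : option C) => [c|]; first exact: nB.
exact: negligible_set0.
Qed.

End negligible_sets.

(** * Probability that a Poisson measure charges a box *)

Section hitting.
Context {R : realType} d (T : measurableType d) (P : probability T R).
Implicit Types (pi : {RV P >-> lfmeasure R}) (a b c e s : R).

Definition half_open_box a b c e : set (R * R) := `[a, b[%classic `*` `[c, e[%classic.

Lemma measurable_half_open_box a b c e : measurable (half_open_box a b c e).
Proof. exact: measurableX. Qed.

Lemma half_open_box_quadrant a b c e : 0 <= a -> 0 <= c ->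
  half_open_box a b c e `<=` quadrant.
Proof.
move=> a0 c0 p [] /=; rewrite !in_itv/= => /andP[p1 _] /andP[p2 _].
by split; [exact: le_trans p1|exact: le_trans p2].
Qed.

Lemma lfmeasure_eval_measurable (B : set (R * R)) : measurable B ->
  measurable_fun setT (fun mu : lfmeasure R => mu B).
Proof.
move=> mB _ U mU; rewrite setTI; apply: sub_sigma_algebra.
by exists B, U; split.
Qed.

(** A measurable substitute for having an atom in [B], with the threshold suited to Markov's
    inequality. *)
Definition charges (B : set (R * R)) : set (lfmeasure R) := [set mu | (1 <= mu B)%E].

Lemma measurable_charges B : measurable B -> measurable (charges B).
Proof.
move=> mB; have := lfmeasure_eval_measurable mB measurableT (emeasurable_itv `[1%E, +oo[).
by rewrite setTI; congr measurable; apply/seteqP; split=> mu; rewrite /= in_itv/= andbT.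
Qed.

Lemma RV_eval_measurable pi (B : set (R * R)) : measurable B ->
  measurable_fun setT (fun w => pi w B).
Proof. by move=> mB; apply: (measurableT_comp (lfmeasure_eval_measurable mB)). Qed.

Lemma measurable_RV_charges pi B : measurable B -> measurable (pi @^-1` charges B).
Proof.
by move=> mB; rewrite -[X in measurable X]setTI; apply: measurable_funPT => //;
  exact: measurable_charges.
Qed.

Lemma charges_atom (mu : lfmeasure R) p B : simple_point_measure mu ->
  atoms mu p -> measurable B -> B p -> charges B mu.
Proof.
move=> simmu atp mB Bp; have [_ _ muB] := simple_atoms simmu.
rewrite /charges /=; apply: (@le_trans _ _ (mu [set p])).
  rewrite (muB _ (measurable_point p)) (_ : atoms _ `&` _ = [set p]); last first.
    by apply/seteqP; split=> [q [_ ->]|q ->].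
  by rewrite counting_finite// fset_set1 cardfs1.
by apply: le_measure; rewrite ?inE//; [exact: measurable_point|move=> _ ->].
Qed.

(* Markov's inequality. *)
Lemma charges_prob pi a b c e : has_lebesgue_intensity pi ->
  0 <= a -> a <= b -> 0 <= c -> c <= e ->
  (P (pi @^-1` charges (half_open_box a b c e)) <= ((b - a) * (e - c))%:E)%E.
Proof.
move=> leb a0 ab c0 ce; have mB := measurable_half_open_box a b c e.
have := leb _ mB (half_open_box_quadrant a0 c0).
rewrite /half_open_box product_measure1E//.
have len (u v : R) : u <= v -> lebesgue_measure (`[u, v[%classic : set R) = (v - u)%:E.
  move=> uv; rewrite lebesgue_measure_itv /= lte_fin EFinB; case: ltP => // vu.
  by rewrite -EFinB (_ : v - u = 0)//; apply/eqP; rewrite subr_eq0 eq_le vu uv.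
rewrite [X in _ = X -> _](_ : _ = ((b - a) * (e - c))%:E) => [<-|]; last first.
  by rewrite EFinM; congr (_ * _)%E; exact: len.
have := le_integral_abse P measurableT (RV_eval_measurable pi mB) ltr01.
rewrite mul1e setTI.
rewrite (_ : [set w | _] = pi @^-1` charges (half_open_box a b c e)); last first.
  by apply/seteqP; split=> w; rewrite /charges /= gee0_abs.
move=> h; apply: (le_trans h); rewrite /intensity le_eqVlt; apply/orP; left; apply/eqP.
by apply: eq_integral => w _; rewrite gee0_abs.
Qed.

Lemma grid_cover (M m : nat) s : 0 <= s -> s < M%:R ->
  exists i : 'I_(M * m.+1), i%:R / m.+1%:R <= s < i.+1%:R / m.+1%:R.
Proof.
move=> s0 sM; have i0 : 0 <= m.+1%:R * s by rewrite mulr_ge0.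
have lt_i : (Num.truncn (m.+1%:R * s) < M * m.+1)%N.
  by rewrite truncn_lt_nat// natrM mulrC ltr_pM2r.
exists (Ordinal lt_i); rewrite /= ler_pdivrMr// ltr_pdivlMr// mulrC.
by rewrite truncn_le truncnS_gt mulr_ge0.
Qed.

(** There are [M * m.+1] columns, each doubly charged with probability at most [(M / m.+1) ^ 2]: the
    sum is [M ^ 3 / m.+1]. Separate level ranges and a product formula as hypothesis cover both two
    independent measures and two disjoint parts of one measure. *)
Lemma same_time_negligible pi1 pi2 (M : nat) c1 e1 c2 e2 :
  has_lebesgue_intensity pi1 -> has_lebesgue_intensity pi2 ->
  0 <= c1 -> c1 <= e1 -> e1 <= M%:R -> 0 <= c2 -> c2 <= e2 -> e2 <= M%:R ->
  (forall a b, 0 <= a ->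
    P (pi1 @^-1` charges (half_open_box a b c1 e1) `&`
       pi2 @^-1` charges (half_open_box a b c2 e2)) =
    (P (pi1 @^-1` charges (half_open_box a b c1 e1)) *
     P (pi2 @^-1` charges (half_open_box a b c2 e2)))%E) ->
  P.-negligible [set w | [/\ simple_point_measure (pi1 w), simple_point_measure (pi2 w) &
    exists p q, [/\ atoms (pi1 w) p, atoms (pi2 w) q, p.1 = q.1, p.1 < M%:R &
      c1 <= p.2 < e1 /\ c2 <= q.2 < e2]]].
Proof.
move=> leb1 leb2 c10 ce1 e1M c20 ce2 e2M indep.
apply: negligible_small => e e0.
have [m me] : exists m : nat, M%:R ^+ 3 / m.+1%:R < e.
  have [M0|M0] := eqVneq (M%:R ^+ 3) (0 : R); first by exists 0%N; rewrite M0 mul0r.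
  have M30 : 0 < M%:R ^+ 3 :> R by rewrite lt_neqAle eq_sym M0 exprn_ge0.
  near (\oo : set_system nat) => m; exists m; near: m; exact: near_infty_ratio_lt.
pose E (i : 'I_(M * m.+1)) :=
  pi1 @^-1` charges (half_open_box (i%:R / m.+1%:R) (i.+1%:R / m.+1%:R) c1 e1) `&`
  pi2 @^-1` charges (half_open_box (i%:R / m.+1%:R) (i.+1%:R / m.+1%:R) c2 e2).
have [|mU PU] := @union_bound R _ T P _ E.
  by move=> i; apply: measurableI; apply: measurable_RV_charges;
    exact: measurable_half_open_box.
exists [set w | exists i, E i w]; split=> //.
  move=> w [sim1 sim2 [p [q [atp atq pq pM [hp hq]]]]].
  have [atq1 _ _] := simple_atoms sim1.
  have [p0 _] := atq1 _ atp.
  have [i hi] := grid_cover m p0 pM; exists i; split.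
    apply: (charges_atom sim1 atp); first exact: measurable_half_open_box.
    by split; rewrite /= in_itv.
  apply: (charges_atom sim2 atq); first exact: measurable_half_open_box.
  by split; rewrite /= in_itv/= -?pq.
apply: (le_trans PU).
apply: (@le_trans _ _ (\sum_(i < M * m.+1) ((M%:R / m.+1%:R) ^+ 2)%:E)%E).
  apply: lee_sum => i _.
  have i0 : 0 <= i%:R / m.+1%:R :> R by rewrite divr_ge0.
  have ii : i%:R / m.+1%:R <= i.+1%:R / m.+1%:R :> R by rewrite ler_pM2r ?invr_gt0// ler_nat.
  have iiE : i.+1%:R / m.+1%:R - i%:R / m.+1%:R = m.+1%:R^-1 :> R.
    by rewrite -mulrBl -natrB// subSnn mul1r.
  rewrite /E indep// expr2 EFinM; apply: lee_pmul => //.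
    apply: (le_trans (charges_prob leb1 i0 ii c10 ce1)); rewrite lee_fin iiE mulrC.
    by rewrite ler_pM2r ?invr_gt0//; lra.
  apply: (le_trans (charges_prob leb2 i0 ii c20 ce2)); rewrite lee_fin iiE mulrC.
  by rewrite ler_pM2r ?invr_gt0//; lra.
rewrite sumEFin lee_fin sumr_const card_ord -[_ *+ (M * m.+1)]mulr_natl natrM (le_trans _ (ltW me))//.
rewrite le_eqVlt; apply/orP; left; apply/eqP; field.
by rewrite nat1r pnatr_eq0.
Unshelve. all: by end_near. Qed.

End hitting.

(** * Cells met by the completed graph of a path *)

Section graph_cells.
Context {R : realType}.
Implicit Types (y : cadlag R) (a b c e : R).

(** With its vertical segments the graph is connected, so it meets the band between [c] and [e] once
    it has a point below [e] and a point above [c]. *)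
Definition crossing a b c e : set (cadlag R) :=
  [set y | (exists s : rat, a < ratr s < b /\ y (ratr s) < e) /\
           (exists t : rat, a < ratr t < b /\ c < y (ratr t))].

Lemma measurable_crossing a b c e : measurable (crossing a b c e).
Proof.
have m1 (s : rat) (B : set R) : measurable B ->
    measurable (if a < ratr s < b then (fun y : cadlag R => y (ratr s)) @^-1` B else set0).
  move=> mB; case: ifP => // _; rewrite -[X in measurable X]setTI.
  exact: cadlag_eval_measurable.
rewrite (_ : crossing a b c e =
  (\bigcup_(s : rat) if a < ratr s < b then
     (fun y : cadlag R => y (ratr s)) @^-1` `]-oo, e[%classic else set0) `&`
  (\bigcup_(s : rat) if a < ratr s < b then
     (fun y : cadlag R => y (ratr s)) @^-1` `]c, +oo[%classic else set0)).
  by apply: measurableI; apply: bigcupT_measurable_rat => s; exact: m1.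
apply/seteqP; split=> y.
  move=> [[s [hs ys]] [t [ht yt]]]; split.
    by exists s => //; rewrite hs /= in_itv/=.
  by exists t => //; rewrite ht /= in_itv/= andbT.
move=> [[s _ hs] [t _ ht]]; split.
  by exists s; move: hs; case: ifP => //= _; rewrite in_itv/=.
by exists t; move: ht; case: ifP => //= _; rewrite in_itv/= andbT.
Qed.

Lemma count_between (K : nat) (a b : R) : a <= b ->
  \sum_(j < K) (a < j%:R < b)%R%:R <= b - a + 1.
Proof.
(* The induction on [K] needs the sharper count of the integers up to [K - 1]. *)
move=> ab; suff : \sum_(j < K) (a < j%:R < b)%R%:R <=
    Num.max 0 (Num.min (K%:R - 1) b - a + 1).
  move=> h; apply: (le_trans h); rewrite ge_max; apply/andP; split; first by lra.
  by rewrite lerD2r lerD2r ge_min lexx orbT.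
elim: K => [|K IH]; first by rewrite big_ord0 le_max lexx.
rewrite big_ord_recr /=; apply: (le_trans (lerD IH (lexx _))).
rewrite -natr1 addrK.
have [/andP[aK Kb]|] := boolP (a < K%:R < b).
  rewrite (min_l (ltW Kb)) (_ : Num.min (K%:R - 1) b = K%:R - 1); last by rewrite min_l//; lra.
  move: aK; move: (K%:R : R) => k ak; rewrite /= [X in _ <= X]max_r; last by lra.
  by rewrite -lerBrDr ge_max; lra.
move=> _; rewrite addr0 ge_max !le_max lexx /=; apply/orP; right.
rewrite lerD2r lerD2r le_min !ge_min lexx orbT andbT; apply/orP; left; lra.
Qed.

(* Enlarging the cell [i / q, (i + 1) / q[ x [j / q, (j + 1) / q[ by 1 / q on each
   side turns the condition that it meets the completed graph of y into an open
   one, which can be tested at rational times. *)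
Definition cell_crossing (q i j : R) : set (cadlag R) :=
  crossing ((i - 1) / q) ((i + 2) / q) ((j - 1) / q) ((j + 2) / q).

(** The weight of a cell is its area, which also bounds the probability that it is charged: the
    expectation of this sum will bound the bad event. *)
Definition crossing_area (M m : nat) y : R :=
  \sum_(ij : 'I_(M * m.+1) * 'I_(M * m.+1))
    m.+1%:R ^- 2 * \1_(cell_crossing m.+1%:R ij.1%:R ij.2%:R) y.

(** The values stay within [e] of [v], which confines [j] to an interval of length
    [2 * q * e + 3]. *)
Lemma column_crossings y (K : nat) (q i e : R) : 0 < q -> 0 < e ->
  (forall s t, (i - 1) / q < s < (i + 2) / q -> (i - 1) / q < t < (i + 2) / q ->
    `|y s - y t| <= e) ->
  \sum_(j < K) \1_(cell_crossing q i j%:R) y <= 2 * q * e + 4.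
Proof.
move=> q0 e0 osc; pose v := y (i / q).
have h : \sum_(j < K) \1_(cell_crossing q i j%:R) y <=
    \sum_(j < K) (q * (v - e) - 2 < j%:R < q * (v + e) + 1)%R%:R :> R.
  apply: ler_sum => j _; rewrite indicE; have [|//] := boolP (y \in _).
  rewrite inE => -[[s [hs ys]] [t [ht yt]]].
  have iq : (i - 1) / q < i / q < (i + 2) / q by rewrite !ltr_pM2r ?invr_gt0//; lra.
  have := osc _ _ hs iq; have := osc _ _ ht iq; rewrite -/v !ler_distl => h1 h2.
  rewrite (_ : _ && _ = true)//.
  move: ys yt; rewrite ltr_pdivlMr// ltr_pdivrMr// => ys yt.
  apply/andP; split.
    have : (v - e) * q <= y (ratr s) * q by rewrite ler_pM2r//; lra.
    lra.
  have : y (ratr t) * q <= (v + e) * q by rewrite ler_pM2r//; lra.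
  lra.
apply: (le_trans h); apply: (le_trans (count_between _ _)); last by lra.
have : 0 < q * e by rewrite mulr_gt0.
lra.
Qed.

Lemma crossing_area_ge0 M m y : 0 <= crossing_area M m y.
Proof. by apply: sumr_ge0 => ij _; rewrite mulr_ge0// invr_ge0 exprn_ge0. Qed.

Lemma crossing_area_le M m y : crossing_area M m y <= M%:R ^+ 2.
Proof.
rewrite /crossing_area; apply: (@le_trans _ _
  (\sum_(ij : 'I_(M * m.+1) * 'I_(M * m.+1)) m.+1%:R ^- 2)).
  by apply: ler_sum => ij _; rewrite ler_piMr ?invr_ge0 ?exprn_ge0// indicE lern1 leq_b1.
rewrite sumr_const card_prod card_ord -[_ *+ (_ * _)]mulr_natr !natrM le_eqVlt.
apply/orP; left; apply/eqP; field.
by rewrite nat1r pnatr_eq0.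
Qed.

(** Columns away from the partition times have few crossed cells, by small oscillation. Each
    partition time spoils at most 6 columns, of [M * q] cells each, which is negligible against
    [q ^ 2]. *)
Lemma crossing_area_cvg M y : crossing_area M m y @[m --> \oo] --> 0.
Proof.
apply/cvgrPdist_le => e e0.
(* Chosen so that the good columns contribute [2 * M * e1], at most [e / 2]; the 1 covers the case
   [M = 0]. *)
pose e1 := e / (4 * (M%:R + 1)).
have M0 : 0 <= M%:R :> R by [].
have e10 : 0 < e1 by rewrite divr_gt0// mulr_gt0// ltr_wpDl.
have [ts tsP] := cadlag_partition y (M%:R + 3) e10.
(* Collects the terms of order [q]: the rounding 4 in each of the [M * q] columns, and the spoiled
   columns. *)
pose B : R := 4 * M%:R + 6 * M%:R * (size ts)%:R.
have B0 : 0 <= B by rewrite addr_ge0// !mulr_ge0.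
have e20 : 0 < e / 2 by rewrite divr_gt0.
have B10 : 0 < B + 1 by rewrite ltr_wpDl.
near=> m.
have Bm : (B + 1) / m.+1%:R < e / 2 by near: m; exact: near_infty_ratio_lt.
rewrite sub0r normrN (ger0_norm (crossing_area_ge0 _ _ _)).
pose q : R := m.+1%:R; have q0 : 0 < q by [].
pose K := (M * m.+1)%N; have KE : K%:R = M%:R * q by rewrite natrM.
have col (i : 'I_K) : \sum_(j < K) \1_(cell_crossing q i%:R j%:R) y <=
    2 * q * e1 + 4 + M%:R * q * \sum_(t <- ts) (q * t - 3 < i%:R < q * t + 2)%R%:R.
  have [/hasP[t tts tI]|] := boolP (has (fun t => q * t - 3 < i%:R < q * t + 2) ts).
    apply: (@le_trans _ _ (M%:R * q)).
      rewrite (@le_trans _ _ (\sum_(j < K) (1 : R)))//.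
        by apply: ler_sum => j _; rewrite indicE lern1 leq_b1.
      by rewrite sumr_const card_ord KE.
    apply: (@le_trans _ _ (M%:R * q * 1)); first by rewrite mulr1.
    apply: (@le_trans _ _ (M%:R * q * \sum_(t <- ts) (q * t - 3 < i%:R < q * t + 2)%R%:R)).
      apply: ler_wpM2l; first by rewrite mulr_ge0// ltW.
      by rewrite (big_rem t)//= tI [X in _ <= X + _](_ : _ = 1)// lerDl sumr_ge0.
    by rewrite lerDr addr_ge0// !mulr_ge0// ltW.
  move=> /hasPn nts; apply: (@le_trans _ _ (2 * q * e1 + 4)); last first.
    by rewrite lerDl; apply: mulr_ge0; [rewrite mulr_ge0// ltW|exact: sumr_ge0].
  apply: column_crossings => // s t; wlog st : s t / s <= t.
    move=> H hs ht; have [|/ltW ts'] := leP s t; first by move=> ?; exact: H.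
    by rewrite distrC; exact: H.
  move=> /andP[s1 s2] /andP[t1 t2]; apply: tsP => //.
    apply: (lt_le_trans t2); rewrite ler_pdivrMr//.
    have : i%:R + 1 <= M%:R * q by rewrite natr1 -KE ler_nat.
    have : 1 <= q by rewrite ler1n.
    by lra.
  move=> r rts; apply/negP => /andP[sr rt]; have := nts r rts; rewrite negb_and -!leNgt.
  move: s1 t2; rewrite ltr_pdivrMr// ltr_pdivlMr// => s1 t2.
  have h1 : s * q < r * q by rewrite ltr_pM2r.
  have h2 : r * q <= t * q by rewrite ler_pM2r.
  by move=> /orP[]; lra.
have sum_le : \sum_(i < K) \sum_(j < K) \1_(cell_crossing q i%:R j%:R) y <=
    q ^+ 2 * (2 * M%:R * e1) + q * B.
  apply: (le_trans (ler_sum _ (fun i _ => col i))).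
  rewrite big_split/= sumr_const card_ord -mulr_sumr exchange_big/=.
  have : \sum_(t <- ts) \sum_(i < K) (q * t - 3 < i%:R < q * t + 2)%R%:R <= 6 * (size ts)%:R :> R.
    apply: (@le_trans _ _ (\sum_(t <- ts) 6)); last first.
      by rewrite big_const_seq count_predT iter_addr_0 mulr_natr.
    by apply: ler_sum => t _; apply: (le_trans (count_between _ _)); lra.
  rewrite -[_ *+ K]mulr_natl KE => h.
  have h' := ler_wpM2l (mulr_ge0 M0 (ltW q0)) h.
  apply: (le_trans (lerD (lexx _) h')); rewrite /B le_eqVlt; apply/orP; left.
  by apply/eqP; ring.
rewrite /crossing_area -(pair_bigA _ (fun i j : 'I_K => q ^- 2 * \1_(cell_crossing q i%:R j%:R) y))/=.
under eq_bigr do rewrite -mulr_sumr.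
rewrite -mulr_sumr mulrC ler_pdivrMr ?exprn_gt0//.
apply: (le_trans sum_le).
have h2 : q * B <= q ^+ 2 * (e / 2).
  rewrite expr2 -mulrA ler_pM2l// mulrC -ler_pdivrMr//.
  apply: (le_trans _ (ltW Bm)); rewrite ler_pM2r ?invr_gt0//; lra.
have h3 : 2 * M%:R * e1 <= e / 2.
  rewrite /e1 (_ : 2 * M%:R * (e / (4 * (M%:R + 1))) = e / 2 * (M%:R / (M%:R + 1))); last first.
    by field; apply/eqP => ?; lra.
  rewrite ler_piMr//; first exact: ltW.
  by rewrite ler_pdivrMr; lra.
have h4 : q ^+ 2 * (2 * M%:R * e1) <= q ^+ 2 * (e / 2) by rewrite ler_pM2l// exprn_gt0.
by apply: (le_trans (lerD h4 h2)); lra.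
Unshelve. all: by end_near. Qed.

End graph_cells.

(** * Genericity of the limit state *)

Section generic_almost_surely.
Context {R : realType} d (T : measurableType d) (P : probability T R).

Lemma cadlag_right_cvg (y : cadlag R) t : y s @[s --> t^'+] --> y t.
Proof.
have [yr _ yN] := cadlag_funP y; have [t0|t0] := leP 0 t; first exact: yr.
rewrite (yN t t0); apply: cvg_near_cst; near=> s; apply: yN.
by near: s; exact: nbhs_right_lt.
Unshelve. all: by end_near. Qed.

Lemma cadlag_rat_near (y : cadlag R) (A : set R) t e : 0 < e -> open A -> A (y t) ->
  exists s : rat, t < ratr s < t + e /\ A (y (ratr s)).
Proof.
move=> e0 oA Ayt.
have : \forall s \near t^'+, A (y s).
  by apply: (cadlag_right_cvg (y := y)); exact: open_nbhs_nbhs.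
rewrite near_withinE => -[r /= r0 hr].
have [] := @rat_in_itvoo R t (t + Num.min e r); first by rewrite ltrDl lt_min e0.
move=> s; rewrite in_itv/= => /andP[ts tsr]; exists s.
have [h1 h2] : Num.min e r <= e /\ Num.min e r <= r by rewrite !ge_min !lexx orbT.
split; first by lra.
by apply: hr => //=; rewrite ltr_distlC; lra.
Qed.

(** The condition on [p] is the failure of the dichotomy in [generic_state]. Independence is applied
    cell by cell, and the resulting expected area tends to 0 by domination by [M ^ 2]. *)
Lemma graph_negligible (Y : {RV P >-> cadlag R}) (pi : {RV P >-> lfmeasure R})
    (M : nat) :
  has_lebesgue_intensity pi -> independent_RVs P Y pi ->
  P.-negligible [set w | simple_point_measure (pi w) /\
    exists p, [/\ atoms (pi w) p, p.1 < M%:R, p.2 < M%:R & forall e, 0 < e ->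
      (exists t, `|t - p.1| < e /\ Y w t <= p.2 + e) /\
      (exists t, `|t - p.1| < e /\ p.2 - e <= Y w t)]].
Proof.
move=> leb indep; apply: negligible_small => e e0.
have mA m (ij : 'I_(M * m.+1) * 'I_(M * m.+1)) :
    measurable (Y @^-1` cell_crossing m.+1%:R ij.1%:R ij.2%:R).
  rewrite -[X in measurable X]setTI; apply: measurable_funPT => //.
  exact: measurable_crossing.
have mind m (ij : 'I_(M * m.+1) * 'I_(M * m.+1)) : measurable_fun setT (fun w =>
    (\1_(cell_crossing m.+1%:R ij.1%:R ij.2%:R) (Y w))%:E : \bar R).
  by apply/measurable_EFinP; exact: (measurable_indic (mA m ij)).
pose f m w : \bar R := (crossing_area M m (Y w))%:E.
have fE m w : f m w = (\sum_(ij : 'I_(M * m.+1) * 'I_(M * m.+1))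
    (m.+1%:R ^- 2)%:E * (\1_(cell_crossing m.+1%:R ij.1%:R ij.2%:R) (Y w))%:E)%E.
  by rewrite /f /crossing_area -sumEFin.
have mf m : measurable_fun setT (f m).
  rewrite (_ : f m = fun w => (\sum_(ij : 'I_(M * m.+1) * 'I_(M * m.+1))
    (m.+1%:R ^- 2)%:E * (\1_(cell_crossing m.+1%:R ij.1%:R ij.2%:R) (Y w))%:E)%E).
    2: by apply/funext => w; exact: fE.
  by apply: emeasurable_sum => ij; apply: measurable_funeM; exact: mind.
have icst : P.-integrable setT (EFin \o cst (M%:R ^+ 2 : R)).
  exact: finite_measure_integrable_cst.
have [|||_ _ cv] := @dominated_convergence _ _ _ P setT measurableT f (cst 0%E)
  (EFin \o cst (M%:R ^+ 2 : R)) mf _ _ icst.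
- exact: measurable_cst.
- by apply: aeW => w _; rewrite /f; apply: cvg_EFin; [exact: nearW|exact: crossing_area_cvg].
- apply: aeW => w n _; rewrite /f /= ger0_norm ?crossing_area_ge0// lee_fin.
  exact: crossing_area_le.
rewrite integral_cst// mul0e in cv.
have [m hm] : exists m, (\int[P]_w f m w < e%:E)%E.
  have : \forall m \near \oo, (\int[P]_w f m w < e%:E)%E.
    apply: (cv [set x : \bar R | (x < e%:E)%E]).
    by apply: open_nbhs_nbhs; split; [exact: open_ereal_lt_ereal|rewrite /= lte_fin].
  by move=> /filter_ex.
pose cell (ij : 'I_(M * m.+1) * 'I_(M * m.+1)) : set (R * R) :=
  half_open_box (ij.1%:R / m.+1%:R) (ij.1.+1%:R / m.+1%:R)
    (ij.2%:R / m.+1%:R) (ij.2.+1%:R / m.+1%:R).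
have mcell ij : measurable (cell ij) by exact: measurable_half_open_box.
pose A (ij : 'I_(M * m.+1) * 'I_(M * m.+1)) := cell_crossing m.+1%:R ij.1%:R ij.2%:R : set (cadlag R).
pose E ij := Y @^-1` A ij `&` pi @^-1` charges (cell ij).
have [|mU PU] := @union_bound R _ T P _ E.
  by move=> ij; apply: measurableI; [exact: mA|exact: measurable_RV_charges].
exists [set w | exists i, E i w]; split=> //.
  move=> w [sim [p [atp p1M p2M hp]]].
  have [/(_ _ atp)[p10 p20] _ _] := simple_atoms sim.
  have [i hi] := grid_cover m p10 p1M; have [j hj] := grid_cover m p20 p2M.
  exists (i, j); split; last first.
    by apply: (charges_atom sim atp (mcell _)); split; rewrite /= in_itv.
  have m0 : 0 < m.+1%:R :> R by [].
  (* Half a mesh keeps times and values strictly inside the enlarged cell, leaving room to pass to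
     rational times. *)
  have [[t [ht yt]] [t' [ht' yt']]] : 
      (exists t, `|t - p.1| < m.+1%:R^-1 / 2 /\ Y w t <= p.2 + m.+1%:R^-1 / 2) /\
      (exists t, `|t - p.1| < m.+1%:R^-1 / 2 /\ p.2 - m.+1%:R^-1 / 2 <= Y w t).
    by apply: hp; rewrite divr_gt0 ?invr_gt0.
  suff : crossing ((i%:R - 1) * m.+1%:R^-1) ((i%:R + 2) * m.+1%:R^-1)
    ((j%:R - 1) * m.+1%:R^-1) ((j%:R + 2) * m.+1%:R^-1) (Y w) by [].
  have succ (n : nat) : n.+1%:R / m.+1%:R = n%:R / m.+1%:R + m.+1%:R^-1 :> R.
    by rewrite -[n.+1%:R]natr1 mulrDl mul1r.
  move: hi hj ht ht' yt yt'; rewrite !succ !ltr_distl !mulrBl !mulrDl mul1r.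
  set r := m.+1%:R^-1; set a := i%:R * r; set b := j%:R * r => hi hj ht ht' yt yt'.
  have r0 : 0 < r by rewrite invr_gt0.
  split.
    have [] := @cadlag_rat_near (Y w) [set x | x < b + 2 * r] t (a + 2 * r - t) _ (@open_lt _ _).
    - by clear -hi ht r0; lra.
    - by rewrite /=; clear -hj yt r0; lra.
    by move=> s [hs1 /= hs2]; exists s; split; [clear -hi ht hs1 r0|clear -hs2]; lra.
  have [] := @cadlag_rat_near (Y w) [set x | b - r < x] t' (a + 2 * r - t') _ (@open_gt _ _).
  - by clear -hi ht' r0; lra.
  - by rewrite /=; clear -hj yt' r0; lra.
  by move=> s [hs1 /= hs2]; exists s; split; [clear -hi ht' hs1 r0|clear -hs2]; lra.
apply: (le_trans PU); apply: le_trans (ltW hm).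
under eq_integral do rewrite fE.
rewrite ge0_integral_sum//; last by move=> ij; apply: measurable_funeM; exact: mind.
apply: lee_sum => ij _.
rewrite ge0_integralZl_EFin//.
rewrite (_ : (\int[P]_w _)%E = P (Y @^-1` A ij)); last first.
  by rewrite (integral_indic P measurableT (mA m ij)) setIT.
rewrite /E indep; [|exact: measurable_crossing|exact: measurable_charges].
rewrite muleC; apply: lee_wpmul2r => //.
have i0 (i : nat) : 0 <= i%:R / m.+1%:R :> R by rewrite divr_ge0.
have ii (i : nat) : i%:R / m.+1%:R <= i.+1%:R / m.+1%:R :> R.
  by rewrite ler_pM2r ?invr_gt0// ler_nat.
have iiE (i : nat) : i.+1%:R / m.+1%:R - i%:R / m.+1%:R = m.+1%:R^-1 :> R.
  by rewrite -mulrBl -natrB// subSnn mul1r.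
apply: (le_trans (charges_prob leb (i0 _) (ii _) (i0 _) (ii _))).
by rewrite !iiE -invfM -expr2.
Qed.

Lemma mutually_independent_pair (I : choiceType) d1 (T1 : measurableType d1)
    (X : I -> T -> T1) i j (B1 B2 : set T1) :
  mutually_independent_RVs P X -> i != j -> measurable B1 -> measurable B2 ->
  P (X i @^-1` B1 `&` X j @^-1` B2) = (P (X i @^-1` B1) * P (X j @^-1` B2))%E.
Proof.
move=> indep ij mB1 mB2.
have mB k : measurable (if k == i then B1 else B2) by case: ifP.
have := indep [fset i; j]%fset _ mB.
rewrite big_fsetU1/=; last by rewrite inE.
rewrite big_seq_fset1 eqxx (eq_sym j) (negbTE ij) => <-.
congr (P _); apply/seteqP; split=> w /=.
  move=> [w1 w2] k /=; rewrite !inE => /orP[/eqP ->|/eqP ->]; first by rewrite eqxx.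
  by rewrite (eq_sym j) (negbTE ij).
move=> h; split; first by have := h i; rewrite /= !inE eqxx => /(_ isT).
by have := h j; rewrite /= !inE eqxx orbT (eq_sym j) (negbTE ij) => /(_ isT).
Qed.

Lemma time0_negligible (pi : {RV P >-> lfmeasure R}) (M : nat) :
  has_lebesgue_intensity pi ->
  P.-negligible [set w | simple_point_measure (pi w) /\
    exists p, [/\ atoms (pi w) p, p.1 = 0 & p.2 < M%:R]].
Proof.
move=> leb; apply: negligible_small => e e0.
pose b := e / (M%:R + 1).
have M1 : 0 < M%:R + 1 :> R by rewrite ltr_wpDl.
have b0 : 0 < b by rewrite divr_gt0.
have mB := @measurable_half_open_box R 0 b 0 M%:R.
exists (pi @^-1` charges (half_open_box 0 b 0 M%:R)); split.
- exact: measurable_RV_charges.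
- move=> w [sim [p [atp p0 pM]]]; apply: (charges_atom sim atp mB).
  have [/(_ _ atp)[_ p2] _ _] := simple_atoms sim.
  by split; rewrite /= in_itv/= ?p0 ?lexx// p2.
- apply: (le_trans (charges_prob leb (lexx _) (ltW b0) (lexx _) _)) => //.
  rewrite lee_fin !subr0 /b mulrAC ler_pdivrMr// ler_pM2l//; lra.
Qed.

(** Every failure of genericity is visible in a bounded region, so integer cutoffs leave countably
    many negligible events, of four types. *)
Lemma almost_surely_generic (Y : nat -> {RV P >-> cadlag R})
    (pi : nat -> {RV P >-> lfmeasure R}) :
  iid P pi -> (forall k, is_poisson_measure (pi k)) ->
  (forall k, has_lebesgue_intensity (pi k)) ->
  (forall k, independent_RVs P (Y k) (pi k)) ->
  P.-negligible [set w | (forall k, simple_point_measure (pi k w)) /\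
    ~ generic_state (fun k => (Y k w, pi k w))].
Proof.
move=> [indep _] pois leb Yindep.
pose B0 (c : nat * nat) := [set w | simple_point_measure (pi c.1 w) /\
    exists p, [/\ atoms (pi c.1 w) p, p.1 = 0 & p.2 < c.2%:R]].
pose B1 (c : nat * nat) := [set w | simple_point_measure (pi c.1 w) /\
    exists p, [/\ atoms (pi c.1 w) p, p.1 < c.2%:R, p.2 < c.2%:R & forall e, 0 < e ->
      (exists t, `|t - p.1| < e /\ Y c.1 w t <= p.2 + e) /\
      (exists t, `|t - p.1| < e /\ p.2 - e <= Y c.1 w t)]].
pose B2 (c : nat * nat * nat) := [set w | c.1.1 != c.1.2 /\
    [/\ simple_point_measure (pi c.1.1 w), simple_point_measure (pi c.1.2 w) &
    exists p q, [/\ atoms (pi c.1.1 w) p, atoms (pi c.1.2 w) q, p.1 = q.1, p.1 < c.2%:R &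
      0 <= p.2 < c.2%:R /\ 0 <= q.2 < c.2%:R]]].
(* Two atoms of one measure at the same time have different heights, separated by a rational level;
   the masses below and above that level are independent. *)
pose B3 (c : nat * nat * rat) := [set w | 0 <= c.2 <= c.1.2%:R /\
    [/\ simple_point_measure (pi c.1.1 w), simple_point_measure (pi c.1.1 w) &
    exists p q, [/\ atoms (pi c.1.1 w) p, atoms (pi c.1.1 w) q, p.1 = q.1, p.1 < c.1.2%:R &
      0 <= p.2 < ratr c.2 /\ ratr c.2 <= q.2 < c.1.2%:R]]].
have nB0 : P.-negligible [set w | exists c, B0 c w].
  by apply: negligible_countable => c; exact: time0_negligible.
have nB1 : P.-negligible [set w | exists c, B1 c w].
  by apply: negligible_countable => c; exact: graph_negligible.
have nB2 : P.-negligible [set w | exists c, B2 c w].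
  apply: negligible_countable => -[[k l] M]; rewrite /B2 /=.
  have [kl|kl] := eqVneq k l.
    by apply: (negligibleS _ (negligible_set0 P)) => w [].
  apply: negligibleS (@same_time_negligible R d T P (pi k) (pi l) M 0 M%:R 0 M%:R
    (leb k) (leb l) (lexx _) _ (lexx _) (lexx _) _ (lexx _) _) => //.
    by move=> w [].
  move=> a b a0; apply: (mutually_independent_pair indep) => //;
    by apply: measurable_charges; exact: measurable_half_open_box.
have nB3 : P.-negligible [set w | exists c, B3 c w].
  apply: negligible_countable => -[[k M] r]; rewrite /B3 /=.
  have [/andP[r0 rM]|nr] := boolP (0 <= r <= M%:R); last first.
    by apply: (negligibleS _ (negligible_set0 P)) => w [].
  move: r0 rM; rewrite -(@ler0q R) -(ler_rat R) ratr_nat => r0 rM.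
  apply: negligibleS (@same_time_negligible R d T P (pi k) (pi k) M 0 (ratr r) (ratr r) M%:R
    (leb k) (leb k) (lexx _) r0 rM r0 rM (lexx _) _) => //.
    by move=> w [].
  move=> a b a0; have [_ poisindep] := pois k.
  pose B (i : 'I_2) := if i == ord0 then half_open_box a b 0 (ratr r)
    else half_open_box a b (ratr r) M%:R.
  have U1 : measurable [set x : \bar R | (1 <= x)%E].
    rewrite (_ : [set x | _] = `[1%E, +oo[%classic); last first.
      by apply/seteqP; split=> x; rewrite /= in_itv/= andbT.
    exact: emeasurable_itv.
  apply: (mutually_independent_pair (X := fun i w => pi k w (B i)) (i := ord0)
    (j := ord_max) _ _ U1 U1) => //.
  apply: poisindep => [i|].
    rewrite /B; case: ifP => _; split; try exact: measurable_half_open_box;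
    exact: half_open_box_quadrant.
  apply/trivIsetP => i j _ _ ij; apply/seteqP; split=> // p.
  have h : ~ (half_open_box a b 0 (ratr r) p /\ half_open_box a b (ratr r) M%:R p).
    by move=> [[_ /=]]; rewrite in_itv/= => h1 [_ /=]; rewrite in_itv/=; lra.
  move: ij; rewrite /B.
  have [i0|i0] := eqVneq i ord0; have [j0|j0] := eqVneq j ord0.
  - by rewrite i0 j0 eqxx.
  - by move=> _ hp; apply: h.
  - by move=> _ [h1 h2]; apply: h.
  - have ord2 (o : 'I_2) : o != ord0 -> o = ord_max.
      by case: o => -[|[|o]] //= ho _; exact: val_inj.
    by rewrite (ord2 _ i0) (ord2 _ j0) eqxx.
have big (r1 r2 : R) : exists M : nat, r1 < M%:R /\ r2 < M%:R.
  exists (Num.bound (`|r1| + `|r2|)).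
  have := archi_boundP (addr_ge0 (normr_ge0 r1) (normr_ge0 r2)).
  have := ler_norm r1; have := ler_norm r2; have := normr_ge0 r1; have := normr_ge0 r2.
  by split; lra.
apply: negligibleS (negligibleU nB0 (negligibleU nB1 (negligibleU nB2 nB3))).
move=> w [sim ngen]; apply: contrapT => /not_orP[n0 /not_orP[n1 /not_orP[n2 n3]]].
apply: ngen; split=> //=.
  move=> k p atp; have [/(_ _ atp)[p1 p2] _ _] := simple_atoms (sim k).
  have [M [M1 M2]] := big p.1 p.2; split.
    rewrite lt_neqAle p1 andbT eq_sym; apply/eqP => p10; apply: n0.
    by exists (k, M); split=> //; exists p.
  apply: contrapT => nex; apply: n1; exists (k, M); split=> //; exists p; split=> // e e0.
  have /not_orP[/existsNP[t ht] /existsNP[t' ht']] :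
      ~ ((forall t, `|t - p.1| < e -> p.2 + e < Y k w t) \/
        (forall t, `|t - p.1| < e -> Y k w t < p.2 - e)).
    by move=> h; apply: nex; exists e.
  move/not_implyP : ht => [ht1 /negP]; rewrite -leNgt => ht2.
  move/not_implyP : ht' => [ht'1 /negP]; rewrite -leNgt => ht'2.
  by split; [exists t|exists t'].
move=> k l p q atp atq pq.
have [/(_ _ atp)[p1 p2] _ _] := simple_atoms (sim k).
have [/(_ _ atq)[q1 q2] _ _] := simple_atoms (sim l).
have [M' [M1' M2']] := big p.2 q.2; have [M [M1 M2]] := big p.1 M'%:R.
have [kl|kl] := eqVneq k l; last first.
  exfalso; apply: n2; exists (k, l, M); split=> //; split=> //; exists p, q; split=> //.
  by split; lra.
split=> //; rewrite -{}kl in atq *.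
have cross (p' q' : R * R) : atoms (pi k w) p' -> atoms (pi k w) q' -> p'.1 = q'.1 ->
    p'.1 < M%:R -> 0 <= p'.2 -> q'.2 < M%:R -> p'.2 < q'.2 -> False.
  move=> atp' atq' pq' p'1 p'2 q'2 pq2; have [] := @rat_in_itvoo R p'.2 q'.2 pq2.
  move=> r; rewrite in_itv/= => hr; apply: n3; exists (k, M, r).
  split; first by rewrite /= -(@ler0q R) -(ler_rat R) ratr_nat; lra.
  by split=> //; exists p', q'; split=> //=; split; lra.
have [pq2|qp2|pq2] := ltgtP p.2 q.2.
- by exfalso; apply: (cross p q) => //; lra.
- by exfalso; apply: (cross q p) => //; lra.
- by rewrite [p]surjective_pairing [q]surjective_pairing pq pq2.
Qed.

End generic_almost_surely.

(** * Approximation by cylinder functions *)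

Section cylinder_functions.
Context {R : realType}.
Implicit Types (x y : @state R) (g : @state R -> R) (c : constraint).

Definition simple_states : set (@state R) :=
  [set x | forall k, simple_point_measure (x k).2].

Local Notation coordinates n := (prod_topology (fun _ : 'I_n => (cadlag R * lfmeasure R)%type)).

(** Transfers functions of states to the finite products, where convergence is assumed. The default
    measure is zero, hence simple. *)
Definition extension n (z : coordinates n) : @state R :=
  fun k => if insub k is Some i then z i else (point, point).

Definition finitely_dependent g : Prop :=
  exists n, forall x y, (forall k, (k < n)%N -> x k = y k) -> g x = g y.

Definition cylinder_continuous g : Prop :=
  finitely_dependent g /\ forall n, continuous (g \o @extension n).

Lemma cylinder_continuous_cst (r : R) : cylinder_continuous (cst r).
Proof.
split=> [|n]; first by exists 0%N.
have h : continuous (cst r : coordinates n -> R) by exact: (@cst_continuous (coordinates n) R r).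
exact: h.
Qed.

Lemma cylinder_continuous_op (op : R -> R -> R) g1 g2 :
  (forall (E : topologicalType) (f1 f2 : E -> R), continuous f1 -> continuous f2 ->
    continuous (fun z => op (f1 z) (f2 z))) ->
  cylinder_continuous g1 -> cylinder_continuous g2 ->
  cylinder_continuous (fun x => op (g1 x) (g2 x)).
Proof.
move=> hop [[n1 d1] c1] [[n2 d2] c2]; split; last first.
  by move=> n; exact: (hop _ _ _ (c1 n) (c2 n)).
exists (maxn n1 n2) => x y xy; congr op; [apply: d1|apply: d2] => k kn;
  by apply: xy; rewrite leq_max kn ?orbT.
Qed.

Lemma cylinder_continuousM g1 g2 :
  cylinder_continuous g1 -> cylinder_continuous g2 ->
  cylinder_continuous (fun x => g1 x * g2 x).
Proof. by apply: (cylinder_continuous_op (op := *%R)) => E f1 f2 h1 h2 z; exact: (cvgM (h1 z) (h2 z)). Qed.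

Lemma cylinder_continuous_max g1 g2 :
  cylinder_continuous g1 -> cylinder_continuous g2 ->
  cylinder_continuous (fun x => Num.max (g1 x) (g2 x)).
Proof.
apply: (cylinder_continuous_op (op := Num.max)) => E f1 f2 h1 h2 z.
exact: (continuous_max (h1 z) (h2 z)).
Qed.

Lemma clamp_continuous : continuous (clamp : R -> R).
Proof.
move=> t; apply/cvgrPdist_lt => e e0; apply/nbhs_ballP; exists e => //= s.
by rewrite /ball/=; exact: le_lt_trans (clamp_lipschitz _ _).
Qed.

Lemma slack_continuous c n : continuous (slack c \o @extension n).
Proof.
case: c => [[[[k kind] j] i] [[[q0 q1] q2] q3]].
have [i0 _ ik|z0] := @insubP _ _ 'I_n k.
  have c1 : continuous (fun z : coordinates n => (z i0).1).
    by move=> z; apply: (cvg_comp _ _ (@proj_continuous _ _ i0 z)); exact: cvg_fst.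
  have c2 : continuous (fun z : coordinates n => (z i0).2).
    by move=> z; apply: (cvg_comp _ _ (@proj_continuous _ _ i0 z)); exact: cvg_snd.
  have extE z : @extension n z k = z i0 by rewrite /extension -ik valK.
  have cw j' (a b : R) (g : level) : continuous (fun z : coordinates n => window_sup j' a b g (@extension n z k).1).
    have -> : (fun z : coordinates n => window_sup j' a b g (@extension n z k).1) =
        (fun z : coordinates n => window_sup j' a b g (z i0).1) by apply/funext => z; rewrite extE.
    by move=> z; exact: (cvg_comp _ _ (c1 z) (@window_sup_continuous R j' a b g _)).
  have cp j' (a b u v : R) : continuous (fun z : coordinates n => pyramid_integral j' a b u v (@extension n z k).2).
    have -> : (fun z : coordinates n => pyramid_integral j' a b u v (@extension n z k).2) =
        (fun z : coordinates n => pyramid_integral j' a b u v (z i0).2) by apply/funext => z; rewrite extE.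
    by move=> z; exact: (cvg_comp _ _ (c2 z) (@pyramid_integral_continuous R j' a b u v _)).
  case: kind => [|[|[|kind]]] z.
  - exact: (cvgB (cp j (ratr q0) (ratr q1) (ratr q2) (ratr q3) z) (cvg_cst _)).
  - exact: (cvgB (cvg_cst _) (cp j (ratr q0) (ratr q1) (ratr q2) (ratr q3) z)).
  - exact: (cvgB (cvg_cst _) (cw j (ratr q0) (ratr q1) (ramp_up i (ratr q2)) z)).
  - exact: (cvgB (cvg_cst _) (cw j (ratr q0) (ratr q1) (ramp_down i (ratr q2)) z)).
have -> : slack (k, kind, j, i, (q0, q1, q2, q3)) \o @extension n =
    cst (slack (k, kind, j, i, (q0, q1, q2, q3)) (fun=> (point, point))).
  by apply/funext => z /=; rewrite /extension insubN.
exact: (@cst_continuous (coordinates n) R).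
Qed.

Lemma slack_finitely_dependent c : finitely_dependent (slack c).
Proof.
case: c => [[[[k kind] j] i] [[[q0 q1] q2] q3]]; exists k.+1 => x y xy /=.
by rewrite (xy k (ltnSn k)).
Qed.

Definition gate (m : nat) (l : seq constraint) x : R :=
  \prod_(c <- l) clamp (m%:R * slack c x).

Lemma gate_itv m l x : 0 <= gate m l x <= 1.
Proof.
apply: (big_ind (fun v : R => 0 <= v <= 1)) => [|u v|c _]; rewrite ?ler01 ?lexx//.
  by move=> /andP[u0 u1] /andP[v0 v1]; rewrite mulr_ge0// mulr_ile1.
by rewrite clamp_ge0 clamp_le1.
Qed.

Lemma gate_gt0 m l x : gate m l x != 0 -> cylinder satisfies l x.
Proof.
rewrite /gate prodf_seq_neq0 => /allP h c cl; have := h c cl; rewrite /= /satisfies /= => h'.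
rewrite ltNge; apply/negP => sc; move: h'.
by rewrite clamp_eq0 ?eqxx// mulr_ge0_le0.
Qed.

Lemma gate_near1 l x : cylinder satisfies l x -> \forall m \near \oo, gate m l x = 1.
Proof.
move=> h; have : \forall m \near \oo, forall c, c \in l -> clamp (m%:R * slack c x) = 1.
  apply: near_seq => c /h sc; have s1 : 0 < slack c x := sc.
  near=> m; apply: clamp_eq1; rewrite -ler_pdivrMr//; near: m; exact: nbhs_infty_ger.
by apply: filterS => m hm; rewrite /gate big_seq big1.
Unshelve. all: by end_near. Qed.

Lemma gate_cylinder_continuous m l : cylinder_continuous (gate m l).
Proof.
have -> : gate m l = fun x => \prod_(c <- l) clamp (m%:R * slack c x) by [].
elim: l => [|c l IH].
  have -> : (fun x => \prod_(c <- [::]) clamp (m%:R * slack c x)) = cst 1.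
    by apply/funext => x; rewrite big_nil.
  exact: cylinder_continuous_cst.
have -> : (fun x => \prod_(c <- c :: l) clamp (m%:R * slack c x)) =
    (fun x => clamp (m%:R * slack c x) * \prod_(c <- l) clamp (m%:R * slack c x)).
  by apply/funext => x; rewrite big_cons.
apply: cylinder_continuousM IH; split.
  by have [n hn] := slack_finitely_dependent c; exists n => x y xy; rewrite (hn x y).
move=> n z /=; apply: (cvg_comp (fun z => m%:R * slack c (@extension n z))).
  exact: (cvgM (cvg_cst _) (@slack_continuous c n z)).
exact: clamp_continuous.
Qed.

Context (phi : @state R -> R).

Definition minorant (l : seq constraint) (q : rat) : Prop :=
  0 <= q /\ forall x, simple_states x -> cylinder satisfies l x -> ratr q <= phi x.

Definition minorant_term (m i : nat) x : R :=
  if (choice.unpickle i : option (seq constraint * rat)) is Some (l, q) then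
    if `[< minorant l q >] then ratr q * gate m l x else 0
  else 0.

(** A lower semicontinuous function as a supremum of continuous ones, made sequential: both the
    number of enumerated candidates and the sharpness of their gates grow with [m]. *)
Definition lower_approx (m : nat) x : R :=
  \big[Num.max/0]_(i < m) minorant_term m i x.

Lemma lower_approx_ge0 m x : 0 <= lower_approx m x.
Proof. exact: bigmax_ge_id. Qed.

Lemma lower_approx_le m x : 0 <= phi x -> simple_states x -> lower_approx m x <= phi x.
Proof.
move=> phi0 sx; apply/bigmax_leP; split=> // i _; rewrite /minorant_term.
case: choice.unpickle => [[l q]|//]; case: asboolP => // -[q0 hq].
have /andP[g0 g1] := gate_itv m l x.
have [->|gn0] := eqVneq (gate m l x) 0; first by rewrite mulr0.
apply: le_trans (hq x sx (gate_gt0 gn0)).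
by rewrite ler_piMr// ler0q.
Qed.

Lemma lower_approx_cylinder_continuous m : cylinder_continuous (lower_approx m).
Proof.
have ct i : cylinder_continuous (minorant_term m i).
  rewrite /minorant_term; case: choice.unpickle => [[l q]|]; last exact: cylinder_continuous_cst.
  case: asboolP => _; last exact: cylinder_continuous_cst.
  apply: (@cylinder_continuousM (cst (ratr q))); first exact: cylinder_continuous_cst.
  exact: gate_cylinder_continuous.
have cn n : forall F : nat -> @state R -> R, (forall i, cylinder_continuous (F i)) ->
    cylinder_continuous (fun x => \big[Num.max/0]_(i < n) F i x).
  elim: n => [|n IH] F cF.
    have -> : (fun x => \big[Num.max/0]_(i < 0) F i x) = cst 0.
      by apply/funext => x; rewrite big_ord0.
    exact: cylinder_continuous_cst.
  have -> : (fun x => \big[Num.max/0]_(i < n.+1) F i x) =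
      (fun x => Num.max (F 0%N x) (\big[Num.max/0]_(i < n) F i.+1 x)).
    by apply/funext => x; rewrite big_ord_recl.
  by apply: cylinder_continuous_max => //; exact: (IH (fun i => F i.+1)).
exact: cn.
Qed.

Lemma lower_approx_cvg x : 0 <= phi x -> simple_states x ->
  (forall e, 0 < e -> \forall u \near state_nbhs x, simple_states u -> `|phi u - phi x| < e) ->
  lower_approx m x @[m --> \oo] --> phi x.
Proof.
move=> phi0 sx cont; apply/cvgrPdist_le => e e0.
have e20 : 0 < e / 2 by rewrite divr_gt0.
have [l lx hl] := cont _ e20.
(* For small [phi x] the bound 0 suffices; otherwise a rational between [phi x - e] and
   [phi x - e / 2] is nonnegative and a minorant on a cylinder around [x]. *)
have [phie|ephi] := leP (phi x) e.
  near=> m; rewrite ger0_norm ?subr_ge0 ?lower_approx_le//.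
  by have := lower_approx_ge0 m x; lra.
have [] := @rat_in_itvoo R (phi x - e) (phi x - e / 2); first by lra.
move=> q; rewrite in_itv/= => /andP[q1 q2].
have hm : minorant l q.
  split; first by rewrite -(@ler0q R); lra.
  by move=> u su lu; have := hl u lu su; rewrite ltr_distl; lra.
near=> m; rewrite ger0_norm ?subr_ge0 ?lower_approx_le//.
have gm : gate m l x = 1 by near: m; exact: gate_near1.
have mi : (choice.pickle (l, q) < m)%N by near: m; exact: nbhs_infty_gt.
have : minorant_term m (Ordinal mi) x <= lower_approx m x by exact: le_bigmax.
rewrite /minorant_term /= choice.pickleK; case: asboolP => // _; rewrite gm mulr1; lra.
Unshelve. all: by end_near. Qed.

End cylinder_functions.

(** * The mapping theorem *)

Local Notation coordinates R n :=
  (prod_topology (fun _ : 'I_n => (cadlag R * lfmeasure R)%type)).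

Section random_states.
Context {R : realType}.

Definition simple_coordinates n : set (coordinates R n) :=
  [set z | forall i, simple_point_measure (z i).2].

Lemma extension_simple n (z : coordinates R n) :
  simple_coordinates z -> simple_states (extension z).
Proof.
move=> sz k; rewrite /extension; case: insubP => [i _ _|_]; first exact: sz.
exists set0; split=> [p //|r|B mB]; first by rewrite set0I.
by rewrite set0I measure0.
Qed.

Context d (T : measurableType d) (P : probability T R)
  (Y : nat -> {RV P >-> cadlag R}) (pi : nat -> {RV P >-> lfmeasure R}).

Definition random_state (w : T) : @state R := fun k => (Y k w, pi k w).

Definition random_coordinates n (w : T) : coordinates R n :=
  fun i => (Y i w, pi i w).

Definition simple_event : set T := random_state @^-1` @simple_states R.

Context (random : forall n, (0 < n)%N ->
  random_element_in (@simple_coordinates n) P (@random_coordinates n)).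

Let coordinates_event n := @random_coordinates n @^-1` @simple_coordinates n.

Let measurable_coordinates_event n : (0 < n)%N -> measurable (coordinates_event n).
Proof.
by move=> n0; have [h _] := random n0; have := h setT openT; rewrite setTI.
Qed.

Lemma simple_event_bigcap : simple_event = \bigcap_n coordinates_event n.+1.
Proof.
apply/seteqP; split=> w; first by move=> sw n _ i; exact: sw.
by move=> h k; exact: (h k I (Ordinal (ltnSn k))).
Qed.

Lemma measurable_simple_event : measurable simple_event.
Proof.
rewrite simple_event_bigcap; apply: bigcapT_measurable => n.
exact: measurable_coordinates_event.
Qed.

Lemma simple_eventC_eq0 : P (~` simple_event) = 0%E.
Proof.
apply: measure_negligible; first exact/measurableC/measurable_simple_event.
rewrite simple_event_bigcap setC_bigcap; apply: negligible_bigcup => n.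
have mE := measurable_coordinates_event (ltn0Sn n).
apply/negligibleP; first exact: measurableC.
have [_ P1] := random (ltn0Sn n).
by apply: (eq_trans (probability_setC P mE)); rewrite [X in (_ - X)%E]P1 subee.
Qed.

Lemma integral_simple_event (D : set T) (f : T -> R) : measurable D ->
  simple_event `<=` D -> measurable_fun D f -> (forall w, D w -> 0 <= f w) ->
  (\int[P]_(w in D) (f w)%:E = \int[P]_(w in simple_event) (f w)%:E)%E.
Proof.
move=> mD sD mf f0.
rewrite (@ge0_negligible_integral _ _ _ P D (~` simple_event)) ?setDE ?setCK.
- by congr integral; exact/setIidr.
- exact/measurableC/measurable_simple_event.
- exact: mD.
- exact/measurable_EFinP.
- by move=> w Dw; rewrite lee_fin f0.
- exact: simple_eventC_eq0.
Qed.

(** Replaces the event that the first [n] measures are simple by one event for all [n], at the cost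
    of a null set. *)
Lemma cylinder_integral (g : @state R -> R) n : (0 < n)%N ->
  (forall x y, (forall k, (k < n)%N -> x k = y k) -> g x = g y) ->
  continuous (g \o @extension R n) -> (forall x, 0 <= g x) ->
  (\int[P]_(w in coordinates_event n) (g (extension (@random_coordinates n w)))%:E =
   \int[P]_(w in simple_event) (g (random_state w))%:E)%E /\
  measurable_fun simple_event (fun w => g (random_state w)).
Proof.
move=> n0 dep cont g0.
have gE w : g (extension (@random_coordinates n w)) = g (random_state w).
  by apply: dep => k kn; rewrite /extension insubT.
have sub : simple_event `<=` coordinates_event n by move=> w sw i; exact: sw.
have mg : measurable_fun (coordinates_event n) (fun w => g (random_state w)).
  apply: (measurability (@RGenOpens.G R)) => [|_ [_ [u [v ->]] <-]].
    exact: RGenOpens.measurableE.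
  have [h _] := random n0.
  have := h ((g \o @extension R n) @^-1` `]u, v[%classic) _.
  rewrite preimage_setI setIC => H.
  rewrite (_ : (fun w => g (random_state w)) @^-1` _ =
    @random_coordinates n @^-1` ((g \o @extension R n) @^-1` `]u, v[%classic)).
    by apply: H; move/continuousP : cont; apply; exact: itv_open.
  by apply/seteqP; split=> w /=; rewrite gE.
split; last exact: (measurable_funS (measurable_coordinates_event n0) sub mg).
under eq_integral do rewrite gE.
by apply: integral_simple_event => //; exact: measurable_coordinates_event.
Qed.

End random_states.

Section mapping_theorem.
Context {R : realType}
  (d : nat -> measure_display) (T : forall N, measurableType (d N))
  (P : forall N, probability (T N) R)
  (d' : measure_display) (T' : measurableType d') (P' : probability T' R)
  (Y : forall N, nat -> {RV (P N) >-> cadlag R})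
  (pi : forall N, nat -> {RV (P N) >-> lfmeasure R})
  (Ybar : nat -> {RV P' >-> cadlag R})
  (pibar : nat -> {RV P' >-> lfmeasure R})
  (Ypi_cvg : forall n, (0 < n)%N ->
    @cvg_in_distribution_in R (coordinates R n) (@simple_coordinates R n)
      d T P (fun N => @random_coordinates R _ _ _ (Y N) (pi N) n)
      d' T' P' (@random_coordinates R _ _ _ Ybar pibar n))
  (generic_ae : P'.-negligible [set w | simple_states (random_state Ybar pibar w) /\
    ~ generic_state (random_state Ybar pibar w)]).

Let random N n : (0 < n)%N ->
  random_element_in (@simple_coordinates R n) (P N) (@random_coordinates R _ _ _ (Y N) (pi N) n).
Proof. by move=> /Ypi_cvg[]. Qed.

Let random' n : (0 < n)%N ->
  random_element_in (@simple_coordinates R n) P' (@random_coordinates R _ _ _ Ybar pibar n).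
Proof. by move=> /Ypi_cvg[]. Qed.

Lemma cylinder_integral_cvg (g : @state R -> R) (B : R) :
  cylinder_continuous g -> (forall x, 0 <= g x) ->
  (forall x, simple_states x -> g x <= B) ->
  (\int[P N]_(w in simple_event (Y N) (pi N)) (g (random_state (Y N) (pi N) w))%:E)%E
    @[N --> \oo] -->
  (\int[P']_(w in simple_event Ybar pibar) (g (random_state Ybar pibar w))%:E)%E.
Proof.
move=> [[n dep] cont] g0 gB.
(* One more coordinate is allowed because [Ypi_cvg] requires a positive number of them. *)
have dep' x y : (forall k, (k < n.+1)%N -> x k = y k) -> g x = g y.
  by move=> xy; apply: dep => k kn; apply: xy; exact: ltnW.
have [_ _ /(_ (g \o @extension R n.+1))] := Ypi_cvg (ltn0Sn n).
have [<- _] := cylinder_integral random' (ltn0Sn n) dep' (cont _) g0.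
have E N := (cylinder_integral (random N) (ltn0Sn n) dep' (cont _) g0).1.
under [X in _ -> X]eq_cvg do rewrite -E.
apply; first exact/continuous_subspaceT/cont.
by exists B => z sz; rewrite /= ger0_norm//; exact: (gB _ (extension_simple sz)).
Qed.

Lemma integral_lower_semicontinuity (phi : @state R -> R) (B : R) :
  (forall x, 0 <= phi x <= B) ->
  (forall N, measurable_fun setT (fun w => phi (random_state (Y N) (pi N) w))) ->
  measurable_fun setT (fun w => phi (random_state Ybar pibar w)) ->
  (forall x, generic_state x -> forall e, 0 < e -> \forall u \near state_nbhs x,
    simple_states u -> `|phi u - phi x| < e) ->
  forall e, 0 < e -> \forall N \near \oo,
    \int[P']_w phi (random_state Ybar pibar w) - e <=
    \int[P N]_w phi (random_state (Y N) (pi N) w).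
Proof.
move=> phiB mphi mphi' cont e e0.
have phi0 x : 0 <= phi x by have /andP[] := phiB x.
have bounded_fin d0 (T0 : measurableType d0) (P0 : probability T0 R) (f : T0 -> R) :
    measurable_fun setT f -> (forall w, 0 <= f w <= B) ->
    (\int[P0]_w (f w)%:E)%E \is a fin_num.
  move=> mf fB; rewrite ge0_fin_numE; last first.
    by apply: integral_ge0 => w _; rewrite lee_fin; have /andP[] := fB w.
  apply: (@le_lt_trans _ _ (\int[P0]_w (cst B%:E w))%E).
    apply: ge0_le_integral => //.
    - by move=> w _; rewrite lee_fin; have /andP[] := fB w.
    - exact/measurable_EFinP.
    - by move=> w _; rewrite lee_fin; have /andP[] := fB w.
  by rewrite integral_cst// [X in (_ * X)%E](probability_setT P0) mule1 ltry.
have mS := measurable_simple_event random'.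
have approx_le m x : simple_states x -> lower_approx phi m x <= phi x.
  exact: lower_approx_le.
pose a := \int[P']_w phi (random_state Ybar pibar w).
have aE : (\int[P']_(w in simple_event Ybar pibar) (phi (random_state Ybar pibar w))%:E = a%:E)%E.
  rewrite /a /Rintegral fineK ?bounded_fin//.
  by rewrite (integral_simple_event random' measurableT).
have mapprox m : measurable_fun (simple_event Ybar pibar)
    (fun w => (lower_approx phi m (random_state Ybar pibar w))%:E).
  have [[n dep] ca] := lower_approx_cylinder_continuous phi m.
  apply/measurable_EFinP.
  have dep' x y : (forall k, (k < n.+1)%N -> x k = y k) ->
      lower_approx phi m x = lower_approx phi m y.
    by move=> xy; apply: dep => k kn; apply: xy; exact: ltnW.
  by have [] := cylinder_integral random' (ltn0Sn n) dep' (ca _) (lower_approx_ge0 phi m).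
have [|||| _ _ cv] := @dominated_convergence _ _ _ P' (simple_event Ybar pibar) mS
  (fun m w => (lower_approx phi m (random_state Ybar pibar w))%:E)
  (fun w => (phi (random_state Ybar pibar w))%:E) (EFin \o cst B) mapprox.
- by apply/measurable_EFinP; exact: measurable_funTS.
- case: generic_ae => Z [mZ Z0 hZ]; exists Z; split=> // w /= /not_implyP[sw ncv].
  apply: hZ; split=> // gw; apply: ncv; apply: cvg_EFin; first exact: nearW.
  by apply: lower_approx_cvg => // e' e'0; exact: cont.
- exact: finite_measure_integrable_cst.
- apply: aeW => w m sw /=; rewrite ger0_norm ?lower_approx_ge0// lee_fin.
  by rewrite (le_trans (approx_le _ _ _))//; have /andP[] := phiB (random_state Ybar pibar w).
rewrite aE in cv.
have gt_nbhs (l : \bar R) : ((a - e)%:E < l)%E -> nbhs l [set x | ((a - e)%:E < x)%E].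
  by move=> h; apply: open_nbhs_nbhs; split=> //; exact: open_ereal_gt_ereal.
(* [m] is fixed before [N] varies: convergence in law then applies to a single cylinder function,
   which stays below [phi] at simple states. *)
have [m hm] : exists m, ((a - e)%:E <
    \int[P']_(w in simple_event Ybar pibar) (lower_approx phi m (random_state Ybar pibar w))%:E)%E.
  have : \forall m \near \oo, ((a - e)%:E < \int[P']_(w in simple_event Ybar pibar)
      (lower_approx phi m (random_state Ybar pibar w))%:E)%E.
    by apply: (cv [set x | ((a - e)%:E < x)%E]); apply: gt_nbhs; rewrite lte_fin; lra.
  by move=> /filter_ex.
have cvm := @cylinder_integral_cvg _ B (lower_approx_cylinder_continuous phi m)
  (lower_approx_ge0 phi m) _.
have : \forall N \near \oo, ((a - e)%:E < \int[P N]_(w in simple_event (Y N) (pi N))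
      (lower_approx phi m (random_state (Y N) (pi N) w))%:E)%E.
  apply: (cvm _ [set x | ((a - e)%:E < x)%E]); last exact: gt_nbhs.
  by move=> x sx; rewrite (le_trans (approx_le _ _ _))//; have /andP[] := phiB x.
apply: filterS => N hN; rewrite -lee_fin /Rintegral (fineK (bounded_fin _ _ _ _ (mphi N) _))//.
apply: (le_trans (ltW hN)).
rewrite (integral_simple_event (random N) measurableT)//.
have [[n dep] ca] := lower_approx_cylinder_continuous phi m.
have dep' x y : (forall k, (k < n.+1)%N -> x k = y k) ->
    lower_approx phi m x = lower_approx phi m y.
  by move=> xy; apply: dep => k kn; apply: xy; exact: ltnW.
have [_ mN] := cylinder_integral (random N) (ltn0Sn n) dep' (ca _) (lower_approx_ge0 phi m).
apply: ge0_le_integral.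
- exact: measurable_simple_event (random N).
- by move=> w _; rewrite lee_fin lower_approx_ge0.
- exact/measurable_EFinP.
- by apply/measurable_EFinP; exact: measurable_funTS.
- by move=> w sw; rewrite lee_fin approx_le.
Qed.

Lemma almost_sure_continuous_mapping (E : topologicalType) (F : @state R -> E) :
  (forall N U, open U -> measurable [set w | U (F (random_state (Y N) (pi N) w))]) ->
  (forall U, open U -> measurable [set w | U (F (random_state Ybar pibar w))]) ->
  (forall x, generic_state x -> forall U, open U -> U (F x) ->
    \forall u \near state_nbhs x, simple_states u -> U (F u)) ->
  @cvg_in_distribution R E d T P (fun N w => F (random_state (Y N) (pi N) w))
    d' T' P' (fun w => F (random_state Ybar pibar w)).
Proof.
move=> mF mF' cF.
split.
- move=> N; split=> [U oU|]; first by rewrite setIT; exact: mF.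
  by rewrite preimage_setT probability_setT.
- split=> [U oU|]; first by rewrite setIT; exact: mF'.
  by rewrite preimage_setT probability_setT.
move=> f cf0 [M fM]; have cf : continuous f by apply/continuous_subspace_setT.
have fM' x : - M <= f x <= M by rewrite -ler_norml; exact: fM.
have /continuousP of_ := cf.
have mf N : measurable_fun setT (fun w => f (F (random_state (Y N) (pi N) w))).
  apply: (measurability (@RGenOpens.G R)) => [|_ [_ [u [v ->]] <-]].
    exact: RGenOpens.measurableE.
  rewrite setTI; apply: (mF N (f @^-1` `]u, v[%classic)).
  by apply: of_; exact: itv_open.
have mf' : measurable_fun setT (fun w => f (F (random_state Ybar pibar w))).
  apply: (measurability (@RGenOpens.G R)) => [|_ [_ [u [v ->]] <-]].
    exact: RGenOpens.measurableE.
  rewrite setTI; apply: (mF' (f @^-1` `]u, v[%classic)).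
  by apply: of_; exact: itv_open.
have near_f x : generic_state x -> forall e, 0 < e ->
    \forall u \near state_nbhs x, simple_states u -> `|f (F u) - f (F x)| < e.
  move=> gx e e0.
  have := cF x gx (f @^-1` ball (f (F x)) e) _ _.
  rewrite /ball /= subrr normr0 => /(_ _ e0) H.
  have /H : open (f @^-1` ball (f (F x)) e) by apply: of_; exact: ball_open.
  by apply: filterS => u hu su; rewrite distrC; exact: hu.
have intf d0 (T0 : measurableType d0) (P0 : probability T0 R) (h : T0 -> R) :
    measurable_fun setT h -> (forall w, - M <= h w <= M) ->
    P0.-integrable setT (EFin \o h).
  move=> mh hM; apply: measurable_bounded_integrable => //.
    by rewrite [X in (X < _)%E](probability_setT P0) ltry.
  exists M; split=> [|r Mr w _ /=]; first exact: num_real.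
  by rewrite (le_trans _ (ltW Mr))// ler_norml.
have intM d0 (T0 : measurableType d0) (P0 : probability T0 R) :
    \int[P0]_(w in setT) M = M.
  by rewrite Rintegral_cst// [X in fine X](probability_setT P0) mulr1.
have icst d0 (T0 : measurableType d0) (P0 : probability T0 R) :
    P0.-integrable setT (EFin \o cst M).
  exact: finite_measure_integrable_cst.
have fRV N w : - M <= f (F (random_state (Y N) (pi N) w)) <= M by exact: fM'.
have fRV' w : - M <= f (F (random_state Ybar pibar w)) <= M by exact: fM'.
pose I N := \int[P N]_w f (F (random_state (Y N) (pi N) w)).
pose I' := \int[P']_w f (F (random_state Ybar pibar w)).
have low e : 0 < e -> \forall N \near \oo, I' - e <= I N.
  (* The shift by [M] makes the function nonnegative, as lower approximations start from 0. *)
  move=> e0; have := @integral_lower_semicontinuity (fun x => f (F x) + M) (M + M) _ _ _ _ e e0.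
  have -> : \int[P']_w (f (F (random_state Ybar pibar w)) + M) = I' + M.
    by rewrite RintegralD// ?intM//; [exact: intf|exact: icst].
  move=> h; have {}h : \forall N \near \oo, I' + M - e <=
      \int[P N]_w (f (F (random_state (Y N) (pi N) w)) + M).
    apply: h.
    - by move=> x; have := fM' (F x); lra.
    - move=> N; exact: (measurable_funD (mf N) (measurable_cst M)).
    - exact: (measurable_funD mf' (measurable_cst M)).
    - move=> x gx e' e'0; have := near_f x gx e' e'0; apply: filterS => u hu su.
      by rewrite (_ : _ - _ = f (F u) - f (F x)); [exact: hu|ring].
  apply: filterS h => N; rewrite RintegralD//; [|exact: intf|exact: icst].
  by rewrite intM -/(I N); lra.
have upp e : 0 < e -> \forall N \near \oo, I N <= I' + e.
  move=> e0; have := @integral_lower_semicontinuity (fun x => M - f (F x)) (M + M) _ _ _ _ e e0.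
  have -> : \int[P']_w (M - f (F (random_state Ybar pibar w))) = M - I'.
    by rewrite RintegralB// ?intM//; [exact: icst|exact: intf].
  move=> h; have {}h : \forall N \near \oo, M - I' - e <=
      \int[P N]_w (M - f (F (random_state (Y N) (pi N) w))).
    apply: h.
    - by move=> x; have := fM' (F x); lra.
    - move=> N; exact: (measurable_funB (measurable_cst M) (mf N)).
    - exact: (measurable_funB (measurable_cst M) mf').
    - move=> x gx e' e'0; have := near_f x gx e' e'0; apply: filterS => u hu su.
      by rewrite (_ : _ - _ = - (f (F u) - f (F x))) ?normrN; [exact: hu|ring].
  apply: filterS h => N; rewrite RintegralB//; [|exact: icst|exact: intf].
  by rewrite intM -/(I N); lra.
rewrite !preimage_setT.
rewrite (_ : (\int[P']_w _)%E = I'%:E); last first.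
  by rewrite /I' /Rintegral fineK//; apply: integrable_fin_num => //; exact: intf.
rewrite (_ : (fun N => _) = EFin \o I); last first.
  apply/funext => N /=; rewrite /I /Rintegral fineK ?preimage_setT//.
  by apply: integrable_fin_num => //; exact: intf.
apply: cvg_EFin; first exact: nearW.
apply/cvgrPdist_le => e e0; apply: filterS2 (low _ e0) (upp _ e0) => N h1 h2.
by rewrite /= ler_distl; lra.
Qed.

End mapping_theorem.

Section jump_processes.
Context {R : realType}.

Definition jump_process (x : @state R) (k : nat) : cadlag R :=
  point_process (x k).1 (x k).2.

Lemma random_jump_process_measurable d (T : measurableType d) (P : probability T R)
    (Y : nat -> {RV P >-> cadlag R}) (pi : nat -> {RV P >-> lfmeasure R}) k t :
  measurable_fun setT (fun w => jump_process (random_state Y pi w) k t).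
Proof.
apply: (point_process_measurable (Y := Y k) (pi := pi k)) => [s|B mB].
  exact: (measurableT_comp (cadlag_eval_measurable s) (measurable_funPT (Y k))).
exact: RV_eval_measurable.
Qed.

Lemma near_jump_row (x : @state R) n (U : set (cadlag 'rV[R]_n)) :
  generic_state x -> open U -> U (cadlag_row (fun i : 'I_n => jump_process x i)) ->
  \forall u \near state_nbhs x, simple_states u ->
    U (cadlag_row (fun i : 'I_n => jump_process u i)).
Proof.
move=> gx oU Ux; have [T [e [e0 hU]]] := oU _ Ux.
have := near_same_jumps n T gx e0; apply: filterS => u hu su.
apply: hU; have [lam tc hlam] := hu su; exists lam => // t /hlam[h1 h2]; split=> //.
(* One time change matches all coordinates, and the values agree exactly. *)
rewrite (_ : cadlag_row _ t = cadlag_row (fun i : 'I_n => jump_process x i) (lam t)).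
  by rewrite subrr normr0.
by apply/rowP => i; rewrite !mxE; exact: h2.
Qed.

(** In the product topology it suffices to treat one coordinate at a time, each with its own time
    change. *)
Lemma near_jump_seq (x : @state R) (U : set (prod_topology (fun _ : nat => cadlag R))) :
  generic_state x -> open U -> U (jump_process x) ->
  \forall u \near state_nbhs x, simple_states u -> U (jump_process u).
Proof.
move=> gx oU Ux.
suff : (jump_process @ within (@simple_states R) (state_nbhs x) -->
    (jump_process x : prod_topology (fun _ : nat => cadlag R))).
  by apply; exact: open_nbhs_nbhs.
apply: cvg_prod_topology => k B oB Bx; have [T [e [e0 hB]]] := oB _ Bx.
have := near_same_jumps k.+1 T gx e0; apply: filterS => u hu su.
apply: hB; have [lam tc hlam] := hu su; exists lam => // t /hlam[h1 h2]; split=> //.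
by rewrite (h2 k (ltnSn k)) subrr normr0.
Qed.

End jump_processes.

(* Indices N and k range over nat and stand for N + 1 and k + 1. *)
Theorem theorem1p1 (R : realType)
  (d : nat -> measure_display) (T : forall N, measurableType (d N))
  (P : forall N, probability (T N) R)
  (d' : measure_display) (T' : measurableType d') (P' : probability T' R)
  (Y : forall N, nat -> {RV (P N) >-> cadlag R})
  (pi : forall N, nat -> {RV (P N) >-> lfmeasure R})
  (Ybar : nat -> {RV P' >-> cadlag R})
  (pibar : nat -> {RV P' >-> lfmeasure R})
  (Y_ge0 : forall N k w t, 0 <= Y N k w t)
  (Ybar_ge0 : forall k w t, 0 <= Ybar k w t)
  (pi_iid : forall N, iid (P N) (pi N))
  (pi_poisson : forall N k, is_poisson_measure (pi N k))
  (pi_lebesgue : forall N k, has_lebesgue_intensity (pi N k))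
  (pibar_iid : iid P' pibar)
  (pibar_poisson : forall k, is_poisson_measure (pibar k))
  (pibar_lebesgue : forall k, has_lebesgue_intensity (pibar k))
  (Ypi_cvg : forall n, (0 < n)%N ->
    @cvg_in_distribution_in R
      (prod_topology (fun _ : 'I_n => (cadlag R * lfmeasure R)%type))
      [set x | forall i, simple_point_measure (x i).2]
      d T P (fun N w i => (Y N i w, pi N i w))
      d' T' P' (fun w i => (Ybar i w, pibar i w)))
  (Ybar_pibar_indep : forall k, independent_RVs P' (Ybar k) (pibar k)) :
  (forall n, (0 < n)%N ->
    @cvg_in_distribution R (cadlag 'rV[R]_n)
      d T P (fun N w => cadlag_row (fun i => point_process (Y N i w) (pi N i w)))
      d' T' P' (fun w => cadlag_row (fun i => point_process (Ybar i w) (pibar i w))))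
  /\
  @cvg_in_distribution R (prod_topology (fun _ : nat => cadlag R))
    d T P (fun N w k => point_process (Y N k w) (pi N k w))
    d' T' P' (fun w k => point_process (Ybar k w) (pibar k w)).

Proof.
have generic_ae := almost_surely_generic pibar_iid pibar_poisson pibar_lebesgue
  Ybar_pibar_indep.
split=> [n n0|].
  apply: (almost_sure_continuous_mapping Ypi_cvg generic_ae
    (F := fun x => cadlag_row (fun i : 'I_n => jump_process x i))) => [N U oU|U oU|x gx U oU Ux].
  - apply: J1_open_measurable_row => // i t; exact: random_jump_process_measurable.
  - apply: J1_open_measurable_row => // i t; exact: random_jump_process_measurable.
  - exact: near_jump_row.
apply: (almost_sure_continuous_mapping Ypi_cvg generic_ae
  (E := prod_topology (fun _ : nat => cadlag R)) (F := jump_process)) => [N U oU|U oU|x gx U oU Ux].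
- apply: J1_open_measurable_seq => // k t; exact: random_jump_process_measurable.
- apply: J1_open_measurable_seq => // k t; exact: random_jump_process_measurable.
- exact: near_jump_seq.
Qed.
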